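(* For $i=1,2$ let $K_i$ be a function field of one variable over a finite field $\mathbb{F}_i$ with $q_i=p_i^{r_i}$ elements ($p_i$ prime), and define $$G_2^{FF}(n)=\sum_{\substack{A_1,A_2\\ NA_1+NA_2=n}}\Lambda_{K_1}(A_1)\Lambda_{K_2}(A_2)\ (n\in\mathbb{N}),\qquad \Phi_2^{FF}(s)=\sum_{n=1}^{\infty}\frac{G_2^{FF}(n)}{n^s}\ (\Re s>2).$$ If $p_1=p_2$, then $\Phi_2^{FF}(s)$ can be continued meromorphically to the whole complex plane $\mathbb{C}$.
   Context: For an effective divisor $A_i$ of $K_i$, $NA_i=q_i^{\deg A_i}$; the sum defining $G_2^{FF}(n)$ runs over pairs of effective divisors $A_1$ of $K_1$ and $A_2$ of $K_2$. The von Mangoldt function is $\Lambda_{K_i}(A_i)=\log(NP_i)$ if $A_i=hP_i$ for some prime (place) $P_i$ of $K_i$ and some $h\in\mathbb{N}$, and $\Lambda_{K_i}(A_i)=0$ otherwise. The Dirichlet series $\Phi_2^{FF}(s)$ converges absolutely for $\Re s>2$. *)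

(* Defs.v *)
From HB Require Import structures.
From mathcomp Require Import all_boot all_order all_algebra all_field finmap.
From mathcomp Require Import all_classical all_reals all_analysis.
From mathcomp Require Import complex.

Set Implicit Arguments.
Unset Strict Implicit.
Unset Printing Implicit Defensive.

Import Order.TTheory GRing.Theory Num.Theory.
Import numFieldNormedType.Exports.

Local Open Scope classical_set_scope.
Local Open Scope ring_scope.

(* A function field of one variable over F is a finite extension K of a
   rational function field F(x); here F(x) is {fraction {poly F}}, x being the
   image of 'X.  F is not required to be algebraically closed in K.  The
   notions below depend on K and on the embedding of F, not on the choice
   of x. *)
Section FunctionField.
Variables (F : finFieldType) (K : fieldExtType {fraction {poly F}}).

Definition fconst (c : F) : K := (tofrac c%:P)%:A.

(* A place is given by its valuation ring, a proper subring of K containing the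
   constants and, for every x in K, containing x or x^-1. *)
Record place := Place {
  valring : set K;
  valring_const : forall c, valring (fconst c);
  valringB : forall x y, valring x -> valring y -> valring (x - y);
  valringM : forall x y, valring x -> valring y -> valring (x * y);
  valringV : forall x, valring x \/ valring x^-1;
  valring_proper : valring != setT }.

HB.instance Definition _ := gen_eqMixin place.
HB.instance Definition _ := gen_choiceMixin place.

(* The maximal ideal, made of the nonunits of the valuation ring; 0 is listed
   separately because 0^-1 = 0. *)
Definition maxideal (P : place) : set K :=
  [set x | valring P x /\ (x = 0 \/ ~ valring P x^-1)].

Definition residue_basis (P : place) (d : nat) (b : 'I_d -> K) : Prop :=
  (forall i, valring P (b i)) /\
  forall z, valring P z -> exists! c : {ffun 'I_d -> F},
    maxideal P (z - \sum_(i < d) fconst (c i) * b i).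

(* The dimension over F of the residue field at P. *)
Definition place_degree (P : place) : nat :=
  xget 0%N [set d | exists b : 'I_d -> K, residue_basis P b].

Definition effdiv := {fsfun place -> nat with 0%N}.

Definition multiple (h : nat) (P : place) : effdiv :=
  [fsfun Q in [fset P]%fset => h | 0%N].

Definition div_degree (A : effdiv) : nat :=
  (\sum_(P <- finsupp A) A P * place_degree P)%N.

Definition div_norm (A : effdiv) : nat := (#|F| ^ div_degree A)%N.

(* P is determined by the divisor hP when h > 0, so the set below has at most
   one element; xget returns 0 when it is empty. *)
Definition von_mangoldt (R : realType) (A : effdiv) : R :=
  xget 0 [set y | exists (P : place) (h : nat),
    [/\ (0 < h)%N, A = multiple h P & y = ln (div_norm (multiple 1 P))%:R]].

End FunctionField.

(* The sum is over finitely many pairs, so that the default value 0 of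
   \sum_(_ \in _) on infinite supports is not used. *)
Definition G2FF (R : realType)
    (F1 : finFieldType) (K1 : fieldExtType {fraction {poly F1}})
    (F2 : finFieldType) (K2 : fieldExtType {fraction {poly F2}})
    (n : nat) : R :=
  \sum_(A \in [set A : effdiv K1 * effdiv K2 |
                 (div_norm A.1 + div_norm A.2)%N = n])
    von_mangoldt R A.1 * von_mangoldt R A.2.

(* R[i] viewed as an abstract numClosedFieldType, to which the library attaches
   the topology of the modulus. *)
Definition Cplx (R : realType) : numClosedFieldType := R[i].

Section Complex.
Variable R : realType.
Local Notation C := (Cplx R).

Definition cexp (z : C) : C :=
  (expR (complex.Re z))%:C%C * (cos (complex.Im z) +i* sin (complex.Im z))%C.

(* Only used for n > 0. *)
Definition natpow (n : nat) (s : C) : C := cexp (s * (ln n%:R)%:C%C).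

(* Derivatives are taken over the field C itself: this is complex
   differentiability in a neighbourhood of z. *)
Definition holomorphic_at (f : C -> C) (z : C) : Prop :=
  \forall w \near z, derivable (f : C^o -> C^o) w 1.

(* On a punctured neighbourhood of z, f is g(w) / (w - z)^m with g holomorphic
   at z: f has at worst a pole at z. *)
Definition meromorphic_at (f : C -> C) (z : C) : Prop :=
  exists (m : nat) (g : C -> C), holomorphic_at g z /\
    \forall w \near z^', f w = g w / (w - z) ^+ m.

Definition meromorphic (f : C -> C) : Prop := forall z, meromorphic_at f z.

(* The Dirichlet series with coefficients a 1, a 2, ... converges to l at s. *)
Definition dirichlet_cvg (a : nat -> R) (s l : C) : Prop :=
  (\sum_(1 <= n < N) (a n)%:C%C / natpow n s : C) @[N --> \oo] --> l.

End Complex.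

(* Main.v *)
Require Import Defs.
From HB Require Import structures.
From mathcomp Require Import all_boot all_order all_algebra all_field finmap.
From mathcomp Require Import all_classical all_reals all_analysis.
From mathcomp Require Import complex.
From mathcomp Require Import zify ring lra.

Set Implicit Arguments.
Unset Strict Implicit.
Unset Printing Implicit Defensive.

Import Order.TTheory GRing.Theory Num.Theory.
Import numFieldNormedType.Exports.

Local Open Scope classical_set_scope.
Local Open Scope ring_scope.

(* Write q = #|F|, and N_k for the sum of deg P over the places P with deg P | k,
   so that the von Mangoldt function sums to N_k log q over the effective
   divisors of degree k >= 1.  Riemann's theorem gives |L(A)| = gamma q^(deg A)
   for deg A large, with a constant gamma.  Counting pairs (D, D') of effective
   divisors with D' - D - B principal turns this into a linear recurrence for
   the numbers A_n of effective divisors of degree n, hence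
   (1 - T^e) (1 - q^e T^e) Z(T) is a polynomial for Z(T) = sum_n A_n T^n, and
   n A_n = sum_k N_k A_(n-k) makes N_k an exponential sum sum_z c_z z^k; the
   crude bound N_k <= k A_k forces |z| <= q.

   So Phi is a finite combination of the double series
     sum_(k1, k2 >= 1) a^k1 b^k2 (p^(r1 k1) + p^(r2 k2))^-s.
   The shift (k1, k2) -> (k1 + r2, k2 + r1) multiplies the base by p^(r1 r2),
   so up to the factor 1 - a^r2 b^r1 p^(- r1 r2 s) the double series reduces to
   finitely many series sum_k b^k (c + Q^k)^-s.  These are continued by the
   binomial expansion of (1 + c / Q^k)^-s, whose terms are geometric in k. *)

(** * Valuation rings *)

(** All finiteness on the arithmetic side comes from one source: [dimK K + 1] elements of K are
    dependent over F[x]. Such relations, normalised so that some coefficient is a unit at the place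
    considered, give the discreteness of the valuations, the finiteness of the residue fields and
    the finiteness of the set of places above a prime. Dimensions over F are replaced by indices of
    additive groups: divisibility of indices makes q^deg / |L|, suitably scaled, a bounded integer
    that must stabilise, so neither genus nor canonical divisor occurs. It is not known in advance
    that the degree 1 is attained, hence the recurrences by steps of e, the degree of some place.
    The bound |z| <= q is all that is needed about the zeta function: it makes every geometric ratio
    less than 1 for Re s > 2. Equal characteristics enter through the shift, which needs q_1^r2 =
    q_2^r1 exactly. The Dirichlet series is summed in the order of n, so convergence has to be
    proved along the truncations q_1^k1 + q_2^k2 < N; a contraction argument does this without
    rearranging a double series. *)

Section ValuationRing.
Variables (F : finFieldType) (K : fieldExtType {fraction {poly F}}).
Variable P : place K.
Local Notation O := (valring P).
Local Notation m := (maxideal P).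

Lemma fconst_is_zmod : zmod_morphism (fconst K).
Proof. by move=> a b; rewrite /fconst polyCB tofracB scalerBl. Qed.

Lemma fconst_is_monoid : monoid_morphism (fconst K).
Proof.
split; first by rewrite /fconst polyC1 tofrac1 scale1r.
by move=> a b; rewrite /fconst polyCM tofracM -scalerA -[X in _ *: X]mul1r scalerAl.
Qed.

Lemma valring1 : O 1.
Proof. by rewrite -(fconst_is_monoid).1; exact: valring_const. Qed.

Lemma valring0 : O 0.
Proof. by rewrite -(subrr 1); apply: valringB; exact: valring1. Qed.

Lemma valringN z : O z -> O (- z).
Proof. by move=> Oz; rewrite -sub0r; apply: valringB => //; exact: valring0. Qed.

Lemma valringD y z : O y -> O z -> O (y + z).
Proof. by move=> Oy Oz; rewrite -[z]opprK; apply: valringB => //; exact: valringN. Qed.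

Lemma valring_sum (I : Type) (r : seq I) (Q : pred I) (f : I -> K) :
  (forall i, Q i -> O (f i)) -> O (\sum_(i <- r | Q i) f i).
Proof. by move=> Of; elim/big_ind: _ => //; [exact: valring0 | exact: valringD]. Qed.

Lemma valringX z k : O z -> O (z ^+ k).
Proof.
move=> Oz; elim: k => [|k IH]; first by rewrite expr0; exact: valring1.
by rewrite exprS; exact: valringM.
Qed.

Lemma maxideal_valring z : m z -> O z. Proof. by case. Qed.

Lemma maxideal0 : m 0.
Proof. by split; [exact: valring0 | left]. Qed.

Lemma maxidealN1 : ~ m 1.
Proof. by case=> _ [/eqP|]; [rewrite oner_eq0 | rewrite invr1 => /(_ valring1)]. Qed.

Lemma maxidealMl y z : O y -> m z -> m (y * z).
Proof.
move=> Oy mz; have [/eqP ->|z0] := boolP (z == 0); first by rewrite mulr0; exact: maxideal0.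
have [/eqP ->|y0] := boolP (y == 0); first by rewrite mul0r; exact: maxideal0.
case: (mz) => Oz [/eqP|nOz]; first by rewrite (negPf z0).
split; first exact: valringM.
right=> Oyz; apply: nOz.
by rewrite (_ : z^-1 = y * (y * z)^-1); [exact: valringM | field; rewrite y0 z0].
Qed.

Lemma maxidealMr y z : m y -> O z -> m (y * z).
Proof. by move=> my Oz; rewrite mulrC; exact: maxidealMl. Qed.

Lemma notin_valring z : ~ O z -> m z^-1.
Proof.
move=> nOz; split; first by case: (valringV P z).
by right; rewrite invrK.
Qed.

(** One of [y / z] and [z / y] lies in the ring, so the sum is an integral multiple of one of its
    terms. *)
Lemma maxidealD y z : m y -> m z -> m (y + z).
Proof.
wlog Oyz : y z / O (y / z).
  move=> H my mz.
  have [/H|nO] := pselect (O (y / z)); first exact.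
  rewrite addrC; apply: H => //.
  by case: (valringV P (y / z)) => //; rewrite invf_div.
move=> my mz; have [/eqP z0|z0] := boolP (z == 0); first by rewrite z0 addr0.
rewrite (_ : y + z = (y / z + 1) * z); last by field.
by apply: maxidealMl => //; apply: valringD => //; exact: valring1.
Qed.

Lemma maxidealN z : m z -> m (- z).
Proof. by move=> mz; rewrite -mulN1r; apply: maxidealMl => //; apply: valringN; exact: valring1. Qed.

Lemma maxidealB y z : m y -> m z -> m (y - z).
Proof. by move=> my mz; apply: maxidealD => //; exact: maxidealN. Qed.

Lemma maxideal_sum (I : Type) (r : seq I) (Q : pred I) (f : I -> K) :
  (forall i, Q i -> m (f i)) -> m (\sum_(i <- r | Q i) f i).
Proof. by move=> Of; elim/big_ind: _ => //; [exact: maxideal0 | exact: maxidealD]. Qed.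

Definition valunit z := [/\ z != 0, O z & O z^-1].

Lemma valunitP z : O z -> ~ m z -> valunit z.
Proof.
move=> Oz nmz; split => //; first by apply/eqP => z0; apply: nmz; rewrite z0; exact: maxideal0.
by apply: contrapT => nO; apply: nmz; split => //; right.
Qed.

Lemma valunit_notm z : valunit z -> ~ m z.
Proof. by case=> z0 _ Oz' [_ [/eqP|//]]; rewrite (negPf z0). Qed.

Lemma valunitM y z : valunit y -> valunit z -> valunit (y * z).
Proof.
move=> [y0 Oy Oy'] [z0 Oz Oz']; split; first by rewrite mulf_neq0.
- exact: valringM.
- by rewrite invfM; exact: valringM.
Qed.

Lemma valunitV z : valunit z -> valunit z^-1.
Proof. by case=> z0 Oz Oz'; split => //; rewrite ?invr_eq0 ?invrK. Qed.

Lemma valunit1 : valunit 1.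
Proof. by split; rewrite ?oner_eq0 ?invr1 //; exact: valring1. Qed.

Lemma valunitX z k : valunit z -> valunit (z ^+ k).
Proof.
move=> uz; elim: k => [|k IH]; first by rewrite expr0; exact: valunit1.
by rewrite exprS; exact: valunitM.
Qed.

Lemma maxideal_prime y z : O y -> O z -> m (y * z) -> m y \/ m z.
Proof.
move=> Oy Oz myz; have [|nmy] := pselect (m y); first by left.
have [|nmz] := pselect (m z); first by right.
by have /valunit_notm := valunitM (valunitP Oy nmy) (valunitP Oz nmz).
Qed.

Lemma valunitD y z : valunit y -> m z -> valunit (y + z).
Proof.
move=> uy mz; apply: valunitP; first by apply: valringD; [case: uy | exact: maxideal_valring].
by move=> /maxidealB/(_ mz); rewrite addrK; exact: valunit_notm.
Qed.

End ValuationRing.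

HB.instance Definition _ (F : finFieldType) (K : fieldExtType {fraction {poly F}}) :=
  GRing.isZmodMorphism.Build F K (fconst K) (fconst_is_zmod K).
HB.instance Definition _ (F : finFieldType) (K : fieldExtType {fraction {poly F}}) :=
  GRing.isMonoidMorphism.Build F K (fconst K) (fconst_is_monoid K).

(** * Polynomials in x and in its inverse, and linear relations over them *)

Section FunctionFieldPoly.
Variables (F : finFieldType) (K : fieldExtType {fraction {poly F}}).

Definition xK : K := (tofrac 'X)%:A.

Definition peval (t : K) (f : {poly F}) : K := (map_poly (fconst K) f).[t].

Lemma peval0 t : peval t 0 = 0. Proof. by rewrite /peval rmorph0 horner0. Qed.
Lemma pevalD t f g : peval t (f + g) = peval t f + peval t g.
Proof. by rewrite /peval rmorphD hornerD. Qed.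
Lemma pevalB t f g : peval t (f - g) = peval t f - peval t g.
Proof. by rewrite /peval rmorphB hornerD hornerN. Qed.
Lemma pevalM t f g : peval t (f * g) = peval t f * peval t g.
Proof. by rewrite /peval rmorphM hornerM. Qed.
Lemma pevalC t c : peval t c%:P = fconst K c.
Proof. by rewrite /peval map_polyC hornerC. Qed.
Lemma pevalX t : peval t 'X = t.
Proof. by rewrite /peval map_polyX hornerX. Qed.
Lemma pevalXn t k : peval t ('X^k) = t ^+ k.
Proof. by rewrite /peval map_polyXn hornerXn. Qed.

Lemma pevalE t f : peval t f = \sum_(i < size f) fconst K f`_i * t ^+ i.
Proof.
rewrite /peval horner_coef size_map_poly.
by apply: eq_bigr => i _; rewrite coef_map.
Qed.

Lemma peval_xK f : peval xK f = (tofrac f)%:A.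
Proof.
elim/poly_ind: f => [|f c IH]; first by rewrite peval0 tofrac0 scale0r.
rewrite pevalD pevalM IH pevalX pevalC /fconst tofracD tofracM scalerDl.
by congr (_ + _); rewrite -scalerA -[X in _ = _ *: X]mul1r scalerAl.
Qed.

Lemma peval_xK_eq0 f : peval xK f = 0 -> f = 0.
Proof.
by rewrite peval_xK => /eqP; rewrite scaler_eq0 oner_eq0 orbF tofrac_eq0 => /eqP.
Qed.

Lemma xK_neq0 : xK != 0.
Proof. by apply/eqP => x0; have /eqP := @peval_xK_eq0 'X (etrans (pevalX _) x0); rewrite polyX_eq0. Qed.

Lemma frac_repr (a : {fraction {poly F}}) :
  exists p : {poly F} * {poly F}, p.2 != 0 /\ a * tofrac p.2 = tofrac p.1.
Proof.
elim/quotW: a => -[[p q] /= q0]; exists (p, q); split => //=.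
unlock tofrac; rewrite -[LHS]FracField.pi_mul; apply/eqmodP; rewrite /= FracField.equivfE.
by rewrite /FracField.mulf /= !numden_Ratio ?(oner_neq0, mul1r, mulr1) //= mulrC.
Qed.

Lemma common_denom (I : finType) (a : I -> {fraction {poly F}}) :
  exists d : {poly F}, d != 0 /\ exists f : I -> {poly F}, forall i, a i * tofrac d = tofrac (f i).
Proof.
have [p hp] : {p : I -> {poly F} * {poly F} & forall i, (p i).2 != 0 /\ a i * tofrac (p i).2 = tofrac (p i).1}.
  by apply: (@choice _ _ (fun i q => q.2 != 0 /\ a i * tofrac q.2 = tofrac q.1)) => i; exact: frac_repr.
exists (\prod_i (p i).2); split; first by rewrite prodf_seq_neq0; apply/allP => i _; case: (hp i).
exists (fun i => (p i).1 * \prod_(j | j != i) (p j).2) => i.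
by rewrite (bigD1 i) //= !tofracM mulrA (hp i).2.
Qed.

Definition dimK := (\dim {:K})%N.

(** Denominators are cleared in a relation over F(x). The finiteness of K over F(x) enters the proof
    only here. *)
Lemma dependent_xK (z : 'I_dimK.+1 -> K) : exists f : 'I_dimK.+1 -> {poly F},
  (exists i, f i != 0) /\ \sum_i peval xK (f i) * z i = 0.
Proof.
have : ~~ free [tuple z i | i < dimK.+1].
  apply/negP => /eqP fr.
  have := dimvS (subvf <<[tuple z i | i < dimK.+1]>>).
  by rewrite fr size_tuple ltnn.
move=> /freeP nf.
have [a [suma [i ai]]] : exists a : 'I_dimK.+1 -> {fraction {poly F}},
    \sum_i a i *: z i = 0 /\ exists i, a i != 0.
  apply: contrapT => H; apply: nf => a suma i; apply/eqP; apply: contrapT => /negP ai.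
  apply: H; exists a; split; last by exists i.
  rewrite -[RHS]suma; apply: eq_bigr => j _; congr (_ *: _).
  by rewrite -tnth_nth tnth_mktuple.
have [d [d0 [f hf]]] := common_denom a; exists f; split.
  have td0 : tofrac d != 0 by rewrite tofrac_eq0.
  by exists i; have := mulf_neq0 ai td0; rewrite hf tofrac_eq0.
rewrite -[RHS](scaler0 _ (tofrac d)) -[in RHS]suma scaler_sumr; apply: eq_bigr => j _.
rewrite peval_xK mulr_algl -hf (mulrC (a j)).
by rewrite -(scalerA (tofrac d) (a j) (z j)).
Qed.

(* Multiplying by a high power of [x^-1] turns polynomials in [x] into
   polynomials in [x^-1]. *)
Lemma peval_xKV (f : {poly F}) N : (size f <= N.+1)%N ->
  peval xK^-1 (\poly_(i < N.+1) f`_(N - i)) = xK^-1 ^+ N * peval xK f.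
Proof.
move=> sf; rewrite /peval (@horner_coef_wide _ N.+1); last first.
  by rewrite size_map_poly; exact: size_poly.
rewrite (@horner_coef_wide _ N.+1 (map_poly _ f)) ?size_map_poly // mulr_sumr.
rewrite [RHS](reindex_inj rev_ord_inj) /=; apply: eq_bigr => i _.
rewrite !coef_map coef_poly ltn_ord subSS mulrCA; congr (_ * _).
have iN : (i <= N)%N by rewrite -ltnS.
by rewrite -[in X in X * _](subnK iN) exprD mulrAC -exprMn mulVf ?xK_neq0 // expr1n mul1r.
Qed.

Lemma peval_xKV_eq0 f : peval xK^-1 f = 0 -> f = 0.
Proof.
move=> f0; have [//|fn0] := eqVneq f 0.
have szf : (size f).-1.+1 = size f by rewrite prednK // size_poly_gt0.
pose g := \poly_(i < (size f).-1.+1) f`_((size f).-1 - i).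
have : peval xK g = 0.
  have := @peval_xKV g (size f).-1 (size_poly _ _).
  set h := \poly_(i < _) _; have -> : h = f.
    apply/polyP => i; rewrite !coef_poly; case: ltnP => iN.
      by rewrite subKn // ltnS leq_subr.
    by rewrite nth_default // -szf.
  rewrite f0 => /esym/eqP; rewrite mulf_eq0 expf_eq0 invr_eq0 (negPf xK_neq0) andbF /=.
  by move/eqP.
move/peval_xK_eq0 => g0; have : g`_0 = 0 by rewrite g0 coef0.
by rewrite coef_poly subn0 /= => /eqP; rewrite lead_coef_eq0 (negPf fn0).
Qed.

(** A valuation ring contains x or its inverse, so at each place one of the two is an integral
    transcendental element. *)
Definition parameter (t : K) := t = xK \/ t = xK^-1.

Lemma peval_eq0 t f : parameter t -> peval t f = 0 -> f = 0.
Proof. by case=> ->; [exact: peval_xK_eq0 | exact: peval_xKV_eq0]. Qed.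

Lemma dependent t (z : 'I_dimK.+1 -> K) : parameter t ->
  exists f : 'I_dimK.+1 -> {poly F},
  (exists i, f i != 0) /\ \sum_i peval t (f i) * z i = 0.
Proof.
case=> ->; first exact: dependent_xK.
have [f [[i fi] sumf]] := dependent_xK z.
pose N := (\max_i size (f i))%N.
have szf j : (size (f j) <= N.+1)%N by rewrite leqW // (leq_bigmax j).
exists (fun j => \poly_(k < N.+1) (f j)`_(N - k)); split.
  exists i; apply/eqP => /(congr1 (peval xK^-1)); rewrite peval_xKV // peval0 => /eqP.
  rewrite mulf_eq0 expf_eq0 invr_eq0 (negPf xK_neq0) andbF /= => /eqP.
  by move/peval_xK_eq0 => /eqP; rewrite (negPf fi).
transitivity (xK^-1 ^+ N * \sum_j peval xK (f j) * z j); last by rewrite sumf mulr0.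
by rewrite mulr_sumr; apply: eq_bigr => j _; rewrite peval_xKV // mulrA.
Qed.

(** The factor p is divided out of all coefficients as long as possible; the total size drops each
    time. At a place above p the coefficient prime to p is a unit, which is how the relations are
    exploited below. *)
Lemma dependent_prim t (p : {poly F}) (z : 'I_dimK.+1 -> K) : parameter t -> (1 < size p)%N ->
  exists f : 'I_dimK.+1 -> {poly F},
  (exists i, ~~ (p %| f i)) /\ \sum_i peval t (f i) * z i = 0.
Proof.
move=> pt sp; have [f] := dependent z pt.
have [N] := ubnP (\sum_i size (f i))%N.
elim: N f => // N IH f fN [[i fi] sumf].
have [H|H] := pselect (exists i, ~~ (p %| f i)); first by exists f.
have pf j : p %| f j by apply: contrapT => /negP nj; apply: H; exists j.
have p0 : p != 0 by rewrite -size_poly_gt0 ltnW.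
have fE j : f j = f j %/ p * p by rewrite divpK.
apply: (IH (fun j => f j %/ p)); last split.
- rewrite ltnS in fN; apply: leq_trans fN; rewrite [X in (_ < X)%N](bigD1 i) //= (bigD1 i) //=.
  rewrite -addSn leq_add //; last by apply: leq_sum => j _; rewrite size_divp // leq_subr.
  by rewrite size_divp // ltn_subrL size_poly_gt0 fi; move: sp; case: (size p) => [|[]].
- by exists i; apply: contra_neq fi => e; rewrite fE e mul0r.
apply/eqP; move/eqP: sumf.
have -> : \sum_j peval t (f j) * z j = peval t p * \sum_j peval t (f j %/ p) * z j.
  by rewrite mulr_sumr; apply: eq_bigr => j _; rewrite {1}fE pevalM mulrAC mulrC mulrA.
by rewrite mulf_eq0 => /orP[/eqP/(peval_eq0 pt)/eqP|//]; rewrite (negPf p0).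
Qed.

End FunctionFieldPoly.

Arguments dimK {F} K.
Arguments xK {F} K.

Lemma div_mul_cancel (E : fieldType) (a b u : E) : u != 0 -> u * (a / (u * b)) = a / b.
Proof. by move=> u0; rewrite invfM mulrCA mulVKf. Qed.

Lemma div_div_cancel (E : fieldType) (z a b : E) : z != 0 -> z / a / (z / b) = b / a.
Proof. by move=> z0; rewrite invf_div mulrC mulrA divfK. Qed.

(** * Discreteness of the valuations *)

Section Uniformizer.
Variables (F : finFieldType) (K : fieldExtType {fraction {poly F}}).
Implicit Type P : place K.

Lemma peval1 t : peval t 1 = 1 :> K.
Proof. by rewrite -polyC1 pevalC rmorph1. Qed.

Lemma pevalXp (t : K) (f : {poly F}) k : peval t (f ^+ k) = peval t f ^+ k.
Proof. by elim: k => [|k IH]; rewrite ?expr0 ?peval1 // !exprS pevalM IH. Qed.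

Lemma peval_valring P t f : valring P t -> valring P (peval t f).
Proof.
move=> Ot; rewrite pevalE; apply: valring_sum => i _.
by apply: valringM; [exact: valring_const | exact: valringX].
Qed.

Lemma fconst_unit P c : c != 0 -> valunit P (fconst K c).
Proof.
move=> c0; split; first by rewrite fmorph_eq0.
  exact: valring_const.
by rewrite -fmorphV; exact: valring_const.
Qed.

(** [p] generates the prime ideal that the maximal ideal of P cuts out in F[t]. *)
Record lies_over P t p : Prop := Over {
  over_param : parameter t;
  over_valring : valring P t;
  over_irr : irreducible_poly p;
  over_max : maxideal P (peval t p) }.

Lemma over_unit P t p f : lies_over P t p -> ~~ (p %| f) -> valunit P (peval t f).
Proof.
move=> [pt Ot ip mp] npf.
have /Bezout_eq1_coprimepP [[u v] /= uv] : coprimep p f by rewrite irreducible_poly_coprime.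
apply: valunitP; first exact: peval_valring.
move=> mf; apply: (@maxidealN1 _ _ P).
have <- : peval t (u * p + v * f) = 1 by rewrite uv peval1.
by rewrite pevalD !pevalM; apply: maxidealD; apply: maxidealMl => //; exact: peval_valring.
Qed.

Lemma over_neq0 P t p : lies_over P t p -> peval t p != 0.
Proof.
move=> o; apply/eqP => /(peval_eq0 (over_param o)) p0.
by have := irredp_neq0 (over_irr o); rewrite p0 eqxx.
Qed.

Lemma irreducible_in_maxideal P t (f : {poly F}) : parameter t -> valring P t ->
  f != 0 -> maxideal P (peval t f) -> exists p, lies_over P t p.
Proof.
move=> pt Ot; have [N] := ubnP (size f); elim: N f => // N IH f; rewrite ltnS => sN f0 mf.
have sf1 : (1 < size f)%N.
  rewrite ltnNge; apply/negP => /size1_polyC e; rewrite e pevalC in mf.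
  apply: (valunit_notm _ mf); apply: fconst_unit; apply: contra_neq f0 => c0.
  by rewrite e c0.
have [ir|nir] := pselect (forall q : {poly F}, size q != 1%N -> q %| f -> q %= f).
  by exists f; split.
have [q [q1 qf nqf]] : exists q : {poly F}, [/\ size q != 1%N, q %| f & ~~ (q %= f)].
  apply: contrapT => H; apply: nir => q q1 qf; apply: contrapT => /negP nqf.
  by apply: H; exists q.
have fE : f = f %/ q * q by rewrite divpK.
have q0 : q != 0 by apply: contra_neq f0 => q0; rewrite fE q0 mulr0.
have d0 : f %/ q != 0 by apply: contra_neq f0 => d0; rewrite fE d0 mul0r.
have qlt : (size q < size f)%N.
  rewrite ltn_neqAle dvdp_leq // andbT; apply: contra nqf => /eqP e.
  by rewrite -dvdp_size_eqp // e.
have dlt : (size (f %/ q)%R < size f)%N.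
  rewrite size_divp // ltn_subrL size_poly_gt0 f0 andbT.
  by move: q1 q0; rewrite -size_poly_gt0; case: (size q) => [|[]].
move: mf; rewrite fE pevalM => /maxideal_prime -/(_ (peval_valring _ Ot) (peval_valring _ Ot)) [] mf.
  by apply: (IH (f %/ q)) => //; exact: leq_trans sN.
by apply: (IH q) => //; exact: leq_trans sN.
Qed.

Lemma exists_over P : exists t p, lies_over P t p.
Proof.
have [Ox|nOx] := pselect (valring P (xK K)); last first.
  exists (xK K)^-1, 'X; split; [by right | by case: (valringV P (xK K)) | | ].
    by have := irredp_XsubC (0 : F); rewrite subr0.
  by rewrite pevalX; exact: notin_valring.
suff [f [f0 nu]] : exists f : {poly F}, f != 0 /\ ~ valunit P (peval (xK K) f).
  have [p op] : exists p, lies_over P (xK K) p.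
    apply: (@irreducible_in_maxideal P _ f) => //; first by left.
    apply: contrapT => nm; apply: nu; apply: valunitP nm; exact: peval_valring.
  by exists (xK K), p.
apply: contrapT => H.
have U f : f != 0 -> valunit P (peval (xK K) f).
  by move=> f0; apply: contrapT => nu; apply: H; exists f.
have [z nOz] : exists z, ~ valring P z.
  apply: contrapT => nz; have /eqP := valring_proper P; apply.
  by apply/seteqP; split => // z _; apply: contrapT => nOz; apply: nz; exists z.
have mz := notin_valring nOz.
have z0 : z != 0 by apply/eqP => z0; apply: nOz; rewrite z0; exact: valring0.
(* If all nonzero polynomials in x were units at P, an equation for z divided by its highest power
   of z would write the top coefficient, a unit, as a sum of multiples of z^-1, which lies in the
   maximal ideal. *)
have [f [[i0 fi0] sumf]] := dependent_xK (fun i => z ^+ i).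
case: (@arg_maxnP _ i0 (fun i => f i != 0) (fun i => i : nat) fi0) => j fj maxj.
have [_ _ _] := U _ fj; apply: valunit_notm (U _ fj) _.
have -> : peval (xK K) (f j) = - \sum_(i | i != j) peval (xK K) (f i) * z ^+ i / z ^+ j.
  apply/eqP; rewrite -addr_eq0 -mulr_suml -[X in X + _](mulfK (expf_neq0 j z0)) -mulrDl.
  by move: sumf; rewrite (bigD1 j) //= => ->; rewrite mul0r.
apply: maxidealN; apply: maxideal_sum => i ij.
have [/eqP ->|fi] := boolP (f i == 0); first by rewrite peval0 !mul0r; exact: maxideal0.
have lij : (i < j)%N by rewrite ltn_neqAle ij; exact: maxj.
rewrite -mulrA; apply: maxidealMl; first exact: peval_valring.
rewrite -(subnK (ltnW lij)) exprD invfM mulrCA mulfV ?expf_neq0 // mulr1 -exprVn.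
rewrite -(subnSK lij) exprS; apply: maxidealMr => //.
by apply: valringX; exact: maxideal_valring.
Qed.

(** The ramification index is at most [K : F(x)]. The elements 1 = z_0, ..., z_m are strictly
    increasing for divisibility and strictly divide p(t). In a primitive relation between them, the
    first term with a coefficient prime to p would strictly divide all the others, so it could not
    cancel. *)
Lemma chain_bound P t p (z : nat -> K) m : lies_over P t p -> z 0%N = 1 ->
  (forall i, (i <= m)%N -> z i != 0) ->
  (forall i, (i < m)%N -> maxideal P (z i.+1 / z i)) ->
  maxideal P (peval t p / z m) -> (m < dimK K)%N.
Proof.
move=> o z1 z0 zS wz; rewrite ltnNge; apply/negP => dm.
have ratio i j : (i < j <= m)%N -> maxideal P (z j / z i).
  elim: j => // j IH /andP[]; rewrite ltnS leq_eqVlt => /orP[/eqP -> jm|ij jm]; first exact: zS.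
  have -> : z j.+1 / z i = (z j.+1 / z j) * (z j / z i).
    by rewrite mulrA divfK // z0 // ltnW.
  apply: maxidealMl; last by apply: IH; rewrite ij ltnW.
  exact/maxideal_valring/zS.
have zO i : (i <= m)%N -> valring P (z i).
  case: i => [_|i im]; first by rewrite z1; exact: valring1.
  by have := @ratio 0%N i.+1; rewrite im z1 divr1 => /(_ isT) /maxideal_valring.
have wzO i : (i <= m)%N -> maxideal P (peval t p / z i).
  rewrite leq_eqVlt => /orP[/eqP -> //|im].
  have -> : peval t p / z i = (peval t p / z m) * (z m / z i) by rewrite mulrA divfK // z0.
  by apply: maxidealMr => //; apply: maxideal_valring; apply: ratio; rewrite im /=.
have [f [[i0 fi0] sumf]] := @dependent_prim _ _ t p (fun i => z i) (over_param o) (over_irr o).1.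
case: (@arg_minnP _ i0 (fun i => ~~ (p %| f i)) (fun i => i : nat) fi0) => j fj minj.
have im (i : 'I_(dimK K).+1) : (i <= m)%N by apply: leq_trans dm; rewrite -ltnS.
apply: valunit_notm (over_unit o fj) _.
have -> : peval t (f j) = - \sum_(i | i != j) peval t (f i) * z i / z j.
  apply/eqP; rewrite -addr_eq0 -mulr_suml -[X in X + _](mulfK (z0 j (im j))) -mulrDl.
  by move: sumf; rewrite (bigD1 j) //= => ->; rewrite mul0r.
apply: maxidealN; apply: maxideal_sum => i ij.
have [/minj ji|] := boolP (~~ (p %| f i)).
  rewrite -mulrA; apply: maxidealMl; first exact: peval_valring (over_valring o).
  by apply: ratio; rewrite im andbT ltn_neqAle ji andbT eq_sym.
rewrite negbK => /dvdpP[g ->]; rewrite pevalM.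
have -> : peval t g * peval t p * z i / z j = (peval t g * z i) * (peval t p / z j) by ring.
apply: maxidealMl; last exact: wzO.
by apply: valringM; [exact: peval_valring (over_valring o) | exact: zO].
Qed.

(** Otherwise every nonzero element of the maximal ideal would be a product of two such elements;
    splitting p(t) repeatedly would give chains of any length, against [chain_bound]. *)
Lemma exists_uniformizer P :
  exists u, [/\ maxideal P u, u != 0 & forall y, maxideal P y -> valring P (y / u)].
Proof.
have [t [p o]] := exists_over P; have w0 := over_neq0 o; have mw := over_max o.
apply: contrapT => H.
have [g hg] : {g : K -> K & forall u, maxideal P u -> u != 0 ->
    [/\ maxideal P (g u), g u != 0 & maxideal P (u / g u)]}.
  apply: (@choice _ _ (fun u y => maxideal P u -> u != 0 ->
    [/\ maxideal P y, y != 0 & maxideal P (u / y)])) => u.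
  have [mu|nm] := pselect (maxideal P u); last by exists 0.
  have [u0|/negP nu] := boolP (u == 0); first by exists 0 => _ /negP.
  have [y [my nO]] : exists y, maxideal P y /\ ~ valring P (y / u).
    apply: contrapT => H'; apply: H; exists u; split => //; first exact/negP.
    by move=> y my; apply: contrapT => nO; apply: H'; exists y.
  exists y => _ _; split => //.
    by apply/eqP => y0; apply: nO; rewrite y0 mul0r; exact: valring0.
  by have := notin_valring nO; rewrite invf_div.
pose x i := iter i g (peval t p).
have hx i : maxideal P (x i) /\ x i != 0.
  by elim: i => [//|i [mi xi0]]; case: (hg _ mi xi0).
have rx i : maxideal P (x i / x i.+1) by case: (hx i) => mi xi0; case: (hg _ mi xi0).
suff : (dimK K < dimK K)%N by rewrite ltnn.
(* The chain has to increase, so the successive divisors of p(t) are listed backwards, after 1. *)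
apply: (@chain_bound P t p (fun i => if i is i'.+1 then x (dimK K - i')%N else 1)) => //.
- by move=> [|i] _; rewrite ?oner_eq0 //; case: (hx (dimK K - i)%N).
- move=> [|i] im; first by rewrite divr1 subn0; case: (hx (dimK K)).
  by rewrite -(subnSK (ltnW im)); exact: rx.
case: (dimK K) => [|d]; first by rewrite divr1.
by rewrite subSn // subnn; exact: (rx 0%N).
Qed.

Definition uniformizer P : K := projT1 (cid (exists_uniformizer P)).

Lemma uniformizerP P : [/\ maxideal P (uniformizer P), uniformizer P != 0 &
  forall y, maxideal P y -> valring P (y / uniformizer P)].
Proof. exact: projT2 (cid (exists_uniformizer P)). Qed.

Lemma uniformizer_neq0 P : uniformizer P != 0.
Proof. by case: (uniformizerP P). Qed.

Lemma valunit_of_bound P (z : K) k : z != 0 -> valring P z -> ~ valring P (z / uniformizer P ^+ k) ->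
  exists l : nat, valunit P (z / uniformizer P ^+ l).
Proof.
have [mu u0 umax] := uniformizerP P.
move=> z0 Oz; elim: k => [|k IH] nO; first by rewrite expr0 divr1 in nO.
have [Ok|] := pselect (valring P (z / uniformizer P ^+ k)); last exact: IH.
exists k; apply: valunitP => // /umax; rewrite -mulrA -invfM -exprSr => Ok'.
exact: nO.
Qed.

Lemma exists_val P (z : K) : z != 0 -> exists k : int, valunit P (z / uniformizer P ^ k).
Proof.
have [mu u0 umax] := uniformizerP P; set u := uniformizer P in mu u0 umax *.
have [t [p o]] := exists_over P; have w0 := over_neq0 o; have mw := over_max o.
have Xu i : u ^+ i != 0 by rewrite expf_neq0.
(* p(t) has finite order: if it were divisible by all powers of the uniformizer, these powers would
   form a chain of length [dimK K]. *)
have [l ul] : exists l : nat, valunit P (peval t p / u ^+ l).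
  have [[k]|nO] := pselect (exists k, ~ valring P (peval t p / u ^+ k)).
    apply: valunit_of_bound => //; exact: maxideal_valring.
  suff : (dimK K < dimK K)%N by rewrite ltnn.
  apply: (@chain_bound P t p (fun i => u ^+ i)) => //.
    by move=> i _; rewrite exprS mulfK.
  have -> : peval t p / u ^+ dimK K = u * (peval t p / u ^+ (dimK K).+1).
    by rewrite exprS div_mul_cancel.
  apply: maxidealMr => //; apply: contrapT => nO'; apply: nO; by exists (dimK K).+1.
wlog Oz : z / valring P z.
  move=> H z0; have [|nO] := pselect (valring P z); first by move/H; exact.
  have Oz' : valring P z^-1 by case: (valringV P z).
  have [|k uk] := H _ Oz'; first by rewrite invr_eq0.
  exists (- k); have := valunitV uk; rewrite invf_div mulrC.
  by rewrite -invr_expz !invrK.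
move=> z0.
(* The lowest nonzero coefficient of an equation for z over F[t] is a multiple of z in the ring. So
   the order of z is at most the order [l * s] of that coefficient, where p^s is the exact power of
   p dividing it. *)
have [f [[i0 fi0] sumf]] := dependent (fun i => z ^+ i) (over_param o).
case: (@arg_minnP _ i0 (fun i => f i != 0) (fun i => i : nat) fi0) => j fj minj.
have Ofz : valring P (peval t (f j) / z).
  have -> : peval t (f j) / z = - \sum_(i | i != j) peval t (f i) * z ^+ i / z ^+ j / z.
    apply/eqP; rewrite -addr_eq0 -!mulr_suml -mulrDl -[X in X + _](mulfK (expf_neq0 j z0)) -mulrDl.
    by move: sumf; rewrite (bigD1 j) //= => ->; rewrite !mul0r.
  apply: valringN; apply: valring_sum => i ij.
  have [/eqP ->|fi] := boolP (f i == 0); first by rewrite peval0 !mul0r; exact: valring0.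
  have lij : (j < i)%N by rewrite ltn_neqAle eq_sym ij; exact: minj.
  rewrite -!mulrA; apply: valringM; first exact: peval_valring (over_valring o).
  rewrite (_ : z ^+ i * _ = z ^+ (i - j.+1)); first exact: valringX.
  by rewrite -{1}(subnK lij) exprD exprS !mulrA mulfK ?expf_neq0 // mulfK.
have [s [g [fE pg]]] : exists s g, f j = p ^+ s * g /\ ~~ (p %| g).
  have p1 := (over_irr o).1.
  have [N] := ubnP (size (f j)); elim: N (f j) fj => // N IH h h0; rewrite ltnS => sh.
  have [/dvdpP[h' hE]|] := boolP (p %| h); last by exists 0%N, h; rewrite expr0 mul1r.
  have h'0 : h' != 0 by apply: contra_neq h0 => h'0; rewrite hE h'0 mul0r.
  have [] := IH _ h'0; last first.
    by move=> s [g [e pg]]; exists s.+1, g; rewrite exprS -mulrA -e mulrC.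
  apply: leq_trans sh; rewrite hE size_mul ?(irredp_neq0 (over_irr o)) //.
  move: p1; case: (size p) => [|[|k]] // _; rewrite addnS /= addnS ltnS leq_addr //.
suff [k nO] : exists k, ~ valring P (z / u ^+ k).
  have [m um] := valunit_of_bound z0 Oz nO; by exists m%:Z.
exists (l * s).+1 => Oz'.
have : valunit P (peval t (f j) / u ^+ (l * s)).
  rewrite fE pevalM pevalXp exprM mulrAC -expr_div_n; apply: valunitM.
    exact: valunitX.
  exact: over_unit o pg.
move=> /valunit_notm; apply.
rewrite (_ : _ / _ = u * ((peval t (f j) / z) * (z / u ^+ (l * s).+1))).
  by apply: maxidealMr => //; exact: valringM.
by rewrite exprS (mulrA (peval t (f j) / z)) divfK // div_mul_cancel.
Qed.

End Uniformizer.

(** * Indices of additive subgroups *)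

Section Index.
Variable M : comNzRingType.
Implicit Types V U W : set M.

Definition zgroup V := V 0 /\ forall x y, V x -> V y -> V (x - y).

Lemma zgroupN V x : zgroup V -> V x -> V (- x).
Proof. by move=> [V0 VB] Vx; rewrite -sub0r; exact: VB. Qed.

Lemma zgroupD V x y : zgroup V -> V x -> V y -> V (x + y).
Proof. by move=> gV Vx Vy; rewrite -[y]opprK; apply: gV.2 => //; exact: zgroupN. Qed.

Lemma zgroup_sum V (I : Type) (r : seq I) (Q : pred I) (f : I -> M) : zgroup V ->
  (forall i, Q i -> V (f i)) -> V (\sum_(i <- r | Q i) f i).
Proof. by move=> gV Vf; elim/big_ind: _ => //; [exact: gV.1 | move=> x y; exact: zgroupD]. Qed.

Definition transversal (T : Type) V U (r : T -> M) :=
  [/\ forall i, V (r i), forall i j, U (r i - r j) -> i = j &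
      forall z, V z -> exists i, U (z - r i)].

(* [U] has index [N] in [V]. *)
Definition idx V U (N : nat) := exists r : 'I_N -> M, transversal V U r.

Lemma transversal_idx (T : finType) V U (r : T -> M) : transversal V U r -> idx V U #|T|.
Proof.
move=> [rV rI rS]; exists (fun i => r (enum_val i)); split=> //.
  by move=> i j /rI/enum_val_inj.
by move=> z /rS[i Ui]; exists (enum_rank i); rewrite enum_rankK.
Qed.

Lemma idx_inj (T : finType) V U N (f : T -> M) : zgroup U -> idx V U N ->
  (forall i, V (f i)) -> (forall i j, U (f i - f j) -> i = j) -> (#|T| <= N)%N.
Proof.
move=> gU [r [rV rI rS]] fV fI.
have [g hg] : {g : T -> 'I_N & forall i, U (f i - r (g i))}.
  by apply: (@choice _ _ (fun i j => U (f i - r j))) => i; apply: rS.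
rewrite -[X in (_ <= X)%N]card_ord; apply: (@leq_card _ _ g) => i j e; apply: fI.
rewrite (_ : _ - _ = (f i - r (g i)) - (f j - r (g j))); first by apply: gU.2.
by rewrite e opprB addrA subrK.
Qed.

Lemma idx_surj (T : finType) V U (f : T -> M) : zgroup U -> (forall i, V (f i)) ->
  (forall z, V z -> exists i, U (z - f i)) -> exists N, idx V U N /\ (N <= #|T|)%N.
Proof.
move=> gU fV fS.
pose E t t' := `[<U (f t - f t')>].
pose rep t := odflt t [pick t' | E t t'].
have Erep t : U (f t - f (rep t)).
  rewrite /rep; case: pickP => [t' /asboolP //|/(_ t)/asboolP[]].
  by rewrite subrr; exact: gU.1.
have repE t t' : U (f t - f t') -> rep t = rep t'.
  move=> Utt'; rewrite /rep.
  have -> : [pick t'' | E t t''] = [pick t'' | E t' t''].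
    apply: eq_pick => s; apply: asbool_equiv_eq; split=> H.
      rewrite (_ : _ - _ = (f t - f s) - (f t - f t')); first exact: gU.2.
      by rewrite opprB [RHS]addrC addrA subrK.
    rewrite (_ : _ - _ = (f t - f t') + (f t' - f s)); first exact: zgroupD.
    by rewrite addrA subrK.
  case: pickP => //= /(_ t')/asboolP[]; rewrite subrr; exact: gU.1.
pose S := [set rep t | t in T]%SET.
exists #|S|; split; last by apply: leq_trans (leq_imset_card _ _) _; rewrite max_card.
exists (fun i => f (enum_val i)); split=> //.
  move=> i j Uij; apply: enum_val_inj; move: Uij.
  have /imsetP[s _ ->] := enum_valP i; have /imsetP[s' _ ->] := enum_valP j => Us.
  apply: repE.
  rewrite (_ : _ - _ = (f s - f (rep s)) + (f (rep s) - f (rep s')) + (f (rep s') - f s')).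
    apply: zgroupD => //; first exact: zgroupD.
    by rewrite -opprB; exact: zgroupN.
  by ring.
move=> z /fS[t Ut]; have rS : rep t \in S by apply/imsetP; exists t.
exists (enum_rank_in rS (rep t)); rewrite enum_rankK_in //.
by rewrite -[z](subrK (f t)) -addrA; exact: zgroupD.
Qed.

Lemma idx_uniq V U N N' : zgroup U -> idx V U N -> idx V U N' -> N = N'.
Proof.
move=> gU iN iN'; apply/eqP; rewrite eqn_leq.
have [r [rV rI _]] := iN; have [r' [rV' rI' _]] := iN'.
by have := idx_inj gU iN' rV rI; have := idx_inj gU iN rV' rI'; rewrite !card_ord => -> ->.
Qed.

Lemma idx_gt0 V U N : V 0 -> idx V U N -> (0 < N)%N.
Proof. by move=> V0 [r [_ _ /(_ _ V0)[i _]]]; case: N r i => // r []. Qed.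

Lemma idx_tower V U W N N' : zgroup V -> zgroup U -> U `<=` V -> W `<=` U ->
  idx V U N -> idx U W N' -> idx V W (N * N').
Proof.
move=> gV gU UV WU [r [rV rI rS]] [s [sU sI sS]].
rewrite -[X in (X * _)%N]card_ord -[X in (_ * X)%N]card_ord -card_prod.
apply: (@transversal_idx _ _ _ (fun ij => r ij.1 + s ij.2)); split.
- by move=> [i j]; apply: zgroupD => //; exact: UV.
- move=> [i j] [i' j'] /= Wij; have e : i = i'.
    apply: rI; rewrite (_ : _ - _ = (r i + s j - (r i' + s j')) - (s j - s j')).
      by apply: gU.2; [exact: WU | exact: gU.2].
    by rewrite opprD addrACA addrK.
  move: Wij; rewrite e; rewrite opprD addrACA subrr add0r => /sI ->.
  by [].
- move=> z /rS[i Ui]; have [j Wj] := sS _ Ui; exists (i, j) => /=.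
  by rewrite opprD addrA.
Qed.

(** Second isomorphism theorem: every class modulo U meets V', so the representatives can be moved
    into V'. *)
Lemma idx_eqmod V U N V' : zgroup U -> zgroup V' -> V' `<=` V ->
  (forall z, V z -> exists2 z', V' z' & U (z - z')) ->
  idx V U N -> idx V' (U `&` V') N.
Proof.
move=> gU gV' V'V H [r [rV rI rS]].
have [r' hr'] : {r' : 'I_N -> M & forall i, V' (r' i) /\ U (r i - r' i)}.
  apply: (@choice _ _ (fun i y => V' y /\ U (r i - y))) => i.
  by have [y] := H _ (rV i); exists y.
exists r'; split; first by move=> i; case: (hr' i).
  move=> i j [Uij _]; apply: rI.
  rewrite (_ : _ - _ = (r i - r' i) + (r' i - r' j) - (r j - r' j)); last by ring.
  by apply: gU.2; [apply: zgroupD => // |]; [case: (hr' i) | case: (hr' j)].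
move=> z V'z; have [i Ui] := rS _ (V'V _ V'z); exists i; split.
  rewrite (_ : _ - _ = (z - r i) + (r i - r' i)); last by ring.
  by apply: zgroupD => //; case: (hr' i).
by apply: gV'.2 => //; case: (hr' i).
Qed.

Lemma idx_sub V U W N : zgroup V -> zgroup U -> zgroup W -> U `<=` V -> W `<=` U ->
  idx V W N -> exists a b, [/\ idx V U a, idx U W b & N = (a * b)%N].
Proof.
move=> gV gU gW UV WU iN; have [r [rV rI rS]] := iN.
have [a [ia _]] : exists a, idx V U a /\ (a <= #|'I_N|)%N.
  apply: (@idx_surj _ _ _ r) => // z /rS[i Wi]; exists i; exact: WU.
pose T := {i : 'I_N | `[<U (r i)>]}.
have [b [ib _]] : exists b, idx U W b /\ (b <= #|{: T}|)%N.
  apply: (@idx_surj _ _ _ (fun i : T => r (val i))) => //.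
    by move=> [i /= /asboolP].
  move=> z Uz; have [i Wi] := rS _ (UV _ Uz).
  have Ui : `[<U (r i)>].
    apply/asboolP; rewrite (_ : r i = z - (z - r i)); last by ring.
    by apply: gU.2 => //; exact: WU.
  by exists (exist _ i Ui).
exists a, b; split=> //; apply: (idx_uniq gW iN); exact: idx_tower ia ib.
Qed.

(** The quotient of V' embeds into that of V with image (U + V') / U, and Lagrange's theorem
    applies. Divisibility, not only the inequality, is used in [riemann], where a quotient of
    cardinalities has to be an integer. *)
Lemma idx_capdvd V U N V' : zgroup V -> zgroup U -> zgroup V' -> U `<=` V -> V' `<=` V ->
  idx V U N -> exists2 b, idx V' (U `&` V') b & (b %| N)%N.
Proof.
move=> gV gU gV' UV V'V iN.
pose S : set M := [set z | exists2 y, V' y & U (z - y)].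
have gS : zgroup S.
  split; first by exists 0; [exact: gV'.1 | rewrite subrr; exact: gU.1].
  move=> x y [x' Vx' Ux] [y' Vy' Uy]; exists (x' - y'); first exact: gV'.2.
  rewrite (_ : _ - _ = (x - x') - (y - y')); last by ring.
  exact: gU.2.
have SV : S `<=` V.
  move=> z [y V'y Uzy]; rewrite -[z](subrK y); apply: zgroupD => //; [exact: UV | exact: V'V].
have US : U `<=` S by move=> z Uz; exists 0; [exact: gV'.1 | rewrite subr0].
have [a [b [_ ib ->]]] := idx_sub gV gS gU SV US iN.
exists b; last exact: dvdn_mull.
apply: idx_eqmod ib => //.
by move=> z V'z; exists z => //; rewrite subrr; exact: gU.1.
Qed.

Lemma idx_image V U V' U' (h : M -> M) N : (forall x y, h (x - y) = h x - h y) ->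
  (forall x, V x -> V' (h x)) -> (forall y, V' y -> exists2 x, V x & y = h x) ->
  (forall x, V x -> U' (h x) <-> U x) -> zgroup V -> idx V U N -> idx V' U' N.
Proof.
move=> hB hV hS hU gV [r [rV rI rS]]; exists (fun i => h (r i)); split.
- by move=> i; apply: hV.
- by move=> i j; rewrite -hB hU; [exact: rI | exact: gV.2].
- move=> y /hS[x Vx ->]; have [i Ui] := rS _ Vx; exists i.
  by rewrite -hB hU //; exact: gV.2.
Qed.

End Index.

(** * Order functions and powers of the maximal ideals *)

Section Order.
Variables (F : finFieldType) (K : fieldExtType {fraction {poly F}}).
Implicit Type P : place K.

Lemma zgroup_valring P : zgroup (valring P).
Proof. by split; [exact: valring0 | exact: valringB]. Qed.

Lemma zgroup_maxideal P : zgroup (maxideal P).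
Proof. by split; [exact: maxideal0 | exact: maxidealB]. Qed.

(** The order of 0 is set to 0 instead of infinity, so that inverses and powers obey the usual rules
    without exception; statements about ideals therefore treat 0 apart. *)
Definition ordv P (z : K) : int :=
  if z == 0 then 0 else xget 0 [set k : int | valunit P (z / uniformizer P ^ k)].

Lemma ordvP P z : z != 0 -> valunit P (z / uniformizer P ^ ordv P z).
Proof.
move=> z0; rewrite /ordv (negPf z0).
by have [k uk] := exists_val P z0; exact: (@xgetPex _ 0 [set k : int | valunit P (z / uniformizer P ^ k)] (ex_intro _ k uk)).
Qed.

Lemma uniformizer_exp P (k : int) : 0 < k -> maxideal P (uniformizer P ^ k).
Proof.
have [mu _ _] := uniformizerP P.
case: k => // -[//|k] _; rewrite -exprnP exprS; apply: maxidealMr => //.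
by apply: valringX; exact: maxideal_valring.
Qed.

Lemma ordv_uniq P z (k : int) : z != 0 -> valunit P (z / uniformizer P ^ k) -> ordv P z = k.
Proof.
have u0 := uniformizer_neq0 P.
move=> z0 uk; have := ordvP P z0; move: (ordv P z) => l ul.
have H (a b : int) : valunit P (z / uniformizer P ^ a) -> valunit P (z / uniformizer P ^ b) ->
    ~ (a < b).
  move=> ua ub ab; have /(uniformizer_exp P) : 0 < b - a by rewrite subr_gt0.
  apply: valunit_notm; rewrite (_ : _ ^ _ = (z / uniformizer P ^ a) * (z / uniformizer P ^ b)^-1).
    by apply: valunitM => //; exact: valunitV.
  by rewrite div_div_cancel // expfzDr // -invr_expz.
by case: (ltgtP l k) => // /H; [case/(_ ul uk) | case/(_ uk ul)].
Qed.

Lemma ordv0 P : ordv P 0 = 0. Proof. by rewrite /ordv eqxx. Qed.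

Lemma ordvM P y z : y != 0 -> z != 0 -> ordv P (y * z) = ordv P y + ordv P z.
Proof.
move=> y0 z0; apply: ordv_uniq; first by rewrite mulf_neq0.
rewrite expfzDr ?uniformizer_neq0 // invfM mulrACA.
by apply: valunitM; exact: ordvP.
Qed.

Lemma ordv_unit P z : valunit P z -> ordv P z = 0.
Proof. by move=> uz; case: (uz) => z0 _ _; apply: ordv_uniq => //; rewrite expr0z divr1. Qed.

Lemma ordv1 P : ordv P 1 = 0.
Proof. exact/ordv_unit/valunit1. Qed.

Lemma ordvV P z : ordv P z^-1 = - ordv P z.
Proof.
have [->|z0] := eqVneq z 0; first by rewrite invr0 ordv0 oppr0.
by apply/eqP; rewrite -addr_eq0 -ordvM ?invr_eq0 // mulVf // ordv1.
Qed.

Lemma ordvX P z n : ordv P (z ^+ n) = ordv P z *+ n.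
Proof.
have [->|z0] := eqVneq z 0.
  by case: n => [|n]; rewrite ?expr0 ?ordv1 ?mulr0n // exprS mul0r ordv0 mul0rn.
by elim: n => [|n IH]; rewrite ?expr0 ?ordv1 ?mulr0n // exprS ordvM ?expf_neq0 // IH mulrS.
Qed.

Lemma ordv_uniformizer P : ordv P (uniformizer P) = 1.
Proof.
apply: ordv_uniq; first exact: uniformizer_neq0.
by rewrite expr1z divff ?uniformizer_neq0 //; exact: valunit1.
Qed.

Lemma ordv_gt0 P z : z != 0 -> maxideal P z <-> 0 < ordv P z.
Proof.
move=> z0; have := ordvP P z0; set v := ordv P z => uv.
have zE : z = z / uniformizer P ^ v * uniformizer P ^ v.
  by rewrite divfK // expfz_neq0 // uniformizer_neq0.
split=> [mz|v0]; last first.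
  rewrite zE; apply: maxidealMl; first by case: uv.
  exact: uniformizer_exp.
rewrite ltNge; apply/negP; rewrite le_eqVlt => /orP[/eqP ve|vlt].
  by move: uv; rewrite ve expr0z divr1 => /valunit_notm.
have : maxideal P (uniformizer P ^ (- v)) by apply: uniformizer_exp; rewrite oppr_gt0.
move=> /maxideal_valring Ov; apply: (valunit_notm uv).
by rewrite invr_expz; apply: maxidealMr.
Qed.

Lemma ordv_ge0 P z : z != 0 -> valring P z <-> 0 <= ordv P z.
Proof.
move=> z0; split=> [Oz|v0].
  have zi : z^-1 != 0 by rewrite invr_eq0.
  rewrite leNgt; apply/negP; rewrite -oppr_gt0 -ordvV => /(ordv_gt0 P zi)[_].
  by rewrite invrK => -[/eqP|//]; rewrite (negPf zi).
apply: contrapT => /notin_valring; rewrite ordv_gt0 ?invr_eq0 // ordvV oppr_gt0.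
by rewrite ltNge v0.
Qed.

(** The powers of the maximal ideal as fractional ideals, k being of either sign. *)
Definition pw P (k : int) : set K := [set z | z = 0 \/ k <= ordv P z].

Lemma pwE P k z : pw P k z <-> valring P (z / uniformizer P ^ k).
Proof.
have [->|z0] := eqVneq z 0; first by rewrite mul0r; split=> _; [exact: valring0 | left].
have uk0 : uniformizer P ^ k != 0 by rewrite expfz_neq0 // uniformizer_neq0.
have vu : ordv P (uniformizer P ^ k) = k.
  by apply: ordv_uniq => //; rewrite divff //; exact: valunit1.
rewrite ordv_ge0 ?mulf_neq0 ?invr_eq0 // ordvM ?invr_eq0 // ordvV vu subr_ge0.
by split; [case=> // /eqP; rewrite (negPf z0) | right].
Qed.

Lemma zgroup_pw P k : zgroup (pw P k).
Proof.
split; first by left.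
by move=> x y; rewrite !pwE mulrBl; exact: valringB.
Qed.

Lemma pwM P a b y z : pw P a y -> pw P b z -> pw P (a + b) (y * z).
Proof.
rewrite !pwE => Oy Oz; rewrite expfzDr ?uniformizer_neq0 // invfM mulrACA; exact: valringM.
Qed.

Lemma pw_le P k l : k <= l -> pw P l `<=` pw P k.
Proof. by move=> kl z [->|lz]; [left | right; exact: le_trans lz]. Qed.

Lemma pw0 P : pw P 0 = valring P.
Proof. by apply/seteqP; split=> z; rewrite pwE expr0z divr1. Qed.

Lemma pw1 P : pw P 1 = maxideal P.
Proof.
apply/seteqP; split=> z; have [->|z0] := eqVneq z 0.
- by move=> _; exact: maxideal0.
- by case=> [/eqP|vz]; rewrite ?(negPf z0) // ordv_gt0.
- by move=> _; left.
- by rewrite ordv_gt0 // => vz; right.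
Qed.

Lemma pw_ordv P z : pw P (ordv P z) z. Proof. by right. Qed.

Lemma pw_neq0 P k z : z != 0 -> pw P k z -> k <= ordv P z.
Proof. by move=> /eqP z0 []. Qed.

Lemma ordvDl P z y : z != 0 -> pw P (ordv P z + 1) y -> z + y != 0 /\ ordv P (z + y) = ordv P z.
Proof.
move=> z0 py; have zy0 : z + y != 0.
  apply/eqP => /eqP; rewrite addr_eq0 => /eqP zE.
  have := pw_neq0 z0; move/(_ P (ordv P z + 1)); rewrite {2}zE => /(_ (zgroupN (zgroup_pw _ _) py)).
  by rewrite gerDl ler10.
split=> //; apply/eqP; rewrite eq_le; apply/andP; split.
  rewrite leNgt; apply/negP => lt.
  have : pw P (ordv P z + 1) z.
    rewrite -[X in pw _ _ X](addrK y); apply: (zgroup_pw _ _).2 => //.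
    by right; rewrite lezD1.
  by move/(pw_neq0 z0); rewrite gerDl ler10.
apply: pw_neq0 => //; apply: zgroupD; [exact: zgroup_pw | exact: pw_ordv |].
by apply: pw_le py; rewrite lerDl.
Qed.

End Order.

(** * Residue fields and degrees of places *)

Section Residue.
Variables (F : finFieldType) (K : fieldExtType {fraction {poly F}}).
Implicit Type P : place K.

(** A family of integral elements that is independent over F[t]/(p) modulo the maximal ideal has at
    most [K : F(x)] members, by a primitive relation. A maximal one spans the residue field, and its
    coefficients may be reduced modulo p, which leaves finitely many combinations. *)
Lemma residue_finite P : exists N, idx (valring P) (maxideal P) N.
Proof.
have [t [p o]] := exists_over P; have Ot := over_valring o; have mp := over_max o.
have p1 := (over_irr o).1.
have gm := zgroup_maxideal P.
pose ind m (z : 'I_m -> K) := (forall i, valring P (z i)) /\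
  forall f : 'I_m -> {poly F}, maxideal P (\sum_i peval t (f i) * z i) -> forall i, p %| f i.
pose Q m := `[<exists z : 'I_m -> K, ind m z>].
have Q0 : exists m, Q m.
  by exists 0%N; apply/asboolP; exists (fun=> 0); split=> [[]|f _ []].
have Qb m : Q m -> (m <= dimK K)%N.
  move=> /asboolP[z [zO zi]]; rewrite leqNgt; apply/negP => dm.
  have [f [[i0 fi0] sumf]] := @dependent_prim _ _ t p (fun i => z (widen_ord dm i)) (over_param o) p1.
  pose f' (j : 'I_m) := if insub (j : nat) is Some i then f i else 0.
  have f'w i : f' (widen_ord dm i) = f i by rewrite /f' insubT //= => ?; congr f; exact: val_inj.
  have : maxideal P (\sum_j peval t (f' j) * z j).
    rewrite (bigID (fun j : 'I_m => (j < (dimK K).+1)%N)) /= [X in _ + X]big1 ?addr0; last first.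
      by move=> j; rewrite -leqNgt => dj; rewrite /f' insubF ?peval0 ?mul0r // ltnNge dj.
    rewrite (big_ord_narrow dm) /=; under eq_bigr do rewrite f'w.
    by rewrite sumf; exact: maxideal0.
  by move=> /zi /(_ (widen_ord dm i0)); rewrite f'w (negPf fi0).
case: (ex_maxnP Q0 Qb) => m /asboolP[z [zO zi]] maxm.
pose d := (size p).-1.
pose g (c : {ffun 'I_m -> 'rV[F]_d}) := \sum_i peval t (rVpoly (c i)) * z i.
suff : forall y, valring P y -> exists c, maxideal P (y - g c).
  move=> H; have [N [iN _]] : exists N, idx (valring P) (maxideal P) N /\ (N <= #|{ffun 'I_m -> 'rV[F]_d}|)%N.
    apply: (@idx_surj _ _ _ _ g) => // c; apply: valring_sum => i _.
    by apply: valringM => //; exact: peval_valring.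
  by exists N.
move=> y Oy.
(* Maximality of m: adjoining y creates a relation, and the coefficient of y in it is prime to p,
   since otherwise the [z i] alone would be related. *)
have [f [mf npf]] : exists f : 'I_m -> {poly F}, exists h,
    maxideal P (peval t h * y + \sum_i peval t (f i) * z i) /\ ~~ (p %| h).
  apply: contrapT => H; suff /maxm : Q m.+1 by rewrite ltnn.
  apply/asboolP; exists (fun i => if unlift ord0 i is Some j then z j else y); split.
    by move=> i; case: unliftP => [j _|_].
  move=> f mf; have ph : p %| f ord0.
    apply: contrapT => /negP nph; apply: H; exists (fun i => f (lift ord0 i)), (f ord0).
    split=> //; move: mf; rewrite big_ord_recl unlift_none.
    by under eq_bigr do rewrite liftK.
  move=> i; case: (unliftP ord0 i) => [j ->|->//]; move: j.
  apply: (zi (fun j => f (lift ord0 j))); move: mf.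
  rewrite big_ord_recl unlift_none; under eq_bigr do rewrite liftK.
  move/maxidealB => /(_ (peval t (f ord0) * y)); rewrite addrAC subrr add0r; apply.
  move/dvdpP: ph => [h ->]; rewrite pevalM; apply: maxidealMr => //.
  by apply: maxidealMl => //; exact: peval_valring.
move: npf => [mf' nph].
(* Bezout inverts [mf], the coefficient of y, modulo p. *)
have /Bezout_eq1_coprimepP [[u v] /= uv] : coprimep p mf.
  by rewrite irreducible_poly_coprime //; exact: over_irr o.
pose c : {ffun 'I_m -> 'rV[F]_d} := [ffun i => poly_rV ((- v * f i) %% p)].
exists c.
have cE i : peval t (- v * f i) = peval t ((- v * f i) %/ p) * peval t p + peval t (rVpoly (c i)).
  rewrite ffunE poly_rV_K; first by rewrite -pevalM -pevalD -divp_eq.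
  by rewrite -ltnS /d prednK ?ltn_modp ?(irredp_neq0 (over_irr o)) // ltnW.
rewrite (_ : y - g c = peval t u * peval t p * y +
   peval t v * (peval t mf * y + \sum_i peval t (f i) * z i)
   + \sum_i peval t ((- v * f i) %/ p) * peval t p * z i).
  apply: maxidealD; first apply: maxidealD.
  - by apply: maxidealMr => //; apply: maxidealMl => //; exact: peval_valring.
  - by apply: maxidealMl => //; exact: peval_valring.
  - apply: maxideal_sum => i _; apply: maxidealMr => //; apply: maxidealMl => //; exact: peval_valring.
have -> : g c = \sum_i peval t (- v * f i) * z i - \sum_i peval t ((- v * f i) %/ p) * peval t p * z i.
  by rewrite /g -sumrB; apply: eq_bigr => i _; rewrite cE; ring.
rewrite opprB addrA addrAC; congr (_ + _).
have -> : \sum_i peval t (- v * f i) * z i = - peval t v * \sum_i peval t (f i) * z i.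
  rewrite mulr_sumr; apply: eq_bigr => i _; rewrite pevalM mulrA; congr (_ * _ * _).
  by rewrite -[- v]sub0r pevalB peval0 sub0r.
have e : peval t u * peval t p + peval t v * peval t mf = 1 by rewrite -!pevalM -pevalD uv peval1.
by rewrite -{1}[y]mul1r -e; ring.
Qed.

Lemma residue_basis_idx P d (b : 'I_d -> K) : residue_basis P b ->
  idx (valring P) (maxideal P) (#|F| ^ d).
Proof.
move=> [bO bU]; rewrite -[d in (_ ^ d)%N]card_ord -card_ffun.
apply: (@transversal_idx _ _ _ _ (fun c : {ffun 'I_d -> F} => \sum_i fconst K (c i) * b i)).
have Oc (c : {ffun 'I_d -> F}) : valring P (\sum_i fconst K (c i) * b i).
  by apply: valring_sum => i _; apply: valringM => //; exact: valring_const.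
split=> //.
- move=> c c' mcc; have [e [_ eU]] := bU _ (Oc c).
  have := eU c; rewrite subrr => /(_ (maxideal0 P)) <-; exact: eU.
- by move=> z /bU[c [mc _]]; exists c.
Qed.

(** This shows that the default value 0 in [place_degree] is never taken. An independent family of m
    elements gives q^m distinct residues, so m is bounded, and a maximal family is a basis. *)
Lemma residue_basis_exists P : exists d (b : 'I_d -> K), residue_basis P b.
Proof.
have [N iN] := residue_finite P; have gm := zgroup_maxideal P.
pose L m (c : 'I_m -> F) (b : 'I_m -> K) := \sum_i fconst K (c i) * b i.
pose ind m (b : 'I_m -> K) := (forall i, valring P (b i)) /\
  forall c : 'I_m -> F, maxideal P (L m c b) -> forall i, c i = 0.
have Lsub m c c' (b : 'I_m -> K) : L m c b - L m c' b = L m (fun i => c i - c' i) b.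
  by rewrite /L -sumrB; apply: eq_bigr => i _; rewrite rmorphB mulrBl.
have LO m c (b : 'I_m -> K) : (forall i, valring P (b i)) -> valring P (L m c b).
  by move=> bO; apply: valring_sum => i _; apply: valringM => //; exact: valring_const.
pose Q m := `[<exists b : 'I_m -> K, ind m b>].
have Q0 : exists m, Q m.
  by exists 0%N; apply/asboolP; exists (fun=> 0); split=> [[]|f _ []].
have Qb m : Q m -> (m <= N)%N.
  move=> /asboolP[b [bO bi]].
  have : (#|{ffun 'I_m -> F}| <= N)%N.
    apply: (@idx_inj _ _ _ _ _ (fun c : {ffun 'I_m -> F} => L m c b) gm iN).
      by move=> c; exact: LO.
    by move=> c c'; rewrite Lsub => /bi H; apply/ffunP => i; apply/eqP; rewrite -subr_eq0; apply/eqP.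
  rewrite card_ffun card_ord; apply: leq_trans; apply: ltnW; apply: ltn_expl.
  exact: finRing_gt1.
case: (ex_maxnP Q0 Qb) => m /asboolP[b [bO bi]] maxm.
exists m, b; split=> // y Oy.
suff [c mc] : exists c : {ffun 'I_m -> F}, maxideal P (y - L m c b).
  exists c; split=> // c' mc'.
  have : maxideal P (L m c b - L m c' b).
    rewrite (_ : _ - _ = (y - L m c' b) - (y - L m c b)); last by ring.
    exact: maxidealB.
  by rewrite Lsub => /bi H; apply/ffunP => i; apply/eqP; rewrite -subr_eq0; apply/eqP.
have [c [a [mc a0]]] : exists (c : 'I_m -> F) (a : F),
    maxideal P (fconst K a * y + L m c b) /\ a != 0.
  apply: contrapT => H; suff /maxm : Q m.+1 by rewrite ltnn.
  apply/asboolP; exists (fun i => if unlift ord0 i is Some j then b j else y); split.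
    by move=> i; case: unliftP => [j _|_].
  move=> c; rewrite /L big_ord_recl unlift_none; under eq_bigr do rewrite liftK.
  move=> mc; have c0 : c ord0 = 0.
    apply: contrapT => /eqP c0; apply: H; by exists (fun i => c (lift ord0 i)), (c ord0).
  move=> i; case: (unliftP ord0 i) => [j ->|->//]; move: j.
  by apply: (bi (fun j => c (lift ord0 j))); move: mc; rewrite c0 rmorph0 mul0r add0r.
exists [ffun i => - (c i / a)].
rewrite (_ : _ - _ = fconst K a^-1 * (fconst K a * y + L m c b)).
  by apply: maxidealMl => //; exact: valring_const.
rewrite mulrDr mulrA -rmorphM mulVf // rmorph1 mul1r; congr (_ + _).
rewrite /L mulr_sumr -sumrN; apply: eq_bigr => i _.
by rewrite ffunE rmorphN rmorphM; ring.
Qed.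

Lemma place_degree_idx P : idx (valring P) (maxideal P) (#|F| ^ place_degree P).
Proof.
have [d [b rb]] := residue_basis_exists P.
have [b'] := @xgetPex _ 0%N [set d | exists b : 'I_d -> K, residue_basis P b]
  (ex_intro _ d (ex_intro _ b rb)).
exact: residue_basis_idx.
Qed.

Lemma place_degree_gt0 P : (0 < place_degree P)%N.
Proof.
rewrite lt0n; apply/eqP => d0; have := place_degree_idx P; rewrite d0 expn0 => -[r [rO _ rS]].
have [i m0] := rS _ (valring0 P); have [j m1] := rS _ (valring1 P).
apply: (@maxidealN1 _ _ P); rewrite (_ : 1 = (1 - r j) - (0 - r i)); first exact: maxidealB.
by rewrite (ord1 i) (ord1 j); ring.
Qed.

Lemma pw_idx P (k : int) : idx (pw P k) (pw P (k + 1)) (#|F| ^ place_degree P).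
Proof.
have u0 := uniformizer_neq0 P; have uk : uniformizer P ^ k != 0 by rewrite expfz_neq0.
apply: (@idx_image _ _ _ _ _ (fun x => uniformizer P ^ k * x)) (place_degree_idx P).
- by move=> x y; rewrite mulrBr.
- by move=> x Ox; rewrite pwE mulrAC divff ?mul1r.
- move=> y; rewrite pwE => Oy; exists (y / uniformizer P ^ k) => //.
  by rewrite mulrC divfK.
- move=> x Ox; by rewrite -pw1 !pwE expfzDr // invfM mulrACA divff // mul1r.
- exact: zgroup_valring.
Qed.

End Residue.

(** * Weak approximation *)

Section Approximation.
Variables (F : finFieldType) (K : fieldExtType {fraction {poly F}}).
Implicit Type P Q : place K.

Lemma place_eq P Q : valring P = valring Q -> P = Q.
Proof.
case: P => O c1 c2 c3 c4 c5; case: Q => O' d1 d2 d3 d4 d5 /= e.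
by subst O'; congr Place; exact: Prop_irrelevance.
Qed.

(** A discrete valuation ring is maximal among the proper subrings: if z has negative order at P,
    every y is an element of the ring of P times a power of z. *)
Lemma valring_sub P Q : valring P `<=` valring Q -> P = Q.
Proof.
move=> PQ; apply: place_eq; apply/seteqP; split=> // z Qz; apply: contrapT => nPz.
have z0 : z != 0 by apply/eqP => z0; apply: nPz; rewrite z0; exact: valring0.
have vz : ordv P z < 0 by rewrite ltNge; apply/negP => /(ordv_ge0 P z0).
suff : valring Q = setT by move=> e; have := valring_proper Q; rewrite e eqxx.
apply/seteqP; split=> // y _.
have [->|y0] := eqVneq y 0; first exact: valring0.
pose n := `|ordv P y|%N.
rewrite -[y](divfK (expf_neq0 n z0)); apply: valringM; last exact: valringX.
apply: PQ; rewrite ordv_ge0 ?mulf_neq0 ?invr_eq0 ?expf_neq0 //.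
rewrite ordvM ?invr_eq0 ?expf_neq0 // ordvV ordvX /n; move: vz.
move: (ordv P z) (ordv P y) => a b; nia.
Qed.

Lemma approx_pair P Q : P != Q -> exists z, [/\ z != 0, 0 < ordv P z & ordv Q z < 0].
Proof.
move=> PQ.
have sep P' Q' : P' != Q' -> exists y, [/\ y != 0, 0 <= ordv P' y & ordv Q' y < 0].
  move=> /eqP n; have [y [Py nQy]] : exists y, valring P' y /\ ~ valring Q' y.
    apply: contrapT => H; apply: n; apply: valring_sub => y Py; apply: contrapT => nQ.
    by apply: H; exists y.
  have y0 : y != 0 by apply/eqP => y0; apply: nQy; rewrite y0; exact: valring0.
  exists y; split=> //; first exact/(ordv_ge0 P' y0).
  by rewrite ltNge; apply/negP => /(ordv_ge0 Q' y0).
have [y [y0 Py Qy]] := sep _ _ PQ.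
have [z [z0 Qz Pz]] : exists y, [/\ y != 0, 0 <= ordv Q y & ordv P y < 0].
  by apply: sep; rewrite eq_sym.
exists (y / z); split; rewrite ?mulf_neq0 ?invr_eq0 // ordvM ?invr_eq0 // ordvV; lia.
Qed.

Lemma approx_sep P (s : seq (place K)) : P \notin s ->
  exists z, [/\ z != 0, 0 < ordv P z & forall Q, Q \in s -> ordv Q z < 0].
Proof.
elim: s => [_|Q s IH].
  by exists (uniformizer P); rewrite uniformizer_neq0 ordv_uniformizer; split.
rewrite inE negb_or => /andP[PQ /IH [y [y0 Py sy]]].
have [z [z0 Pz Qz]] := approx_pair PQ.
have [Qy|Qy] := ltP (ordv Q y) 0.
  by exists y; split=> // R; rewrite inE => /predU1P[-> //|]; exact: sy.
(* With k larger than every |ord_R y|, the elements y and z^k have different orders at each R in s,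
   so their sum takes the smaller one. *)
have [k kP] : exists k : nat, (0 < k)%N /\ forall R, R \in s -> ordv R y != ordv R z *+ k.
  exists (\sum_(R <- s) `|ordv R y|%N).+1; split=> // R Rs.
  have : (`|ordv R y| <= \sum_(R <- s) `|ordv R y|)%N by rewrite (big_rem R) //= leq_addr.
  have := sy _ Rs; move: (\sum_(R <- s) _)%N (ordv R y) (ordv R z) => a b c.
  have [->|c0] := eqVneq c 0; first by rewrite mul0rn; lia.
  move=> b0 ab; apply/eqP => e; have : (`|b| = `|c| * a.+1)%N by rewrite e; nia.
  nia.
case: kP => k0 kP.
have zk0 : z ^+ k != 0 by rewrite expf_neq0.
have vk R : ordv R (z ^+ k) = ordv R z *+ k by rewrite ordvX.
have add R : ordv R y < ordv R (z ^+ k) -> y + z ^+ k != 0 /\ ordv R (y + z ^+ k) = ordv R y.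
  by move=> lt; apply: ordvDl => //; right; rewrite lezD1.
have add' R : ordv R (z ^+ k) < ordv R y -> y + z ^+ k != 0 /\ ordv R (y + z ^+ k) = ordv R (z ^+ k).
  by move=> lt; rewrite addrC; apply: ordvDl => //; right; rewrite lezD1.
have Qlt : ordv Q (z ^+ k) < 0 by rewrite vk pmulrn_llt0.
have [yz0 Qyz] := add' Q (lt_le_trans Qlt Qy).
exists (y + z ^+ k); split=> //.
  have : pw P 1 (y + z ^+ k).
    apply: zgroupD; first exact: zgroup_pw.
      by right; rewrite -gtz0_ge1.
    by right; rewrite vk -gtz0_ge1 pmulrn_lgt0.
  by move/(pw_neq0 yz0); rewrite gtz0_ge1.
move=> R; rewrite inE => /predU1P[->|Rs]; first by rewrite Qyz.
have := kP R Rs; rewrite -vk; case: (ltgtP (ordv R y) (ordv R (z ^+ k))) => // lt _.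
  by have [_ ->] := add _ lt; exact: sy.
by have [_ ->] := add' _ lt; apply: lt_trans lt (sy _ Rs).
Qed.

Lemma approx_one P (s : seq (place K)) : P \notin s ->
  exists e, [/\ pw P 1 (e - 1) & forall Q, Q \in s -> pw Q 1 e].
Proof.
move=> /approx_sep[z [z0 Pz sz]].
have [z1 v1] : 1 + z != 0 /\ ordv P (1 + z) = 0.
  have [|//|? ->] := @ordvDl _ _ P 1 z; rewrite ?oner_eq0 ?ordv1 //.
  by right; rewrite add0r -gtz0_ge1.
(* z vanishes at P and has poles on s, so 1 / (1 + z) is close to 1 at P and to 0 on s. *)
exists (1 + z)^-1; split.
  rewrite (_ : _ - 1 = - z / (1 + z)); last by field.
  have := @pwM _ _ P 1 0 (- z) (1 + z)^-1; rewrite addr0; apply.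
    by apply: zgroupN; [exact: zgroup_pw | right; rewrite -gtz0_ge1].
  by right; rewrite ordvV v1.
move=> Q Qs; right; rewrite ordvV addrC.
have [|_ ->] := @ordvDl _ _ Q z 1 z0.
  by right; rewrite ordv1 lezD1; exact: sz.
by have := sz _ Qs; lia.
Qed.

End Approximation.

(** * Riemann-Roch spaces *)

Section Spaces.
Variables (F : finFieldType) (K : fieldExtType {fraction {poly F}}).
Implicit Types (P Q : place K) (A : place K -> int) (S : set (place K)) (s : seq (place K)).

(** For [S = setT] this is the Riemann-Roch space of the divisor A. Finite S give semilocal modules,
    whose indices are known exactly; these supply the lower bounds. *)
Definition LS S A : set K := [set z | forall P, S P -> pw P (- A P) z].

Lemma zgroup_LS S A : zgroup (LS S A).
Proof.
split; first by move=> P _; left.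
by move=> x y Lx Ly P SP; apply: (zgroup_pw _ _).2; [exact: Lx | exact: Ly].
Qed.

(** Effective divisors are lists of places with repetitions here, so that inductions add one place
    at a time. *)
Definition addl A s : place K -> int := fun P => A P + (count_mem P s)%:Z.
Definition subl A s : place K -> int := fun P => A P - (count_mem P s)%:Z.
Definition degl s := (\sum_(P <- s) place_degree P)%N.

Lemma addl_nil A : addl A [::] = A.
Proof. by apply/funext => P; rewrite /addl addr0. Qed.

Lemma addl_cons A P s : addl A (P :: s) = addl (addl A s) [:: P].
Proof. by apply/funext => Q; rewrite /addl /= PoszD addn0; lia. Qed.

Lemma addlK A s : addl (subl A s) s = A.
Proof. by apply/funext => P; rewrite /addl /subl subrK. Qed.

Lemma LS_le S A A' : (forall P, S P -> A P <= A' P) -> LS S A `<=` LS S A'.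
Proof. by move=> AA' z Lz P SP; apply: pw_le (Lz P SP); rewrite lerN2 AA'. Qed.

Lemma LS_addl S A s : LS S A `<=` LS S (addl A s).
Proof. by apply: LS_le => P _; rewrite lerDl. Qed.

Lemma LS_cap S A P : S P ->
  pw P (- A P) `&` LS S (addl A [:: P]) = LS S A.
Proof.
move=> SP; apply/seteqP; split=> z.
  move=> [pz Lz] Q SQ; have [->//|QP] := eqVneq Q P.
  by have := Lz Q SQ; rewrite /addl /= eq_sym (negPf QP) addr0.
by move=> Lz; split; [exact: Lz | exact: LS_addl].
Qed.

(** Taking leading terms at P embeds the quotient into that of two consecutive powers of the maximal
    ideal. *)
Lemma LS_step S A P : S P ->
  exists2 b, idx (LS S (addl A [:: P])) (LS S A) b & (b %| #|F| ^ place_degree P)%N.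
Proof.
move=> SP; have E : - A P = - addl A [:: P] P + 1 by rewrite /addl /= eqxx; lia.
rewrite -(LS_cap A SP) E; apply: idx_capdvd (pw_idx P _).
- exact: zgroup_pw.
- exact: zgroup_pw.
- exact: zgroup_LS.
- by apply: pw_le; rewrite lerDl.
- by move=> z; apply.
Qed.

Lemma LS_addl_dvd S A s : (forall P, P \in s -> S P) ->
  exists2 b, idx (LS S (addl A s)) (LS S A) b & (b %| #|F| ^ degl s)%N.
Proof.
elim: s => [|P s IH] sS.
  exists 1%N; last exact: dvd1n.
  rewrite addl_nil; exists (fun=> 0); split; first by move=> _; exact: (zgroup_LS _ _).1.
    by move=> i j _; rewrite (ord1 i) (ord1 j).
  by move=> z Lz; exists ord0; rewrite subr0.
have [|b ib bs] := IH _; first by move=> Q Qs; apply: sS; rewrite inE Qs orbT.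
have [|c ic cP] := @LS_step S (addl A s) P; first by apply: sS; rewrite inE eqxx.
exists (c * b)%N; last by rewrite /degl big_cons expnD dvdn_mul.
rewrite addl_cons; apply: idx_tower ic ib; try exact: zgroup_LS; exact: LS_addl.
Qed.

(** For finitely many places the embedding of [LS_step] is onto: weak approximation realises a given
    leading term at P without unwanted poles elsewhere. *)
Lemma LS_step_fin (u : seq (place K)) A P : uniq u -> P \in u ->
  idx (LS [set` u] (addl A [:: P])) (LS [set` u] A) (#|F| ^ place_degree P).
Proof.
move=> uu uP; have E : - A P = - addl A [:: P] P + 1 by rewrite /addl /= eqxx; lia.
have SP : [set` u] P by [].
rewrite -(LS_cap A SP) E; apply: idx_eqmod (pw_idx P _).
- exact: zgroup_pw.
- exact: zgroup_LS.
- by move=> z; apply.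
move=> z pz; have [->|z0] := eqVneq z 0.
  by exists 0; [exact: (zgroup_LS _ _).1 | rewrite subrr; exact: (zgroup_pw _ _).1].
have [|e [e1 es]] := @approx_one _ _ P (rem P u); first by rewrite mem_rem_uniq // !inE eqxx.
have eO : pw P 0 e.
  rewrite -[e](subrK 1); apply: zgroupD; first exact: zgroup_pw.
    by apply: pw_le e1.
  by right; rewrite ordv1.
have eXO n : pw P 0 (e ^+ n).
  elim: n => [|n IH]; first by right; rewrite ordv1.
  by rewrite exprS -[0]addr0; exact: pwM.
have eX1 n : pw P 1 (e ^+ n - 1).
  elim: n => [|n IH]; first by rewrite expr0 subrr; left.
  rewrite (_ : _ - 1 = (e ^+ n - 1) * e + (e - 1)); last by rewrite exprS; ring.
  apply: zgroupD => //; first exact: zgroup_pw.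
  by have := pwM IH eO; rewrite addr0.
have eXs n Q : Q \in rem P u -> pw Q n%:Z (e ^+ n).
  move=> Qs; elim: n => [|n IH]; first by right; rewrite ordv1.
  rewrite exprS (_ : n.+1%:Z = 1 + n%:Z); last by lia.
  by apply: pwM => //; exact: es.
(* z e^n keeps the leading term of z at P, as e is 1 modulo the maximal ideal of P; at every other Q
   of u the order grows by at least n, which is enough to meet the bound there. *)
pose n := (\sum_(Q <- u) (`|addl A [:: P] Q| + `|ordv Q z|))%N.
exists (z * e ^+ n).
  move=> Q uQ; have [->|QP] := eqVneq Q P.
    by rewrite -[X in pw _ X]addr0; apply: pwM.
  have Qr : Q \in rem P u by rewrite mem_rem_uniq // !inE QP.
  have : pw Q (ordv Q z + n%:Z) (z * e ^+ n) by apply: pwM; [exact: pw_ordv | exact: eXs].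
  apply: pw_le.
  have : (`|addl A [:: P] Q| + `|ordv Q z| <= n)%N by rewrite /n (big_rem Q) //= leq_addr.
  by move: (addl A [:: P] Q) (ordv Q z) n => a b c; lia.
rewrite (_ : z - _ = z * - (e ^+ n - 1)); last by rewrite opprB mulrBr mulr1.
by apply: pwM => //; apply: zgroupN => //; exact: zgroup_pw.
Qed.

Lemma LS_addl_fin (u : seq (place K)) A s : uniq u -> {subset s <= u} ->
  idx (LS [set` u] (addl A s)) (LS [set` u] A) (#|F| ^ degl s).
Proof.
move=> uu; elim: s => [|P s IH] su.
  rewrite /degl big_nil expn0 addl_nil; exists (fun=> 0); split.
  - by move=> _; exact: (zgroup_LS _ _).1.
  - by move=> i j _; rewrite (ord1 i) (ord1 j).
  - by move=> z Lz; exists ord0; rewrite subr0.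
rewrite /degl big_cons expnD addl_cons.
apply: idx_tower (LS_step_fin _ _ _) (IH _) => //; try exact: zgroup_LS; try exact: LS_addl.
  by apply: su; rewrite inE eqxx.
by move=> Q Qs; apply: su; rewrite inE Qs orbT.
Qed.

(** * Finiteness of sets of places *)

Lemma finite_of_size_bound (T : choiceType) (X : set T) n :
  (forall l : seq T, uniq l -> {in l, forall y, X y} -> (size l <= n)%N) -> finite_set X.
Proof.
move=> H; apply: contrapT => inf; have [B BS dB] := infinite_set_fset n.+1 inf.
suff : (size (enum_fset B) <= n)%N by rewrite leqNgt dB.
by apply: H; [exact: fset_uniq | move=> y yB; exact: BS].
Qed.

(** At most [K : F(x)] places lie above p. Take elements that are 1 at one listed place and 0 at the
    others, modulo the maximal ideals. A primitive relation between more of them has a unit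
    coefficient at one of the places, where all its other terms vanish. *)
Lemma finite_over t p : finite_set [set P : place K | lies_over P t p].
Proof.
apply: (@finite_of_size_bound _ _ (dimK K)) => l ul lo; rewrite leqNgt; apply/negP => dl.
have P0 : place K by case: l dl {ul lo}.
have Pl (i : 'I_(dimK K).+1) : nth P0 l i \in l by rewrite mem_nth // (leq_trans (ltn_ord i)).
have [e he] : {e : place K -> K & forall P, P \in l ->
    pw P 1 (e P - 1) /\ forall Q, Q \in rem P l -> pw Q 1 (e P)}.
  apply: (@choice _ _ (fun P y => P \in l -> pw P 1 (y - 1) /\ forall Q, Q \in rem P l -> pw Q 1 y)).
  move=> P; have [|y [y1 y2]] := @approx_one _ _ P (rem P l).
    by rewrite mem_rem_uniq // !inE eqxx.
  by exists y.
have o0 : lies_over (nth P0 l (@ord0 (dimK K))) t p by apply: lo.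
have [f [[i fi] sumf]] := @dependent_prim _ _ t p (fun i => e (nth P0 l i)) (over_param o0) (over_irr o0).1.
set P := nth P0 l i; have oP : lies_over P t p := lo _ (Pl i).
have [ei1 _] := he _ (Pl i); rewrite pw1 -/P in ei1.
have uei : valunit P (e P).
  by rewrite -[e P](subrK 1) addrC; apply: valunitD => //; exact: valunit1.
apply: (valunit_notm (valunitM (over_unit oP fi) uei)).
have -> : peval t (f i) * e P = - \sum_(j | j != i) peval t (f j) * e (nth P0 l j).
  by apply/eqP; rewrite -addr_eq0; move: sumf; rewrite (bigD1 i) //= => ->.
apply: maxidealN; apply: maxideal_sum => j ji.
apply: maxidealMl; first exact: peval_valring (over_valring oP).
rewrite -pw1; apply: (he _ (Pl j)).2; rewrite mem_rem_uniq // !inE Pl andbT /P.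
by rewrite nth_uniq ?(leq_trans (ltn_ord _)) // eq_sym.
Qed.

Lemma finite_peval_zeros t (f : {poly F}) : parameter t -> f != 0 ->
  finite_set [set P : place K | valring P t /\ maxideal P (peval t f)].
Proof.
move=> pt; have [N] := ubnP (size f); elim: N f => // N IH f; rewrite ltnS => sN f0.
have [sf1|sf1] := leqP (size f) 1.
  apply: sub_finite_set (finite_set0 _) => P [_].
  move: f0; rewrite (size1_polyC sf1) polyC_eq0 pevalC => /fconst_unit.
  by move/(_ K P)/valunit_notm.
have [ir|nir] := pselect (forall q : {poly F}, size q != 1%N -> q %| f -> q %= f).
  by apply: sub_finite_set (finite_over t f) => P [Ot mf].
have [q [q1 qf nqf]] : exists q : {poly F}, [/\ size q != 1%N, q %| f & ~~ (q %= f)].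
  apply: contrapT => H; apply: nir => q q1 qf; apply: contrapT => /negP nqf.
  by apply: H; exists q.
have fE : f = f %/ q * q by rewrite divpK.
have q0 : q != 0 by apply: contra_neq f0 => q0; rewrite fE q0 mulr0.
have d0 : f %/ q != 0 by apply: contra_neq f0 => d0; rewrite fE d0 mul0r.
have qlt : (size q < size f)%N.
  rewrite ltn_neqAle dvdp_leq // andbT; apply: contra nqf => /eqP e.
  by rewrite -dvdp_size_eqp // e.
have dlt : (size (f %/ q)%R < size f)%N.
  rewrite size_divp // ltn_subrL size_poly_gt0 f0 andbT.
  by move: q1 q0; rewrite -size_poly_gt0; case: (size q) => [|[]].
have fd := IH _ (leq_trans dlt sN) d0; have fq := IH _ (leq_trans qlt sN) q0.
apply: sub_finite_set (_ : finite_set (_ `|` _)); last by rewrite finite_setU; split; [exact: fd|exact: fq].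
move=> P [Ot mf]; have : maxideal P (peval t (f %/ q) * peval t q) by rewrite -pevalM -fE.
move=> mm; case: (maxideal_prime (peval_valring _ Ot) (peval_valring _ Ot) mm) => m'.
  by left.
by right.
Qed.

Lemma finite_xK_poles : finite_set [set P : place K | ~ valring P (xK K)].
Proof.
apply: sub_finite_set (@finite_peval_zeros (xK K)^-1 'X _ _); last by rewrite polyX_eq0.
  by move=> P nO; rewrite /= pevalX; split; [case: (valringV P (xK K)) | exact: notin_valring].
by right.
Qed.

(** Away from the poles of x, a zero of z is a zero of the lowest nonzero coefficient of an equation
    for z over F[x]. *)
Lemma finite_zeros (z : K) : z != 0 -> finite_set [set P : place K | maxideal P z].
Proof.
move=> z0; have [f [[i0 fi0] sumf]] := dependent_xK (fun i => z ^+ i).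
case: (@arg_minnP _ i0 (fun i => f i != 0) (fun i => i : nat) fi0) => j fj minj.
have fx := finite_peval_zeros (or_introl erefl : parameter (xK K)) fj.
apply: sub_finite_set (_ : finite_set (_ `|` _)); last first.
  by rewrite finite_setU; split; [exact: fx | exact: finite_xK_poles].
move=> P mz; have [Ox|nOx] := pselect (valring P (xK K)); [left; split=> // | by right].
have -> : peval (xK K) (f j) = - \sum_(i | i != j) peval (xK K) (f i) * z ^+ i / z ^+ j.
  apply/eqP; rewrite -addr_eq0 -mulr_suml -[X in X + _](mulfK (expf_neq0 j z0)) -mulrDl.
  by move: sumf; rewrite (bigD1 j) //= => ->; rewrite mul0r.
apply: maxidealN; apply: maxideal_sum => i ij.
have [/eqP ->|fi] := boolP (f i == 0); first by rewrite peval0 !mul0r; exact: maxideal0.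
have lij : (j < i)%N by rewrite ltn_neqAle eq_sym ij; exact: minj.
rewrite -mulrA; apply: maxidealMl; first exact: peval_valring.
rewrite -(subnK (ltnW lij)) exprD mulfK ?expf_neq0 //.
rewrite -(subnSK lij) exprS; apply: maxidealMr => //.
by apply: valringX; exact: maxideal_valring.
Qed.

Lemma finite_ordv (z : K) : finite_set [set P : place K | ordv P z != 0].
Proof.
have [->|z0] := eqVneq z 0.
  by apply: sub_finite_set (finite_set0 _) => P; rewrite /= ordv0.
have zi0 : z^-1 != 0 by rewrite invr_eq0.
apply: sub_finite_set (_ : finite_set (_ `|` _)); last first.
  by rewrite finite_setU; split; [exact: finite_zeros z0 | exact: finite_zeros zi0].
move=> P /=; case: ltgtP => // lt _; [right | left]; rewrite /= ordv_gt0 //.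
by rewrite ordvV oppr_gt0.
Qed.

(** In a residue field with N = q^d elements two of the powers x^0, ..., x^N coincide, so P is a
    zero of one of finitely many differences, unless it is a pole of x. *)
Lemma finite_degree d : finite_set [set P : place K | place_degree P = d].
Proof.
pose N := (#|F| ^ d)%N.
pose Z (ij : 'I_N.+1 * 'I_N.+1) := [set P : place K | (ij.1 < ij.2)%N /\
   (valring P (xK K) /\ maxideal P (peval (xK K) ('X^(nat_of_ord ij.2) - 'X^(nat_of_ord ij.1))))].
have fZ ij : finite_set (Z ij).
  have [lt|nlt] := boolP (ij.1 < ij.2)%N; last first.
    by apply: sub_finite_set (finite_set0 _) => P [/(negP nlt)].
  apply: sub_finite_set (@finite_peval_zeros (xK K) ('X^(nat_of_ord ij.2) - 'X^(nat_of_ord ij.1)) _ _); [by move=> P []|by left|].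
  apply/eqP => /(congr1 (fun p : {poly F} => p`_(ij.2))).
  rewrite coefB !coefXn eqxx coef0 (gtn_eqF lt) subr0 => /eqP.
  by rewrite oner_eq0.
apply: sub_finite_set (_ : finite_set ((\bigcup_(ij in setT) Z ij) `|` _)); last first.
  rewrite finite_setU; split; [|exact: finite_xK_poles].
  by apply: bigcup_finite.
move=> P Pd; have [Ox|nOx] := pselect (valring P (xK K)); [left | by right].
have iN := place_degree_idx P; rewrite Pd -/N in iN.
have [i [j [ij mij]]] : exists i j : 'I_N.+1, i != j /\ maxideal P (xK K ^+ i - xK K ^+ j).
  apply: contrapT => H.
  have : (#|'I_N.+1| <= N)%N.
    apply: (@idx_inj _ _ _ _ _ (fun i : 'I_N.+1 => xK K ^+ i) (zgroup_maxideal P) iN).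
      by move=> i; exact: valringX.
    by move=> i j mij; apply: contrapT => /eqP ij; apply: H; exists i, j.
  by rewrite card_ord ltnn.
wlog lij : i j ij mij / (j < i)%N.
  move=> H; case: (ltngtP j i) => [|lt|/val_inj e]; [exact: (H i j)| | by rewrite e eqxx in ij].
  by apply: (H j i) => //; [rewrite eq_sym | rewrite -opprB; exact: maxidealN].
by exists (j, i) => //=; split=> //; split=> //; rewrite pevalB !pevalXn.
Qed.

End Spaces.

Lemma exprVB (E : fieldType) (z : E) i n : z != 0 -> (i <= n)%N ->
  z ^+ (n - i) = z^-1 ^+ i * z ^+ n.
Proof.
by move=> z0 le; rewrite -{2}(subnK le) exprD mulrCA -exprMn mulVf // expr1n mulr1.
Qed.

(** * Existence of a place where a transcendental element vanishes *)

Section ExistencePlace.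
Variables (F : finFieldType) (K : fieldExtType {fraction {poly F}}).
Implicit Type P : place K.
Variable w : K.
Hypothesis w_transc : forall f : {poly F}, peval w f = 0 -> f = 0.

Definition subring (C : set K) :=
  [/\ forall c, C (fconst K c), forall x y, C x -> C y -> C (x - y) &
      forall x y, C x -> C y -> C (x * y)].

(* A maximal subring with these properties is the valuation ring of a pole of
   [w^-1]. *)
Definition admissible C := [/\ subring C, C w & ~ C w^-1].

Lemma w_neq0 : w != 0.
Proof.
apply/eqP => w0; have := @w_transc 'X; rewrite pevalX => /(_ w0)/eqP.
by rewrite polyX_eq0.
Qed.

Lemma admissible_peval : admissible [set y | exists f : {poly F}, y = peval w f].
Proof.
split; first split.
- by move=> c; exists c%:P; rewrite pevalC.
- by move=> _ _ [f ->] [g ->]; exists (f - g); rewrite pevalB.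
- by move=> _ _ [f ->] [g ->]; exists (f * g); rewrite pevalM.
- by exists 'X; rewrite pevalX.
- move=> [f fw]; have /w_transc/eqP : peval w ('X * f - 1) = 0.
    by rewrite pevalB pevalM pevalX -fw divff ?w_neq0 // peval1 subrr.
  rewrite subr_eq0 => /eqP /(congr1 (fun p : {poly F} => p.[0])).
  rewrite hornerM hornerX mul0r hornerC => /eqP.
  by rewrite eq_sym oner_eq0.
Qed.

Lemma maximal_admissible : exists2 C, admissible C &
  forall D, admissible D -> C `<=` D -> D `<=` C.
Proof.
pose R (X : set K) := X = set0 \/ admissible X.
have [|C [RC Cmax]] := @Zorn_bigcup K R.
  move=> X XR Xtot.
  have [[A [XA adA]]|H] := pselect (exists A, X A /\ admissible A); last first.
    left; apply/seteqP; split=> // z [A XA Az]; case: (XR _ XA) => [A0|adA].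
      by rewrite A0 in Az.
    by apply: H; exists A.
  have adX B z : X B -> B z -> admissible B.
    by move=> XB Bz; case: (XR _ XB) => // B0; rewrite B0 in Bz.
  have both x y : (\bigcup_(B in X) B) x -> (\bigcup_(B in X) B) y ->
      exists B, [/\ X B, admissible B, B x & B y].
    move=> [B XB Bx] [D XD Dy]; case: (Xtot _ _ XB XD) => [BD|DB].
      by exists D; split=> //; [exact: (adX D y) | exact: BD].
    by exists B; split=> //; [exact: (adX B x) | exact: DB].
  right; split; first split.
  - by move=> c; exists A => //; case: adA => -[].
  - move=> x y xX yX; have [B [XB [[_ cB _] _ _] Bx By]] := both _ _ xX yX.
    by exists B => //; exact: cB.
  - move=> x y xX yX; have [B [XB [[_ _ cM] _ _] Bx By]] := both _ _ xX yX.
    by exists B => //; exact: cM.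
  - by exists A => //; case: adA.
  - move=> [B XB Bw]; have [_ _] := adX _ _ XB Bw; exact.
have adC : admissible C.
  case: RC => // C0; exfalso.
  apply: (Cmax [set y | exists f : {poly F}, y = peval w f]); last by right; exact: admissible_peval.
  rewrite C0; split=> // sub; apply: (sub w); exists 'X; by rewrite pevalX.
exists C => // D adD CD; apply: contrapT => nDC; apply: (Cmax D); last by right.
by split.
Qed.

(** Chevalley's extension argument. Maximality makes every 1 - w c with c in C invertible in C. If
    neither x nor x^-1 were in C, then C[x] and C[x^-1] would both contain w^-1, and of two such
    expressions the longer can always be shortened by means of the other. *)
Lemma place_of_admissible C : admissible C ->
  (forall D, admissible D -> C `<=` D -> D `<=` C) ->
  forall x, C x \/ C x^-1.
Proof.
move=> [[Cc CB CM] Cw nCw] Cmax.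
have C1 : C 1 by have := Cc 1; rewrite rmorph1.
have C0 : C 0 by rewrite -(subrr 1); exact: CB.
have CD x y : C x -> C y -> C (x + y).
  by move=> Cx Cy; rewrite -[y]opprK; apply: (CB x) => //; rewrite -sub0r; exact: CB.
have CX x k : C x -> C (x ^+ k).
  by move=> Cx; elim: k => [|k IH]; rewrite ?expr0 // exprS; exact: CM.
have Csum (I : Type) (r : seq I) (Q : pred I) (f : I -> K) :
    (forall i, Q i -> C (f i)) -> C (\sum_(i <- r | Q i) f i).
  by move=> Cf; elim/big_ind: _.
have unit1 c : C c -> 1 - w * c != 0 /\ C (1 - w * c)^-1.
  move=> Cc'; set u := 1 - w * c.
  have u0 : u != 0.
    apply/eqP => /eqP; rewrite subr_eq0 => /eqP e; apply: nCw.
    by rewrite -[w^-1]mulr1 e mulKf ?w_neq0.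
  split=> //; have Cu : C u by apply: CB => //; exact: CM.
  (* Inverting u keeps w^-1 out, since every power of u is again 1 modulo w; maximality then puts 1
     / u in C. *)
  pose D : set K := [set y | exists a k, C a /\ y = a / u ^+ k].
  have CsD : C `<=` D by move=> y Cy; exists y, 0%N; rewrite expr0 divr1.
  have uk k : u ^+ k != 0 by rewrite expf_neq0.
  have adD : admissible D.
    split; last 2 first.
    - exact: CsD.
    - move=> [a [k [Ca e]]].
      have [c' [Cc'' uE]] : exists c', C c' /\ u ^+ k = 1 - w * c'.
        elim: k {e} => [|k [c' [Cc1 IH]]]; first by exists 0; rewrite mulr0 subr0.
        exists (c + c' - w * c * c'); split; last by rewrite exprS IH /u; ring.
        by apply: (CB (c + c')); [exact: CD | apply: (CM (w * c)) => //; exact: CM].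
      apply: nCw; suff -> : w^-1 = a + c' by exact: CD.
      have : 1 = w * (a + c').
        rewrite mulrDr -[w * c'](subKr 1) -uE.
        rewrite (_ : w * a = u ^+ k); first by rewrite addrC subrK.
        rewrite -[u ^+ k](mulVKf w_neq0) e; congr (_ * _).
        by rewrite divfK.
      by move=> e1; rewrite -[w^-1]mulr1 e1 mulKf ?w_neq0.
    split; first by move=> c'; apply: CsD.
      move=> _ _ [a [k [Ca ->]]] [b [l [Cb ->]]]; exists (a * u ^+ l - b * u ^+ k), (k + l)%N.
      split; first by apply: (CB (a * u ^+ l)); apply: (CM _ (u ^+ _)) => //; exact: CX.
      rewrite exprD; field; by rewrite !uk.
    move=> _ _ [a [k [Ca ->]]] [b [l [Cb ->]]]; exists (a * b), (k + l)%N.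
    by split; [exact: CM | rewrite exprD invfM mulrACA].
  by apply: (Cmax _ adD CsD); exists 1, 1%N; rewrite expr1 mul1r.
pose G x y := exists p : {poly K}, (forall i, C p`_i) /\ y = p.[x].
have G_C x : ~ C x -> G x w^-1.
  move=> nCx; apply: contrapT => nG; apply: nCx.
  have CG : C `<=` G x.
    move=> y Cy; exists y%:P; split; last by rewrite hornerC.
    by move=> i; rewrite coefC; case: ifP.
  apply: (Cmax (G x)) => //; last first.
    exists 'X; split; last by rewrite hornerX.
    by move=> i; rewrite coefX; case: (i == _).
  split=> //; last exact: CG.
  split; first by move=> c; apply: CG.
    move=> _ _ [p [Cp ->]] [q [Cq ->]]; exists (p - q); split; last by rewrite hornerD hornerN.
    by move=> i; rewrite coefB; exact: CB.
  move=> _ _ [p [Cp ->]] [q [Cq ->]]; exists (p * q); split; last by rewrite hornerM.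
  by move=> i; rewrite coefM; apply: Csum => j _; exact: CM.
(* Multiplied by w x^m, the equation for x^-1 has (1 - w q_0) x^m on one side and lower powers of x
   on the other; as 1 - w q_0 is a unit of C, this eliminates the leading term of p. *)
have red x (p q : {poly K}) : x != 0 -> (forall i, C p`_i) -> (forall i, C q`_i) ->
    w^-1 = p.[x] -> w^-1 = q.[x^-1] -> (size q <= size p)%N ->
    exists p' : {poly K}, [/\ forall i, C p'`_i, w^-1 = p'.[x] & (size p' < size p)%N].
  move=> x0 Cp Cq px qx; case sp : (size p) => [|m] sq.
    by move: sp => /eqP; rewrite size_poly_eq0 => /eqP p0; case: nCw; rewrite px p0 horner0.
  have [v0 Cv] := unit1 _ (Cq 0%N); set v := (1 - w * q`_0)^-1 in Cv.
  exists (\poly_(i < m) (p`_i + p`_m * (v * w * q`_(m - i)))); split.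
  - move=> i; rewrite coef_poly; case: ifP => // _.
    by apply: (CD p`_i) => //; apply: (CM p`_m) => //; apply: (CM (v * w)) => //; exact: CM.
  - rewrite horner_poly; under eq_bigr do rewrite mulrDl.
    rewrite big_split /= px horner_coef sp big_ord_recr /=; congr (_ + _).
    under eq_bigr do rewrite -!mulrA.
    rewrite -!mulr_sumr; congr (_ * _).
    suff e : (1 - w * q`_0) * x ^+ m = w * \sum_(i < m) q`_(m - i) * x ^+ i.
      by rewrite -e mulKf.
    rewrite mulrBl mul1r.
    have wq : 1 = w * \sum_(i < m.+1) q`_i * x^-1 ^+ i.
      by rewrite -horner_coef_wide // -qx divff ?w_neq0.
    rewrite -{1}[x ^+ m]mul1r {1}wq big_ord_recl expr0 mulr1 mulrDr mulrDl.
    rewrite addrAC subrr add0r -mulrA; congr (_ * _).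
    rewrite mulr_suml (reindex_inj rev_ord_inj) /=; apply: eq_bigr => i _.
    rewrite /bump /= add1n subnSK // -mulrA; congr (_ * _).
    by rewrite -(exprVB x0) ?leq_subr // subKn // ltnW.
  - by rewrite ltnS; exact: size_poly.
move=> x; apply: contrapT => /not_orP[nx nxV].
have x0 : x != 0 by apply/eqP => x0; apply: nx; rewrite x0.
have [p [Cp px]] := G_C _ nx; have [q [Cq qx]] := G_C _ nxV.
have [N] := ubnP (size p + size q)%N.
elim: N p q Cp px Cq qx => // N IH p q Cp px Cq qx; rewrite ltnS => sN.
have [sq|sp] := leqP (size q) (size p).
  have [p' [Cp' p'x sp']] := red _ _ _ x0 Cp Cq px qx sq.
  by apply: (IH p' q) => //; apply: leq_trans sN; rewrite ltn_add2r.
have xV0 : x^-1 != 0 by rewrite invr_eq0.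
have px' : w^-1 = p.[x^-1^-1] by rewrite invrK.
have [q' [Cq' q'x sq']] := red _ _ _ xV0 Cq Cp qx px' (ltnW sp).
by apply: (IH p q') => //; apply: leq_trans sN; rewrite ltn_add2l.
Qed.

Lemma exists_place : exists P, ~ valring P w^-1.
Proof.
have [C adC Cmax] := maximal_admissible.
have V := place_of_admissible adC Cmax.
have [[Cc CB CM] Cw nCw] := adC.
have CT : C != setT by apply/eqP => CT; apply: nCw; rewrite CT.
by exists (Place Cc CB CM V CT).
Qed.

End ExistencePlace.

(** * Global sections and their finiteness *)

Section GlobalSections.
Variables (F : finFieldType) (K : fieldExtType {fraction {poly F}}).
Implicit Types (P : place K) (A : place K -> int) (s : seq (place K)).

Lemma exists_xK_pole : exists P, ~ valring P (xK K).
Proof.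
have [P] := @exists_place _ _ (xK K)^-1 (@peval_xKV_eq0 _ _).
by rewrite invrK; exists P.
Qed.

Definition div0 : place K -> int := fun=> 0.
Notation L := (LS setT).

(** A nonzero element without poles is algebraic over F, for otherwise [exists_place] would provide
    a pole. If it lay in a maximal ideal, the equation of its inverse would express the leading
    coefficient, a unit, through multiples of z. *)
Lemma L0_maxideal P z : L div0 z -> maxideal P z -> z = 0.
Proof.
move=> Lz mz; apply/eqP; apply: contrapT => /negP z0.
have [f [f0 fz]] : exists f : {poly F}, f != 0 /\ peval z^-1 f = 0.
  apply: contrapT => H; have [|Q] := @exists_place _ _ z^-1.
    move=> f fz; apply/eqP; apply: contrapT => /negP f0; apply: H; by exists f.
  by rewrite invrK; apply; rewrite -pw0 -oppr0; exact: Lz.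
have lc0 : lead_coef f != 0 by rewrite lead_coef_eq0.
apply: (valunit_notm (fconst_unit P lc0)).
have -> : fconst K (lead_coef f) = - \sum_(i < (size f).-1) fconst K f`_i * z ^+ ((size f).-1 - i).
  apply/eqP; rewrite -addr_eq0 addrC; apply/eqP.
  transitivity (peval z^-1 f * z ^+ (size f).-1); last by rewrite fz mul0r.
  rewrite /peval (@horner_coef_wide _ (size f).-1.+1) ?size_map_poly ?leqSpred //.
  rewrite (eq_bigr (fun i : 'I_(size f).-1.+1 => fconst K f`_i * z^-1 ^+ i)); last first.
    by move=> i _; rewrite coef_map.
  rewrite big_ord_recr /= mulrDl.
  congr (_ + _); last by rewrite -mulrA -exprMn mulVf // expr1n mulr1.
  rewrite mulr_suml; apply: eq_bigr => i _; rewrite -mulrA; congr (_ * _).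
  by rewrite (exprVB z0) // ltnW.
apply: maxidealN; apply: maxideal_sum => i _.
apply: maxidealMl; first exact: valring_const.
rewrite -(subnSK (ltn_ord i)) exprS; apply: maxidealMr => //.
by apply: valringX; exact: maxideal_valring.
Qed.

Lemma L0_finite : exists N, idx (L div0) [set 0] N.
Proof.
have [P _] := exists_xK_pole.
have LP : L div0 `<=` valring P by move=> z Lz; rewrite -pw0 -oppr0; exact: Lz.
have [b ib _] := idx_capdvd (zgroup_valring P) (zgroup_maxideal P) (zgroup_LS setT div0)
  (@maxideal_valring _ _ P) LP (place_degree_idx P).
exists b; rewrite (_ : [set 0] = maxideal P `&` L div0) //.
apply/seteqP; split=> z; first by move=> ->; split; [exact: maxideal0 | exact: (zgroup_LS _ _).1].
by move=> [mz Lz]; exact: L0_maxideal Lz mz.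
Qed.

Definition finsup (A : place K -> int) := finite_set [set P | A P != 0].

Lemma list_of_mult (n : place K -> nat) : finite_set [set P | n P != 0%N] ->
  exists s, forall P, count_mem P s = n P.
Proof.
move=> fn; exists (flatten [seq nseq (n P) P | P <- enum_fset (fset_set [set P | n P != 0%N])]) => P.
rewrite count_flatten -map_comp sumnE big_map.
have [nP|nP] := eqVneq (n P) 0%N.
  rewrite nP big1 // => Q _; rewrite /= count_nseq /=.
  by case: eqP => [->|]; rewrite ?nP // mul0n.
have Pin : P \in fset_set [set P | n P != 0%N] by rewrite in_fset_set // inE.
rewrite (bigD1_seq P) //= ?fset_uniq // count_nseq /= eqxx mul1n big1 ?addn0 //.
by move=> Q QP; rewrite count_nseq /= (negPf QP) mul0n.
Qed.

Lemma finsup_addl A s : finsup A -> finsup (addl A s).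
Proof.
move=> fA; apply: sub_finite_set (_ : finite_set (_ `|` [set` s])); last first.
  by rewrite finite_setU; split; [exact: fA | exact: finite_seq].
move=> P /=; have [Ps|Ps] := boolP (P \in s); first by right.
by rewrite /addl (count_memPn Ps) addr0; left.
Qed.

Lemma finsup_subl A s : finsup A -> finsup (subl A s).
Proof.
move=> fA; apply: sub_finite_set (_ : finite_set (_ `|` [set` s])); last first.
  by rewrite finite_setU; split; [exact: fA | exact: finite_seq].
move=> P /=; have [Ps|Ps] := boolP (P \in s); first by right.
by rewrite /subl (count_memPn Ps) subr0; left.
Qed.

Lemma finsup0 : finsup div0.
Proof. by apply: sub_finite_set (finite_set0 _) => P /eqP []. Qed.

Lemma finsupD A A' : finsup A -> finsup A' -> finsup (fun P => A P + A' P).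
Proof.
move=> fA fA'; apply: sub_finite_set (_ : finite_set (_ `|` _)); last first.
  by rewrite finite_setU; split; [exact: fA | exact: fA'].
move=> P /=; have [A0|] := eqVneq (A P) 0; last by left.
by rewrite A0 add0r; right.
Qed.

Lemma finsupN A : finsup A -> finsup (fun P => - A P).
Proof. by apply: sub_finite_set => P /=; rewrite oppr_eq0. Qed.

Lemma le_addl A A' : finsup A -> finsup A' -> (forall P, A P <= A' P) ->
  exists s, A' = addl A s.
Proof.
move=> fA fA' le; have [|s hs] := @list_of_mult (fun P => `|A' P - A P|%N).
  apply: sub_finite_set (finsupD fA' (finsupN fA)) => P /=.
  by rewrite absz_eq0.
exists s; apply/funext => P; rewrite /addl hs gez0_abs ?subr_ge0 //.
by rewrite [RHS]addrC subrK.
Qed.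

Lemma le_addl0 A : finsup A -> exists s, forall P, A P <= addl div0 s P.
Proof.
move=> fA; have [|s hs] := @list_of_mult (fun P => `|A P|%N).
  by apply: sub_finite_set fA => P /=; rewrite absz_eq0.
by exists s => P; rewrite /addl /div0 add0r hs; lia.
Qed.

Lemma L_finite A : finsup A -> exists N, idx (L A) [set 0] N.
Proof.
move=> fA; have [s As] := le_addl0 fA; have [n0 i0] := L0_finite.
have [b ib _] := @LS_addl_dvd _ _ setT div0 s (fun _ _ => I).
have g0 : zgroup [set 0 : K] by split=> // x y -> ->; rewrite /= subr0.
have H0 (B : place K -> int) : [set 0] `<=` L B by move=> _ ->; exact: (zgroup_LS _ _).1.
have iT := idx_tower (zgroup_LS _ _) (zgroup_LS _ _) (@LS_addl _ _ setT div0 s) (H0 _) ib i0.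
have [a [c [_ ic _]]] := idx_sub (zgroup_LS _ _) (zgroup_LS setT A) g0 (LS_le (fun P _ => As P)) (H0 _) iT.
by exists c.
Qed.

(* The cardinality, not the dimension, of the space of sections: [F] need not
   be algebraically closed in [K]. *)
Definition cL A := xget 0%N [set N | idx (L A) [set 0] N].

Lemma cLP A : finsup A -> idx (L A) [set 0] (cL A).
Proof.
by move=> /L_finite[N iN]; exact: (@xgetPex _ 0%N [set N | idx (L A) [set 0] N] (ex_intro _ N iN)).
Qed.

Lemma zgroup_0 : zgroup [set 0 : K].
Proof. by split=> // x y -> ->; rewrite /= subr0. Qed.

Lemma sub0L A : [set 0] `<=` L A.
Proof. by move=> _ ->; exact: (zgroup_LS _ _).1. Qed.

Lemma cL_uniq A N : finsup A -> idx (L A) [set 0] N -> cL A = N.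
Proof. by move=> fA; apply: idx_uniq (cLP fA); exact: zgroup_0. Qed.

Lemma cL_gt0 A : finsup A -> (0 < cL A)%N.
Proof. by move=> fA; apply: idx_gt0 (cLP fA); exact: (zgroup_LS _ _).1. Qed.

Lemma cL_addl A s : finsup A ->
  exists2 b, cL (addl A s) = (b * cL A)%N & (b %| #|F| ^ degl s)%N.
Proof.
move=> fA; have [b ib bd] := @LS_addl_dvd _ _ setT A s (fun _ _ => I).
exists b => //; apply: cL_uniq; first exact: finsup_addl.
apply: idx_tower ib (cLP fA); try exact: zgroup_LS; [exact: LS_addl | exact: sub0L].
Qed.

Lemma cL_shift A (f : K) : f != 0 -> finsup A -> cL (fun P => A P - ordv P f) = cL A.
Proof.
move=> f0 fA; apply: cL_uniq.
  by apply: finsupD => //; exact: finsupN (finite_ordv f).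
have v (B : place K -> int) (g z : K) : g != 0 -> L B z -> L (fun P => B P - ordv P g) (g * z).
  move=> g0 Lz P _; rewrite opprB; apply: pwM; [exact: pw_ordv | exact: Lz].
apply: (@idx_image _ _ _ _ _ (fun x => f * x)) (cLP fA).
- by move=> x y; rewrite mulrBr.
- by move=> x; exact: v.
- move=> y Ly; exists (f^-1 * y); last by rewrite mulVKf.
  have fV0 : f^-1 != 0 by rewrite invr_eq0.
  have := v _ _ _ fV0 Ly; congr (LS _ _ _); apply/funext => P.
  by rewrite ordvV opprK subrK.
- move=> x _; split; last by move=> ->; rewrite /= mulr0.
  by move=> /eqP; rewrite mulf_eq0 (negPf f0) => /eqP.
- exact: zgroup_LS.
Qed.

Lemma cL_nonzero A : finsup A -> (1 < cL A)%N -> exists2 f, f != 0 & L A f.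
Proof.
move=> fA; have [r [rV rI rS]] := cLP fA; case: (cL A) r rV rI rS => [|[|n]] // r rV rI rS _.
have : r ord0 - r (lift ord0 ord0) != 0.
  by apply/eqP => /rI /eqP; rewrite eq_liftF.
by exists (r ord0 - r (lift ord0 ord0)) => //; apply: (zgroup_LS _ _).2.
Qed.

End GlobalSections.

(** * Degrees of divisors and Riemann's theorem *)

Section Riemann.
Variables (F : finFieldType) (K : fieldExtType {fraction {poly F}}).
Implicit Types (P : place K) (A : place K -> int) (s : seq (place K)).
Notation L := (LS setT).
Notation q := #|F|.

Lemma q_gt1 : (1 < q)%N. Proof. exact: finRing_gt1. Qed.
Lemma qX_gt0 k : (0 < q ^ k)%N. Proof. by rewrite expn_gt0 (ltnW q_gt1). Qed.

Definition deg A : int := \sum_(P \in [set: place K]) A P * (place_degree P)%:Z.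

Lemma degE A (u : seq (place K)) : uniq u -> (forall P, A P != 0 -> P \in u) ->
  deg A = \sum_(P <- u) A P * (place_degree P)%:Z.
Proof.
move=> uu Au; rewrite fsbig_seq // /deg.
rewrite -(@fsbig_widen _ _ 0 +%R [set` u] setT) //.
move=> P [_ /= nu]; apply/eqP; rewrite mulf_eq0; apply/orP; left.
by apply: contrapT => /negP /Au.
Qed.

Lemma finsup_cover A A' : finsup A -> finsup A' -> exists u : seq (place K),
  [/\ uniq u, forall P, A P != 0 -> P \in u & forall P, A' P != 0 -> P \in u].
Proof.
move=> fA fA'; have fU : finite_set ([set P | A P != 0] `|` [set P | A' P != 0]).
  by rewrite finite_setU; split.
exists (enum_fset (fset_set ([set P | A P != 0] `|` [set P | A' P != 0]))).
by split=> [|P AP|P AP]; rewrite ?fset_uniq // in_fset_set // inE; [left | right].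
Qed.

Lemma degD A A' : finsup A -> finsup A' -> deg (fun P => A P + A' P) = deg A + deg A'.
Proof.
move=> fA fA'; have [u [uu Au A'u]] := finsup_cover fA fA'.
rewrite (degE uu Au) (degE uu A'u) (degE uu) -?big_split /=.
  by apply: eq_bigr => P _; rewrite mulrDl.
move=> P; apply: contraR => nu; apply/eqP.
have -> : A P = 0 by apply/eqP; apply: contraR nu; exact: Au.
have -> : A' P = 0 by apply/eqP; apply: contraR nu; exact: A'u.
by [].
Qed.

Lemma degN A : finsup A -> deg (fun P => - A P) = - deg A.
Proof.
move=> fA; have [u [uu Au _]] := finsup_cover fA fA.
rewrite (degE uu Au) (degE uu) -?sumrN; last by move=> P; rewrite oppr_eq0; exact: Au.
by apply: eq_bigr => P _; rewrite mulNr.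
Qed.

Lemma deg0 : deg (@div0 F K) = 0.
Proof. by rewrite (@degE _ [::]) ?big_nil // => P; rewrite /div0 eqxx. Qed.

Lemma finsup_count s : finsup (fun P => (count_mem P s)%:Z).
Proof.
have := finsup_addl s (@finsup0 F K); rewrite /addl /div0.
by under [X in finsup X]eq_fun do rewrite add0r.
Qed.

Lemma deg_count s : deg (fun P => (count_mem P s)%:Z) = (degl s)%:Z.
Proof.
rewrite (@degE _ (undup s)) ?undup_uniq //; last first.
  by move=> P; rewrite mem_undup -has_pred1 has_count lt0n; apply: contraNneq => ->.
elim: s => [|P s IH]; first by rewrite !big_nil /degl big_nil.
rewrite /degl big_cons PoszD -/(degl s) -IH.
have sub : {subset undup s <= undup (P :: s)}.
  by move=> Q; rewrite !mem_undup inE => ->; rewrite orbT.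
set U := undup (P :: s) in sub *.
transitivity (\sum_(Q <- U) (P == Q)%:Z * (place_degree Q)%:Z
   + \sum_(Q <- U) (count_mem Q s)%:Z * (place_degree Q)%:Z).
  by rewrite -big_split /=; apply: eq_bigr => Q _; rewrite -mulrDl -PoszD.
have uU : uniq U by exact: undup_uniq.
have PU : P \in U by rewrite mem_undup mem_head.
congr (_ + _).
  rewrite (bigD1_seq P) // eqxx mul1r big1 /= ?addr0 // => Q QP.
  by rewrite eq_sym (negPf QP) mul0r.
rewrite /U /=; case: ifP => [//|nPs]; rewrite big_cons.
by rewrite (count_memPn (negbT nPs)) mul0r add0r.
Qed.

Lemma deg_addl A s : finsup A -> deg (addl A s) = deg A + (degl s)%:Z.
Proof. by move=> fA; rewrite -deg_count -degD //; exact: finsup_count. Qed.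

Lemma degl_cat s t : degl (s ++ t) = (degl s + degl t)%N.
Proof. by rewrite /degl big_cat. Qed.

Definition replicate m s := flatten (nseq m s).

Lemma count_replicate m s P : count_mem P (replicate m s) = (m * count_mem P s)%N.
Proof. by elim: m => [|m IH] //; rewrite /replicate /= count_cat -/(replicate m s) IH mulSn. Qed.

Lemma degl_replicate m s : degl (replicate m s) = (m * degl s)%N.
Proof.
elim: m => [|m IH]; first by rewrite /degl big_nil.
by rewrite /replicate /= degl_cat -/(replicate m s) IH mulSn.
Qed.

Lemma principal_lists (z : K) : exists sZ sW, [/\
  forall P, (count_mem P sZ)%:Z = Num.max (ordv P z) 0 &
  forall P, (count_mem P sW)%:Z = Num.max (- ordv P z) 0].
Proof.
have [|sZ hZ] := @list_of_mult _ _ (fun P => if 0 <= ordv P z then `|ordv P z|%N else 0%N).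
  apply: sub_finite_set (finite_ordv z) => P /=.
  by case: ifP => // _; rewrite absz_eq0.
have [|sW hW] := @list_of_mult _ _ (fun P => if 0 <= ordv P z then 0%N else `|ordv P z|%N).
  apply: sub_finite_set (finite_ordv z) => P /=.
  by case: ifP => // _; rewrite absz_eq0.
exists sZ, sW; split=> P; rewrite ?hZ ?hW; case: ifP; move: (ordv P z) => a; lia.
Qed.

(** Expansion in base z. The digits represent the semilocal ring at the zeros of z modulo z, and C
    bounds the poles of all of them. Sums of m digits times 1, z, ..., z^(m-1) are pairwise
    distinct, with poles bounded by C plus m times the poles of z. Against the upper bound
    [cL_effective_le] this compares the degrees of the zeros and of the poles. *)
Lemma zeros_growth (z : K) sZ sW : z != 0 ->
  (forall P, (count_mem P sZ)%:Z = Num.max (ordv P z) 0) ->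
  (forall P, (count_mem P sW)%:Z = Num.max (- ordv P z) 0) ->
  exists C, forall m, (q ^ (m * degl sZ) <= cL (addl (@div0 F K) (C ++ replicate m sW)))%N.
Proof.
move=> z0 hZ hW; pose u := undup sZ.
have uu : uniq u by exact: undup_uniq.
have su : {subset sZ <= u} by move=> P; rewrite mem_undup.
have zu P : P \in u -> 0 < ordv P z.
  rewrite mem_undup -has_pred1 has_count => c0; have := hZ P; move: (ordv P z) => a; lia.
have [r [rV rI _]] := @LS_addl_fin _ _ u (subl (@div0 F K) sZ) sZ uu su.
rewrite addlK in rV; move: r rV rI; set N := (q ^ degl sZ)%N => r rV rI.
have [|C hC] := @list_of_mult _ _ (fun P => \sum_i `|ordv P (r i)|)%N.
  apply: sub_finite_set (_ : finite_set (\bigcup_(i in setT) [set P | ordv P (r i) != 0])).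
    move=> P /= nz; apply: contrapT => H; case/negP: nz; rewrite sum_nat_eq0.
    apply/forallP => i; apply/implyP => _; rewrite absz_eq0.
    by apply: contrapT => /negP ni; apply: H; exists i.
  by apply: bigcup_finite => // i _; exact: finite_ordv.
exists C => m.
pose A := addl (@div0 F K) (C ++ replicate m sW).
have fA : finsup A by apply: finsup_addl; exact: finsup0.
have rC i P : pw P (- (count_mem P C)%:Z) (r i).
  have [->|ri0] := eqVneq (r i) 0; first by left.
  right; rewrite hC.
  have : (`|ordv P (r i)| <= \sum_i `|ordv P (r i)|)%N by rewrite (bigD1 i) //= leq_addr.
  by move: (ordv P (r i)) (\sum_i _)%N => a b; lia.
pose g (c : {ffun 'I_m -> 'I_N}) := \sum_(i < m) r (c i) * z ^+ i.
have -> : (q ^ (m * degl sZ) = #|{ffun 'I_m -> 'I_N}|)%N.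
  by rewrite card_ffun !card_ord mulnC expnM.
apply: (@idx_inj _ _ _ _ _ g (@zgroup_0 _ _) (cLP fA)).
  move=> c; apply: zgroup_sum; first exact: zgroup_LS.
  move=> i _ P _; apply: (@pw_le _ _ P _ (- (count_mem P C)%:Z + ordv P z *+ i)).
    rewrite /A /addl /div0 count_cat count_replicate add0r PoszD PoszM hW.
    have := ltn_ord i; move: (ordv P z) (count_mem P C) => a b.
    rewrite -mulr_natr; nia.
  apply: pwM; first exact: rC.
  by rewrite -ordvX; exact: pw_ordv.
move=> c c' /= e; apply/ffunP => i0; apply: contrapT => /eqP ne0.
(* At the lowest differing place of the two expansions, division by z^i shows that the two digits
   agree modulo z, which is excluded by their choice. *)
case: (@arg_minnP _ i0 (fun i => c i != c' i) (fun i => i : nat) ne0) => i ne mini.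
case/eqP: ne; apply: rI.
have zi0 : z ^+ i != 0 by rewrite expf_neq0.
have -> : r (c i) - r (c' i) = - \sum_(j < m | j != i) (r (c j) - r (c' j)) * z ^+ j / z ^+ i.
  apply/eqP; rewrite -addr_eq0 -mulr_suml -[X in X + _](mulfK zi0) -mulrDl.
  rewrite (_ : _ + _ = 0) ?mul0r //.
  move: e; rewrite /g -sumrB (bigD1 i) //= => e.
  rewrite -{2}e mulrBl; congr (_ + _); apply: eq_bigr => j _; by rewrite mulrBl.
apply: (zgroupN (zgroup_LS _ _)).
apply: (@zgroup_sum _ (LS [set` u] (subl (@div0 F K) sZ)) _ _ _ _ (zgroup_LS _ _)).
move=> j ji; have [->|nej] := eqVneq (c j) (c' j).
  by rewrite subrr !mul0r; exact: (zgroup_LS _ _).1.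
have lij : (i < j)%N by rewrite ltn_neqAle eq_sym ji; exact: mini.
rewrite -mulrA -(subnK (ltnW lij)) exprD mulfK // => P Pu.
rewrite /subl /div0 sub0r opprK hZ -[Num.max _ _]add0r.
have oz := zu P Pu.
have -> : Num.max (ordv P z) 0 = ordv P z by move: (ordv P z) oz => a; lia.
apply: pwM.
  have rO k : pw P 0 (r k) by have := rV k P Pu; rewrite oppr0.
  exact: (zgroup_pw _ _).2.
right; rewrite ordvX -(subnSK lij) mulrS lerDl mulrn_wge0 //; exact: ltW.
Qed.

Lemma cL_effective s : exists2 b, cL (addl (@div0 F K) s) = (b * cL (@div0 F K))%N & (b %| q ^ degl s)%N.
Proof. by apply: cL_addl; exact: finsup0. Qed.

Lemma cL_effective_le s : (cL (addl (@div0 F K) s) <= q ^ degl s * cL (@div0 F K))%N.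
Proof.
have [b -> bd] := cL_effective s.
by rewrite leq_mul2r; apply/orP; right; exact: dvdn_leq (qX_gt0 _) bd.
Qed.

Lemma growth_le (a b c d : nat) : (forall m, q ^ (m * a) <= q ^ (c + m * b) * d)%N -> (a <= b)%N.
Proof.
move=> H; rewrite leqNgt; apply/negP => ba.
(* For b < a the exponent [m * a] exceeds [m * b] by at least c + d, and d < q^d. *)
pose m := (c + d)%N; have := H m; apply/negP; rewrite -ltnNge.
have d_lt : (d < q ^ d)%N by exact: ltn_expl q_gt1.
apply: (@leq_trans (q ^ (c + m * b) * q ^ d)).
  by rewrite ltn_mul2l qX_gt0.
rewrite -expnD leq_pexp2l ?(ltnW q_gt1) // /m; nia.
Qed.

Lemma zeros_poles_degree (z : K) sZ sW : z != 0 ->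
  (forall P, (count_mem P sZ)%:Z = Num.max (ordv P z) 0) ->
  (forall P, (count_mem P sW)%:Z = Num.max (- ordv P z) 0) -> degl sZ = degl sW.
Proof.
have H (z' : K) sZ' sW' : z' != 0 ->
    (forall P, (count_mem P sZ')%:Z = Num.max (ordv P z') 0) ->
    (forall P, (count_mem P sW')%:Z = Num.max (- ordv P z') 0) -> (degl sZ' <= degl sW')%N.
  move=> z0 hZ hW; have [C hC] := zeros_growth z0 hZ hW.
  apply: (@growth_le _ _ (degl C) (cL (@div0 F K))) => m.
  apply: leq_trans (hC m) _; apply: leq_trans (cL_effective_le _) _.
  by rewrite degl_cat degl_replicate.
move=> z0 hZ hW; apply/eqP; rewrite eqn_leq (H z) //=.
apply: (H z^-1); rewrite ?invr_eq0 // => P; rewrite ordvV ?opprK //.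
Qed.

Lemma deg_principal (z : K) : z != 0 -> deg (fun P => ordv P z) = 0.
Proof.
move=> z0; have [sZ [sW [hZ hW]]] := principal_lists z.
have -> : (fun P => ordv P z) = (fun P => (count_mem P sZ)%:Z + - (count_mem P sW)%:Z).
  by apply/funext => P; rewrite hZ hW; move: (ordv P z) => a; lia.
rewrite degD; [|exact: finsup_count|exact: finsupN (finsup_count _)].
by rewrite degN ?deg_count ?(zeros_poles_degree z0 hZ hW) ?subrr //; exact: finsup_count.
Qed.

Lemma degB A A' : finsup A -> finsup A' -> deg (fun P => A P - A' P) = deg A - deg A'.
Proof. by move=> fA fA'; rewrite degD ?degN //; exact: finsupN. Qed.

Lemma finsupB A A' : finsup A -> finsup A' -> finsup (fun P => A P - A' P).
Proof. by move=> fA fA'; apply: finsupD => //; exact: finsupN. Qed.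

(** For E = C + m (poles of x) the bound is [zeros_growth]. Any A is equivalent to a divisor below
    such an E: with s >= A, a nonzero section f of E - s gives A - div f <= E. Passing from E down
    to A - div f divides the number of sections by at most q to the difference of the degrees. *)
Lemma riemann_bound : exists c : nat, forall A (d : nat), finsup A -> deg A = d%:Z ->
  (q ^ d <= q ^ c * cL A)%N.
Proof.
have [P0 nP0] := exists_xK_pole K.
have x0 : xK K != 0 by exact: xK_neq0.
have [sZ [sW [hZ hW]]] := principal_lists (xK K).
have ZW := zeros_poles_degree x0 hZ hW.
have [C hC] := zeros_growth x0 hZ hW; rewrite ZW in hC.
have w0 : (0 < degl sW)%N.
  have P0W : P0 \in sW.
    rewrite -has_pred1 has_count; have := hW P0.
    have : ordv P0 (xK K) < 0 by rewrite ltNge; apply/negP => /(ordv_ge0 P0 x0).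
    by move: (ordv _ _) => a; lia.
  by rewrite /degl (big_rem P0) //= addn_gt0 place_degree_gt0.
exists (degl C) => A d fA dA.
have [s As] := le_addl0 fA.
(* The poles of x have degree at least 1, so removing s from E, which costs at most q^(deg s),
   leaves a nonzero section. *)
pose m := (degl s).+1; pose E := addl (@div0 F K) (C ++ replicate m sW).
have fE : finsup E by apply: finsup_addl; exact: finsup0.
have [f f0 Lf] : exists2 f, f != 0 & L (subl E s) f.
  apply: cL_nonzero; first exact: finsup_subl.
  have [b e bd] := cL_addl s (finsup_subl s fE).
  rewrite addlK in e; have := hC m; rewrite -/E e => le1.
  have le2 : (q ^ (m * degl sW) <= q ^ degl s * cL (subl E s))%N.
    apply: leq_trans le1 _; rewrite leq_mul2r; apply/orP; right; exact: dvdn_leq (qX_gt0 _) bd.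
  rewrite ltnNge; apply/negP => c1.
  have : (q ^ (m * degl sW) <= q ^ degl s)%N.
    by apply: leq_trans le2 _; rewrite -[X in (_ <= X)%N]muln1 leq_mul2l c1 orbT.
  rewrite leq_exp2l ?q_gt1 // /m; nia.
have ford := finite_ordv f.
have fA' : finsup (fun P => A P - ordv P f) by exact: finsupB.
have [t et] : exists t, E = addl (fun P => A P - ordv P f) t.
  apply: le_addl => // P.
  have := pw_neq0 f0 (Lf P I); have := As P; rewrite /subl /addl /div0.
  move: (ordv P f) (A P) (E P) (count_mem P s) => a b e k; lia.
have [b e bd] := cL_addl t fA'; rewrite -et (cL_shift f0 fA) in e.
have dE : (degl C + m * degl sW)%N%:Z = d%:Z + (degl t)%:Z.
  have := deg_addl t fA'; rewrite -et degB // deg_principal // subr0 dA => <-.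
  by rewrite /E deg_addl ?deg0 ?add0r ?degl_cat ?degl_replicate //; exact: finsup0.
have le1 : (q ^ (m * degl sW) <= q ^ degl t * cL A)%N.
  apply: leq_trans (hC m) _; rewrite -/E e leq_mul2r; apply/orP; right.
  exact: dvdn_leq (qX_gt0 _) bd.
have e2 : (d + degl t = degl C + m * degl sW)%N by lia.
rewrite -(leq_pmul2l (qX_gt0 (degl t))) mulnCA -expnD addnC e2 expnD.
by rewrite leq_mul2l le1 orbT.
Qed.

(** For effective s, the quotient q^(deg s) |L(0)| / |L(s)| is an integer by divisibility of the
    indices, and it is bounded by [riemann_bound]. Let it be maximal at t0, with value G1. Any A of
    large degree is equivalent to some t0 + s; enlarging t0 can only multiply the quotient by a
    positive integer, so by maximality it keeps the value G1. *)
Theorem riemann : exists n0 G1 G2 : nat, [/\ (0 < G1)%N, (0 < G2)%N &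
  forall A (d : nat), finsup A -> deg A = d%:Z -> (n0 <= d)%N -> (cL A * G1 = q ^ d * G2)%N].
Proof.
have [c hc] := riemann_bound.
pose c0 := cL (@div0 F K); have c0_gt0 : (0 < c0)%N by apply: cL_gt0; exact: finsup0.
have fs s : finsup (addl (@div0 F K) s) by apply: finsup_addl; exact: finsup0.
have ds s : deg (addl (@div0 F K) s) = (degl s)%:Z by rewrite deg_addl ?deg0 ?add0r //; exact: finsup0.
pose R k := `[<exists s, (k * cL (addl (@div0 F K) s) = q ^ degl s * c0)%N>].
have kex s : exists k, (k * cL (addl (@div0 F K) s) = q ^ degl s * c0)%N.
  have [b -> /dvdnP[k ->]] := cL_effective s; exists k; by rewrite mulnA.
have R0 : exists k, R k.
  by have [k hk] := kex [::]; exists k; apply/asboolP; exists [::].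
have Rb k : R k -> (k <= q ^ c * c0)%N.
  move=> /asboolP[s hk].
  rewrite -(leq_pmul2r (cL_gt0 (fs s))) hk mulnAC leq_mul2r; apply/orP; right.
  exact: hc (fs s) (ds s).
case: (ex_maxnP R0 Rb) => G1 /asboolP[t0 hG1] maxG1.
(* From this degree on [riemann_bound] gives A - t0 more than one section. *)
exists (degl t0 + c).+1, G1, c0; split=> //.
  have : (0 < q ^ degl t0 * c0)%N by rewrite muln_gt0 qX_gt0.
  by rewrite -hG1 muln_gt0 => /andP[].
move=> A d fA dA nd.
have fAt : finsup (subl A t0) by exact: finsup_subl.
have dAt : deg (subl A t0) = (d - degl t0)%N%:Z.
  rewrite /subl degB ?dA ?deg_count //; [lia | exact: finsup_count].
have [f f0 Lf] : exists2 f, f != 0 & L (subl A t0) f.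
  apply: cL_nonzero => //.
  have := hc _ _ fAt dAt; rewrite ltnNge => le1; apply/negP => c1.
  have : (q ^ (d - degl t0) <= q ^ c)%N.
    by apply: leq_trans le1 _; rewrite -[X in (_ <= X)%N]muln1 leq_mul2l c1 orbT.
  rewrite leq_exp2l ?q_gt1 //; lia.
have fi0 : f^-1 != 0 by rewrite invr_eq0.
pose A' := fun P => A P - ordv P f^-1.
have fA' : finsup A' by apply: finsupB => //; exact: finite_ordv.
have [s es] : exists s, A' = addl (addl (@div0 F K) t0) s.
  apply: le_addl => // P; have := pw_neq0 f0 (Lf P I).
  rewrite /A' /subl /addl /div0 ordvV; move: (ordv P f) (A P) (count_mem P t0) => a b k; lia.
have dA' : (d = degl t0 + degl s)%N.
  have : deg A' = d%:Z by rewrite degB // ?deg_principal ?subr0 //; exact: finite_ordv.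
  rewrite es deg_addl ?ds //; lia.
rewrite -(cL_shift fi0 fA) -/A' es.
have [b e bd] := cL_addl s (fs t0).
have /dvdnP[k hk] := bd.
have : (k * G1 <= G1)%N.
  apply: maxG1; apply/asboolP; exists (s ++ t0).
  have -> : addl (@div0 F K) (s ++ t0) = addl (addl (@div0 F K) t0) s.
    by apply/funext => P; rewrite /addl count_cat PoszD; lia.
  rewrite e degl_cat expnD hk -mulnA [RHS]mulnAC -!mulnA; congr (k * _)%N.
  by rewrite mulnCA hG1 [(c0 * _)%N]mulnC.
have k0 : (0 < k)%N by have := qX_gt0 (degl s); rewrite hk muln_gt0 => /andP[].
have G0 : (0 < G1)%N.
  have : (0 < q ^ degl t0 * c0)%N by rewrite muln_gt0 qX_gt0.
  by rewrite -hG1 muln_gt0 => /andP[].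
rewrite -[X in (_ <= X)%N]mul1n leq_pmul2r // => k1.
have k_1 : k = 1%N by lia.
by rewrite e dA' expnD hk k_1 mul1n -mulnA [(cL _ * _)%N]mulnC hG1 mulnCA mulnA.
Qed.

End Riemann.

Lemma Posz_eq (a b : nat) : a%:Z = b%:Z -> a = b. Proof. by case. Qed.

Lemma sum_leq_indicator d n : (\sum_(1 <= h < n.+1) (h <= d) = minn d n)%N.
Proof.
elim: n => [|n IH]; first by rewrite big_geq // minn0.
by rewrite big_nat_recr //= IH; lia.
Qed.

Lemma sum_multiples d n (f : nat -> nat) : (0 < d)%N ->
  (\sum_(1 <= k < n.+1 | d %| k) f k = \sum_(1 <= h < n.+1 | h * d <= n) f (h * d))%N.
Proof.
move=> d0.
transitivity (\sum_(1 <= k < n.+1) \sum_(1 <= h < n.+1 | k == h * d) f k)%N.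
  rewrite big_mkcond; apply: eq_big_nat => k /andP[k1 kn].
  case: ifP => [/dvdnP[h kE]|ndk]; last first.
    by rewrite big1_seq // => h /andP[/eqP kE _]; rewrite kE dvdn_mull in ndk.
  rewrite (eq_bigl (fun i => i == h)); last first.
    by move=> i; rewrite kE eqn_pmul2r // eq_sym.
  rewrite big_nat1_eq ifT //; nia.
rewrite (exchange_big_dep predT) //= [RHS]big_mkcond; apply: eq_big_nat => h /andP[h1 hn].
rewrite big_nat1_eq; case: ifP => c; case: ifP => c' //; nia.
Qed.

(** * Counting effective divisors *)

Section EffectiveDivisors.
Variables (F : finFieldType) (K : fieldExtType {fraction {poly F}}).
Implicit Types (P : place K) (D : effdiv K) (A B : place K -> int).
Notation L := (LS setT).
Notation q := #|F|.

Definition divZ D : place K -> int := fun P => (D P)%:Z.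

Lemma finsup_divZ D : finsup (divZ D).
Proof.
apply: sub_finite_set (finite_fset (finsupp D)) => P /=.
by rewrite /divZ mem_finsupp.
Qed.

Lemma deg_divZ D : deg (divZ D) = (div_degree D)%:Z.
Proof.
rewrite (@degE _ _ _ (finsupp D)) ?fset_uniq //; last first.
  by move=> P; rewrite /divZ mem_finsupp.
by rewrite /div_degree (big_morph Posz PoszD erefl); apply: eq_bigr => P _; rewrite PoszM.
Qed.

Lemma divZ_inj : injective divZ.
Proof. by move=> D D' e; apply/fsfunP => P; have := congr1 (@^~ P) e; rewrite /divZ => -[]. Qed.

Lemma divZ_surj A : finsup A -> (forall P, 0 <= A P) -> exists D, divZ D = A.
Proof.
move=> fA A0; exists [fsfun P in fset_set [set P | A P != 0] => `|A P|%N | 0%N].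
apply/funext => P; rewrite /divZ fsfunE; case: ifP => [_|/negbT]; first by rewrite gez0_abs.
rewrite in_fset_set // => H; apply/esym/eqP; apply: contraNT H => AP.
by rewrite inE.
Qed.

Lemma degree_le D P n : div_degree D = n -> (D P * place_degree P <= n)%N.
Proof.
move=> <-; have [DP|DP] := boolP (P \in finsupp D); last by rewrite fsfun_dflt.
by rewrite /div_degree (big_fsetD1 P) //= leq_addr.
Qed.

Lemma mult_le D P n : div_degree D = n -> (D P <= n)%N.
Proof.
by move=> /degree_le -/(_ P); apply: leq_trans; rewrite leq_pmulr // place_degree_gt0.
Qed.

Definition places_le n := fset_set [set P : place K | (place_degree P <= n)%N].

Lemma finite_places_le n : finite_set [set P : place K | (place_degree P <= n)%N].
Proof.
apply: sub_finite_set (_ : finite_set (\bigcup_(i in setT) [set P : place K | place_degree P = nat_of_ord (i : 'I_n.+1)])).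
  by move=> P /= Pn; exists (inord (place_degree P)) => //=; rewrite inordK.
by apply: bigcup_finite => // i _; exact: finite_degree.
Qed.

Lemma in_places_le n P : (P \in places_le n) = (place_degree P <= n)%N.
Proof. by rewrite in_fset_set ?inE //; [exact: asboolb | exact: finite_places_le]. Qed.

Lemma supp_places_le D n P : div_degree D = n -> D P != 0%N -> P \in places_le n.
Proof.
move=> Dn DP; rewrite in_places_le; apply: leq_trans (degree_le P Dn).
by rewrite leq_pmull // lt0n.
Qed.

Definition Eff n := [set D : effdiv K | div_degree D = n].

Lemma finite_Eff n : finite_set (Eff n).
Proof.
pose T := places_le n.
pose mk (c : {ffun 'I_(size T).+1 -> 'I_n.+1}) : effdiv K :=
  [fsfun P in T => nat_of_ord (c (inord (index P T))) | 0%N].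
apply: sub_finite_set (_ : finite_set (mk @` setT)); last exact/finite_image/finite_finset.
move=> D Dn.
have [P0 _] := exists_xK_pole K.
exists [ffun i : 'I_(size T).+1 => inord (D (nth P0 T i))] => //.
apply/fsfunP => P; rewrite fsfunE; case: ifP => PT.
  have iT : (index P T < (size T).+1)%N by rewrite ltnS ltnW // index_mem.
  by rewrite ffunE (inordK iT) nth_index // inordK // ltnS; exact: mult_le.
by apply/esym/eqP; apply: contraFT PT; exact: supp_places_le.
Qed.

Definition eff n := fset_set (Eff n).
Definition effN n := #|` eff n|.

Lemma in_eff n D : (D \in eff n) = (div_degree D == n).
Proof. by rewrite in_fset_set; [apply/idP/eqP; rewrite inE | exact: finite_Eff]. Qed.

Lemma nonzero_sections A c : finsup A -> cL A = c.+1 -> exists r : 'I_c -> K,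
  [/\ forall i, L A (r i) /\ r i != 0, injective r & forall f, f != 0 -> L A f -> exists i, f = r i].
Proof.
move=> fA cA; have := cLP fA; rewrite cA => -[r [rV rI rS]].
have [i0 /esym/eqP] := rS 0 (zgroup_LS _ _).1; rewrite sub0r eq_sym oppr_eq0 => /eqP ri0.
have rinj : injective r by move=> i j e; apply: rI; rewrite /= e subrr.
exists (fun i => r (lift i0 i)); split.
- move=> i; split=> //; rewrite -ri0; apply/eqP => /rinj/eqP.
  by rewrite eq_sym (negPf (neq_lift _ _)).
- by move=> i j /rinj/lift_inj.
- move=> f f0 /rS[i /= /eqP]; rewrite subr_eq0 => /eqP fi.
  case: (unliftP i0 i) => [j ij|ii0]; first by exists j; rewrite -ij.
  by move: f0; rewrite fi ii0 ri0 eqxx.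
Qed.

Lemma L_principal A f : f != 0 -> L A f -> forall P, 0 <= A P + ordv P f.
Proof. by move=> f0 Lf P; have := pw_neq0 f0 (Lf P I); rewrite -subr_ge0 opprK addrC. Qed.

(* Pairs [(D, g)] with [g] a nonzero section of [D + B] are turned into pairs
   [(D', h)] with [h] a nonzero section of [D' - B] by [D' = D + B + div g],
   [h = 1 / g]. *)
Lemma effN_le n m B c c' : finsup B -> n%:Z + deg B = m%:Z ->
  (forall A, finsup A -> deg A = m%:Z -> cL A = c.+1) ->
  (forall A, finsup A -> deg A = n%:Z -> cL A = c'.+1) ->
  (effN n * c <= effN m * c')%N.
Proof.
move=> fB dB hm hn.
have fDB D : finsup (fun P => divZ D P + B P) by apply: finsupD => //; exact: finsup_divZ.
have fDB' D : finsup (fun P => divZ D P - B P) by apply: finsupB => //; exact: finsup_divZ.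
have [r hr] : {r : eff n -> 'I_c -> K & forall D : eff n,
    [/\ forall i, L (fun P => divZ (\val D) P + B P) (r D i) /\ r D i != 0, injective (r D) &
     forall f, f != 0 -> L (fun P => divZ (\val D) P + B P) f -> exists i, f = r D i]}.
  apply: (@choice _ _ (fun (D : eff n) (r : 'I_c -> K) => [/\ forall i, L (fun P => divZ (\val D) P + B P) (r i) /\ r i != 0, injective r &
     forall f, f != 0 -> L (fun P => divZ (\val D) P + B P) f -> exists i, f = r i])) => D.
  apply: nonzero_sections; first exact: fDB.
  apply: hm; first exact: fDB.
  rewrite degD ?deg_divZ //; last exact: finsup_divZ.
  by have := fsvalP D; rewrite in_eff => /eqP ->.
have [r' hr'] : {r : eff m -> 'I_c' -> K & forall D : eff m,
    [/\ forall i, L (fun P => divZ (\val D) P - B P) (r D i) /\ r D i != 0, injective (r D) &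
     forall f, f != 0 -> L (fun P => divZ (\val D) P - B P) f -> exists i, f = r D i]}.
  apply: (@choice _ _ (fun (D : eff m) (r : 'I_c' -> K) => [/\ forall i, L (fun P => divZ (\val D) P - B P) (r i) /\ r i != 0, injective r &
     forall f, f != 0 -> L (fun P => divZ (\val D) P - B P) f -> exists i, f = r i])) => D.
  apply: nonzero_sections; first exact: fDB'.
  apply: hn; first exact: fDB'.
  rewrite degB ?deg_divZ //; last exact: finsup_divZ.
  have := fsvalP D; rewrite in_eff => /eqP ->; lia.
have step (x : eff n * 'I_c) : exists y : eff m * 'I_c',
    r' y.1 y.2 = (r x.1 x.2)^-1 /\
    forall P, divZ (\val y.1) P = divZ (\val x.1) P + B P + ordv P (r x.1 x.2).
  case: x => D i /=; have [/(_ i)[Lr r0] _ _] := hr D.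
  have fA' : finsup (fun P => divZ (\val D) P + B P + ordv P (r D i)).
    by apply: finsupD => //; exact: finite_ordv.
  have [D' eD'] := divZ_surj fA' (L_principal r0 Lr).
  have D'm : D' \in eff m.
    rewrite in_eff; have := deg_divZ D'; rewrite eD' degD ?deg_principal ?addr0 //; last exact: finite_ordv.
    rewrite degD ?deg_divZ //; last exact: finsup_divZ.
    have := fsvalP D; rewrite in_eff => /eqP ->; lia.
  have [_ _ /(_ (r D i)^-1)] := hr' [` D'm]%fset.
  rewrite invr_eq0 => /(_ r0)[|j ej].
    move=> P _; right; rewrite /= eD' ordvV.
    have : 0 <= divZ (\val D) P by [].
    by move: (divZ _ P) (B P) (ordv P _) => a b k; lia.
  by exists ([` D'm]%fset, j) => /=; rewrite -ej eD'.
have [phi hphi] := choice step.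
rewrite /effN !cardfE -[X in (_ * X <= _)%N]card_ord -[X in (_ <= _ * X)%N]card_ord -!card_prod.
apply: (@leq_card _ _ phi) => -[D i] [D' i'] e.
have [e1 e2] := hphi (D, i); have [e1' e2'] := hphi (D', i'); rewrite e /= in e1 e2.
rewrite /= in e1' e2'.
have er : r D i = r D' i' by apply: invr_inj; rewrite -e1.
have eD : D = D'.
  apply: val_inj; apply: divZ_inj; apply/funext => P.
  have := e2 P; rewrite e2' er => /addIr/addIr ->.
  by [].
by move: er; rewrite eD; have [_ inj _] := hr D' => /inj ->.
Qed.

Lemma effN_eq n m B c c' : finsup B -> n%:Z + deg B = m%:Z ->
  (forall A, finsup A -> deg A = m%:Z -> cL A = c.+1) ->
  (forall A, finsup A -> deg A = n%:Z -> cL A = c'.+1) ->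
  (effN n * c = effN m * c')%N.
Proof.
move=> fB dB hm hn; apply/eqP; rewrite eqn_leq (effN_le fB dB) //=.
apply: (@effN_le m n (fun P => - B P)) => //; first exact: finsupN.
by rewrite degN // -dB; lia.
Qed.

(** [effN_eq] with B a single place compares the degrees n and n + e. By Riemann's theorem a divisor
    of degree n has q^n G2 / G1 - 1 nonzero sections, and G1 is cleared. The threshold contains G1
    so that the subtractions are genuine. *)
Lemma effN_growth : exists e n0 G1 G2 : nat, [/\ (0 < e)%N, (0 < G2)%N,
  forall n, (n0 <= n)%N -> (G1 < q ^ n * G2)%N &
  forall n, (n0 <= n)%N ->
   (effN n * (q ^ (n + e) * G2 - G1) = effN (n + e) * (q ^ n * G2 - G1))%N].
Proof.
have [n0 [G1 [G2 [G1_gt0 G2_gt0 RR]]]] := riemann K.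
have [P0 _] := exists_xK_pole K.
pose e := place_degree P0.
have e0 : (0 < e)%N := place_degree_gt0 P0.
exists e, (maxn n0 G1), G1, G2.
have big n : (maxn n0 G1 <= n)%N -> (G1 < q ^ n * G2)%N.
  rewrite geq_max => /andP[_ Gn]; apply: (@leq_trans (q ^ n)); last exact: leq_pmulr.
  by apply: leq_ltn_trans Gn _; exact: ltn_expl (q_gt1 F).
split=> // n nn.
have n0n : (n0 <= n)%N by move: nn; rewrite geq_max => /andP[].
have fB := finsup_count [:: P0].
have dB : deg (fun P => (count_mem P [:: P0])%:Z) = e%:Z by rewrite deg_count /degl big_seq1.
have val m : (maxn n0 G1 <= m)%N -> exists c, (forall A, finsup A -> deg A = m%:Z -> cL A = c.+1)
    /\ ((exists A, finsup A /\ deg A = m%:Z) -> (c.+1 * G1 = q ^ m * G2)%N).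
  move=> nm; have n0m : (n0 <= m)%N by move: nm; rewrite geq_max => /andP[].
  have [[A [fA dA]]|H] := pselect (exists A, finsup A /\ deg A = m%:Z).
    exists (cL A).-1; rewrite prednK ?cL_gt0 //; split=> [A' fA' dA'|_].
      by apply/eqP; rewrite -(eqn_pmul2r G1_gt0) (RR _ _ fA' dA') // (RR _ _ fA dA).
    exact: RR.
  by exists 0%N; split=> // A fA dA; case: H; exists A.
have ne : (maxn n0 G1 <= n + e)%N by rewrite (leq_trans nn) // leq_addr.
have [c [hc ec]] := val _ ne; have [c' [hc' ec']] := val _ nn.
have := @effN_eq n (n + e) _ c c' fB; rewrite dB => /(_ erefl hc hc').
(* If no divisor has degree n, none has degree n + e, and both counts vanish. *)
have [[A [fA dA]]|H] := pselect (exists A, finsup A /\ deg A = n%:Z); last first.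
  have z m : (~ exists A, finsup A /\ deg A = m%:Z) -> effN m = 0%N.
    move=> H'; apply/eqP; rewrite /effN cardfs_eq0; apply/eqP/fsetP => D.
    rewrite in_eff inE; apply/eqP => Dm; apply: H'; exists (divZ D).
    by rewrite deg_divZ Dm; split=> //; exact: finsup_divZ.
  rewrite (z n H) (z (n + e)%N) ?mul0n // => -[A [fA dA]]; apply: H.
  exists (fun P => A P - (count_mem P [:: P0])%:Z); split; first exact: finsupB.
  by rewrite degB // dB dA; lia.
have /ec eG : exists A, finsup A /\ deg A = (n + e)%N%:Z.
  exists (fun P => A P + (count_mem P [:: P0])%:Z); split; first exact: finsupD.
  by rewrite degD // dB dA.
have eG' := ec' (ex_intro _ A (conj fA dA)).
rewrite -eG -eG' !mulSn !addKn => ecc.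
by rewrite !mulnA ecc.
Qed.

Definition primeN (k : nat) : nat :=
  (\sum_(P <- places_le k | (place_degree P %| k)%N) place_degree P)%N.

Lemma effN0 : effN 0 = 1%N.
Proof.
rewrite /effN (_ : eff 0 = [fset [fsfun with 0%N]]%fset) ?cardfs1 //.
apply/fsetP => D; rewrite in_eff in_fset1; apply/eqP/eqP => [D0|->].
  apply/fsfunP => P; rewrite fsfun0E; have := mult_le P D0; by rewrite leqn0 => /eqP.
by rewrite /div_degree finsupp0 big_seq_fset0.
Qed.

Definition add_mult D h P : effdiv K :=
  [fsfun Q in (P |` finsupp D)%fset => (D Q + h * (Q == P))%N | 0%N].
Definition sub_mult D h P : effdiv K :=
  [fsfun Q in finsupp D => (D Q - h * (Q == P))%N | 0%N].

Lemma add_multE D h P Q : add_mult D h P Q = (D Q + h * (Q == P))%N.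
Proof.
rewrite fsfunE !inE; case: eqP => [->//|_] /=; rewrite mem_finsupp muln0 addn0.
by case: eqP.
Qed.

Lemma sub_multE D h P Q : sub_mult D h P Q = (D Q - h * (Q == P))%N.
Proof. by rewrite fsfunE mem_finsupp; case: eqP => [->|] //=. Qed.

Lemma degree_add_mult D h P : div_degree (add_mult D h P) = (div_degree D + h * place_degree P)%N.
Proof.
apply: Posz_eq; rewrite -deg_divZ.
have -> : divZ (add_mult D h P) = fun Q => divZ D Q + (count_mem Q (nseq h P))%:Z.
  by apply/funext => Q; rewrite /divZ add_multE count_nseq /= eq_sym mulnC PoszD.
rewrite degD ?finsup_divZ ?deg_divZ ?deg_count; [|exact: finsup_divZ|exact: finsup_count].
by rewrite PoszD /degl big_nseq iter_addn_0 mulnC.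
Qed.

Lemma card_eff_mult n h P : (h * place_degree P <= n)%N ->
  #|` [fset D in eff n | (h <= (D : effdiv K) P)%N]%fset| = effN (n - h * place_degree P).
Proof.
move=> hn.
have -> : [fset D in eff n | (h <= (D : effdiv K) P)%N]%fset =
    [fset add_mult D h P | D in eff (n - h * place_degree P)]%fset.
  apply/fsetP => D; rewrite !inE /=; apply/andP/imfsetP => /=.
    move=> [Dn hD]; exists (sub_mult D h P).
      rewrite in_eff; have e : D = add_mult (sub_mult D h P) h P.
        apply/fsfunP => Q; rewrite add_multE sub_multE subnK //.
        by case: eqP => [->|_]; rewrite ?muln1 ?muln0.
      by move: Dn; rewrite in_eff {1}e degree_add_mult => /eqP <-; rewrite addnK.
    apply/fsfunP => Q; rewrite add_multE sub_multE subnK //.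
    by case: eqP => [->|_]; rewrite ?muln1 ?muln0.
  move=> [D' D'n ->]; rewrite in_eff in D'n; rewrite in_eff degree_add_mult (eqP D'n) subnK //.
  by rewrite eqxx add_multE eqxx muln1 leq_addl.
rewrite card_imfset //= => D D' e; apply/fsfunP => Q.
by have := congr1 (fun E : effdiv K => E Q) e; rewrite /= !add_multE => /addIn.
Qed.

Lemma div_degree_places n D : div_degree D = n ->
  n = (\sum_(P <- places_le n) D P * place_degree P)%N.
Proof.
move=> Dn; apply: Posz_eq; rewrite -{1}Dn -deg_divZ (@degE _ _ _ (places_le n)) ?fset_uniq //.
  by rewrite (big_morph Posz PoszD erefl); apply: eq_bigr => P _; rewrite PoszM.
by move=> P DP; apply: supp_places_le Dn _; move: DP; rewrite /divZ.
Qed.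

(** Logarithmic derivative of the Euler product, by counting: the degree of D is the sum of deg P
    over the pairs (P, h) with 1 <= h <= D(P), and subtracting hP identifies the D with D(P) >= h
    with the effective divisors of degree n - h deg P. *)
Lemma effN_primeN n : (n * effN n = \sum_(1 <= k < n.+1) primeN k * effN (n - k))%N.
Proof.
have -> : (n * effN n = \sum_(D <- eff n) \sum_(P <- places_le n)
    \sum_(1 <= h < n.+1) (h <= (D : effdiv K) P) * place_degree P)%N.
  rewrite /effN -sum1_size big_distrr /=; apply: eq_big_seq => D.
  rewrite in_eff muln1 => /eqP Dn; rewrite {1}(div_degree_places Dn).
  apply: eq_bigr => P _; rewrite -big_distrl /= sum_leq_indicator.
  by congr (_ * _)%N; apply/esym/minn_idPl; exact: mult_le.
rewrite exchange_big /=.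
transitivity (\sum_(P <- places_le n) \sum_(1 <= k < n.+1 | (place_degree P %| k)%N) place_degree P * effN (n - k))%N.
  apply: eq_big_seq => P; rewrite in_places_le => Pn.
  rewrite sum_multiples ?place_degree_gt0 // exchange_big /= [RHS]big_mkcond.
  apply: eq_big_nat => h /andP[h1 hn]; rewrite -big_distrl /=.
  case: ifP => hP; last first.
    rewrite big1_seq ?mul0n // => D; rewrite in_eff => /= /eqP Dn.
    apply/eqP; rewrite eqb0; apply/negP => hD; move/negP: hP; apply.
    by apply: leq_trans (degree_le P Dn); rewrite leq_mul2r hD orbT.
  rewrite mulnC -(card_eff_mult hP); congr (_ * _)%N.
  rewrite -sum1_size -big_fset_condE [RHS]big_mkcond /=.
  by apply: eq_bigr => D _; case: leqP.
under eq_bigr do rewrite big_mkcond.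
rewrite exchange_big /=; apply: eq_big_nat => k /andP[k1 kn].
rewrite -big_mkcond -big_distrl /=; congr (_ * _)%N.
rewrite /primeN big_fset_condE [RHS]big_fset_condE.
suff -> : [fset i in places_le n | (place_degree i %| k)%N]%fset =
          [fset i in places_le k | (place_degree i %| k)%N]%fset by [].
apply/fsetP => P; rewrite !inE !in_places_le; case dk : (place_degree P %| k)%N; rewrite ?andbF //.
have : (place_degree P <= k)%N by rewrite dvdn_leq.
by move=> le; rewrite le (leq_trans le).
Qed.

End EffectiveDivisors.

(** * Rational generating functions *)

Section ExponentialSums.
Variable E : numClosedFieldType.
Implicit Types (p r : {poly E}) (s : seq E).

Lemma factor_const1 p : p`_0 = 1 -> exists s, p = \prod_(z <- s) (1 - z *: 'X).
Proof.
move=> p0; have [r pE] := closed_field_poly_normal p.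
have r0 : lead_coef p * \prod_(z <- r) - z = 1.
  have e : p.[0] = lead_coef p * \prod_(z <- r) - z.
    rewrite {1}pE hornerZ horner_prod; congr (_ * _).
    by apply: eq_bigr => z _; rewrite hornerXsubC sub0r.
  by rewrite -e horner_coef0.
have nz z : z \in r -> z != 0.
  move=> zr; apply/eqP => z0; move: r0; rewrite (big_rem z) //= z0 oppr0 mul0r mulr0 => /eqP.
  by rewrite eq_sym oner_eq0.
exists [seq z^-1 | z <- r]; rewrite {1}pE big_map.
have -> : \prod_(z <- r) ('X - z%:P) = (\prod_(z <- r) - z) *: \prod_(z <- r) (1 - z^-1 *: 'X).
  rewrite -scaler_prod; apply: eq_big_seq => z /nz z0.
  by rewrite scalerBr scalerA mulNr divff // scaleN1r opprK addrC -polyCN alg_polyC.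
by rewrite scalerA r0 scale1r.
Qed.

(** Power series are treated as polynomials modulo X^m, a congruence being divisibility of a
    difference. *)
Lemma dvdXnP m p : reflect (forall i, (i < m)%N -> p`_i = 0) ('X^m %| p).
Proof.
apply: (iffP idP) => [/dvdpP[g ->] i im|H]; first by rewrite coefMXn im.
rewrite -[p](poly_take_drop m) dvdp_addr ?dvdp_mull //.
rewrite (_ : take_poly m p = 0) ?dvdp0 //; apply/polyP => i.
by rewrite coef_take_poly coef0; case: ifP => // /H.
Qed.

Lemma coprimepX m p : p`_0 != 0 -> coprimep 'X^m p.
Proof.
move=> p0; rewrite coprimep_expl // coprimep_sym.
have : coprimep p ('X - 0%:P) by rewrite coprimep_XsubC rootE horner_coef0.
by rewrite polyC0 subr0.
Qed.

(** Truncation of the sum of z X / (1 - z X) over z in s. *)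
Definition psum s m : {poly E} := \poly_(k < m) (if k == 0%N then 0 else \sum_(z <- s) z ^+ k).

Lemma psum_cons z s m : psum (z :: s) m = psum [:: z] m + psum s m.
Proof.
apply/polyP => k; rewrite coefD !coef_poly; case: ifP => _; last by rewrite addr0.
by case: eqP => _; rewrite ?addr0 // big_cons big_seq1.
Qed.

Lemma psum1_dvd z m : 'X^m %| z *: 'X - psum [:: z] m * (1 - z *: 'X).
Proof.
apply/dvdXnP => -[|i] im.
  by rewrite coefB coefZ coefX mulr0 coefM big_ord1 coef_poly im mul0r subr0.
rewrite coefB coefZ coefX mulrBr mulr1 -scalerAr coefB coefZ coefMX /= !coef_poly im.
rewrite (ltnW im) !big_seq1 eqSS.
by case: i im => [|i] _ /=; rewrite ?mulr0 ?subr0 ?mulr1 ?expr1 ?subrr // -exprS subrr sub0r oppr0 mulr0.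
Qed.

(** Newton's identities: for r the product of the 1 - z X, the series X r'/r is minus the sum of the
    z X / (1 - z X). *)
Lemma newton_dvd s m :
  'X^m %| 'X * (\prod_(z <- s) (1 - z *: 'X))^`() + psum s m * \prod_(z <- s) (1 - z *: 'X).
Proof.
elim: s => [|z s IH].
  rewrite big_nil -polyC1 derivC mulr0 add0r mulr1.
  apply/dvdXnP => i im; rewrite coef_poly im; case: eqP => // _; by rewrite big_nil.
rewrite big_cons psum_cons; move: IH; set r := \prod_(j <- s) _ => IH.
have dE : (1 - z *: 'X : {poly E})^`() = - z%:P.
  by rewrite derivB derivZ derivX -polyC1 derivC sub0r alg_polyC.
rewrite derivM dE -!mul_polyC.
rewrite (_ : 'X * _ + _ = (1 - z%:P * 'X) * ('X * r^`() + psum s m * r)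
   - (z%:P * 'X - psum [:: z] m * (1 - z%:P * 'X)) * r); last by ring.
rewrite mul_polyC.
by apply: dvdp_sub; [exact: dvdp_mull | apply: dvdp_mulr; exact: psum1_dvd].
Qed.

Variables (a N : nat -> E) (Q : {poly E}) (d : nat).
Hypotheses (a0 : a 0%N = 1) (Q0 : Q`_0 = 1).
Hypothesis aQ : forall n, (d <= n)%N -> \sum_(i < n.+1) a i * Q`_(n - i) = 0.
Hypothesis aN : forall n, a n *+ n = \sum_(1 <= k < n.+1) N k * a (n - k)%N.

(** By [aN] the generating series of N is X A'/A. Since A Q = P is a polynomial, this is X P'/P - X
    Q'/Q, and factoring Q and P into factors 1 - z X gives the two sums of powers. *)
Lemma exponential_sum : exists s1 s2 : seq E, forall k, (0 < k)%N ->
  N k = \sum_(z <- s1) z ^+ k - \sum_(z <- s2) z ^+ k.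
Proof.
pose P := \poly_(n < d.+1) \sum_(i < n.+1) a i * Q`_(n - i).
have P0 : P`_0 = 1 by rewrite coef_poly /= big_ord1 a0 Q0 mulr1.
have [s1 s1E] := factor_const1 Q0; have [s2 s2E] := factor_const1 P0.
exists s1, s2 => k k0; pose m := k.+1; pose A := \poly_(i < m) a i.
pose S := \poly_(i < m) (if i == 0%N then 0 else N i).
have h1 : 'X^m %| A * Q - P.
  apply/dvdXnP => n nm; rewrite coefB coefM coef_poly.
  have -> : \sum_(j < n.+1) A`_j * Q`_(n - j) = \sum_(i < n.+1) a i * Q`_(n - i).
    by apply: eq_bigr => j _; rewrite coef_poly (leq_trans (ltn_ord j)).
  by case: ifPn => [_|]; rewrite ?subrr // -leqNgt => dn; rewrite aQ ?subr0 // ltnW.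
have h2 : 'X^m %| 'X * (A * Q - P)^`().
  apply/dvdXnP => i im; rewrite coefXM; case: i im => // i im /=.
  by rewrite coef_deriv (dvdXnP _ _ h1) // mul0rn.
have h3 := newton_dvd s2 m; have h4 := newton_dvd s1 m; rewrite -s1E in h4; rewrite -s2E in h3.
have h5 : 'X^m %| 'X * A^`() - S * A.
  apply/dvdXnP => n nm; rewrite coefB coefXM coefM.
  have -> : \sum_(j < n.+1) S`_j * A`_(n - j) = a n *+ n.
    rewrite aN big_ord_recl coef_poly /= mul0r add0r big_add1 big_mkord.
    apply: eq_bigr => j _; rewrite !coef_poly /bump /= add1n.
    by rewrite (leq_ltn_trans (ltn_ord j) nm) (leq_ltn_trans (leq_subr _ _) nm).
  case: n nm => [|n] nm /=; first by rewrite mulr0n subr0.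
  by rewrite coef_deriv coef_poly nm subrr.
have Qcop : coprimep 'X^m Q.
  by apply: coprimepX; rewrite Q0 oner_neq0.
have Acop : coprimep 'X^m A.
  by apply: coprimepX; rewrite coef_poly a0 oner_neq0.
(* Q is prime to X^m, so the congruence may be checked after multiplication by Q, where A Q can be
   replaced by P. *)
have h6 : 'X^m %| 'X * A^`() - (psum s1 m - psum s2 m) * A.
  rewrite -(Gauss_dvdpl _ Qcop).
  rewrite (_ : _ * Q = 'X * (A * Q - P)^`() + ('X * P^`() + psum s2 m * P)
     + psum s2 m * (A * Q - P) - A * ('X * Q^`() + psum s1 m * Q)); last first.
    rewrite derivB derivM; ring.
  apply: dvdp_sub; last exact: dvdp_mull.
  apply: dvdp_add; last exact: dvdp_mull.
  exact: dvdp_add.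
have h7 : 'X^m %| S - (psum s1 m - psum s2 m).
  rewrite -(Gauss_dvdpl _ Acop).
  rewrite (_ : _ * A = ('X * A^`() - (psum s1 m - psum s2 m) * A) - ('X * A^`() - S * A)); last by ring.
  exact: dvdp_sub.
have := dvdXnP _ _ h7 k (ltnSn k); rewrite !coefB !coef_poly ltnSn.
by rewrite (gtn_eqF k0) => /eqP; rewrite subr_eq0 => /eqP.
Qed.

End ExponentialSums.

(** Distinct bases with nonzero coefficients are what allows one base to be isolated and bounded. *)
Lemma merge_sums (E : fieldType) (s1 s2 : seq E) : exists t : seq E, exists c : E -> E,
  [/\ uniq t, forall z, z \in t -> c z != 0 & forall k,
  \sum_(z <- s1) z ^+ k - \sum_(z <- s2) z ^+ k = \sum_(z <- t) c z * z ^+ k].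
Proof.
pose c z : E := (count_mem z s1)%:R - (count_mem z s2)%:R.
exists [seq z <- undup (s1 ++ s2) | c z != 0], c; split.
- by rewrite filter_uniq // undup_uniq.
- by move=> z; rewrite mem_filter => /andP[].
move=> k; rewrite big_filter [RHS]big_mkcond /=.
have S (s u : seq E) : uniq u -> {subset s <= u} ->
    \sum_(z <- s) z ^+ k = \sum_(z <- u) (count_mem z s)%:R * z ^+ k.
  move=> uu; elim: s => [|y s IH] su.
    by rewrite big_nil big1 // => z _; rewrite mul0r.
  rewrite big_cons IH; last by move=> z zs; apply: su; rewrite inE zs orbT.
  have yu : y \in u by apply: su; rewrite mem_head.
  have -> : y ^+ k = \sum_(z <- u) (y == z)%:R * z ^+ k.
    rewrite (bigD1_seq y) //= eqxx mul1r big1 ?addr0 // => z zy.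
    by rewrite eq_sym (negPf zy) mul0r.
  by rewrite -big_split /=; apply: eq_bigr => z _; rewrite natrD mulrDl.
rewrite (S s1 (undup (s1 ++ s2))) ?undup_uniq //; last first.
  by move=> z zs; rewrite mem_undup mem_cat zs.
rewrite (S s2 (undup (s1 ++ s2))) ?undup_uniq //; last first.
  by move=> z zs; rewrite mem_undup mem_cat zs orbT.
rewrite -sumrB; apply: eq_bigr => z _; rewrite -mulrBl -/(c z).
by case: eqP => [->|//]; rewrite mul0r.
Qed.

(* Lagrange interpolation on the exponents isolates a single term. *)
Lemma isolate_term (E : fieldType) (t : seq E) (c : E -> E) z : uniq t -> z \in t ->
  exists p : {poly E}, forall (k : nat),
  c z * z ^+ k = \sum_(i < size p) p`_i * \sum_(y <- t) c y * y ^+ (k + i).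
Proof.
move=> ut zt; pose r := \prod_(y <- rem z t) ('X - y%:P).
have rz : r.[z] != 0.
  rewrite horner_prod; rewrite prodf_seq_neq0; apply/allP => y; rewrite mem_rem_uniq // !inE => /andP[yz _].
  by rewrite hornerXsubC subr_eq0 eq_sym.
exists (r.[z]^-1 *: r) => k.
under eq_bigr do rewrite mulr_sumr.
rewrite exchange_big /=.
transitivity (\sum_(y <- t) c y * y ^+ k * (r.[z]^-1 *: r).[y]); last first.
  apply: eq_bigr => y _; rewrite horner_coef mulr_sumr; apply: eq_bigr => i _.
  by rewrite exprD; ring.
rewrite (bigD1_seq z) //= hornerZ mulVf // mulr1 big1_seq ?addr0 // => y /andP[yz yt].
have ry : r.[y] = 0.
  by rewrite horner_prod (big_rem y) /= ?hornerXsubC ?subrr ?mul0r // mem_rem_uniq // !inE yz.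
by rewrite hornerZ ry !mulr0.
Qed.

(** * Complex analysis *)

Section ComplexNorm.
Variable R : realType.
Local Notation C := (Cplx R).
Implicit Types (z w : C) (u : nat -> C).

(** The norm of C takes its values in C; estimates use this real modulus, for which the order is
    total. *)
Definition nrm z : R := Num.sqrt (complex.Re z ^+ 2 + complex.Im z ^+ 2).

Lemma normE z : `|z| = ((nrm z)%:C%C : C).
Proof. by case: z => a b; exact: (@normc_def R (a +i* b)%C). Qed.

Definition toC (x : R) : C := (x%:C)%C.

Lemma toCD x y : toC (x + y) = toC x + toC y. Proof. exact: (rmorphD (real_complex R)). Qed.
Lemma toCM x y : toC (x * y) = toC x * toC y. Proof. exact: (rmorphM (real_complex R)). Qed.
Lemma toCB x y : toC (x - y) = toC x - toC y. Proof. exact: (rmorphB (real_complex R)). Qed.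
Lemma toCV x : toC x^-1 = (toC x)^-1. Proof. exact: (fmorphV (real_complex R)). Qed.
Lemma toCX x n : toC (x ^+ n) = toC x ^+ n. Proof. exact: (rmorphXn (real_complex R)). Qed.
Lemma toCn n : toC n%:R = n%:R. Proof. exact: (rmorph_nat (real_complex R)). Qed.
Lemma toC0 : toC 0 = 0. Proof. by []. Qed.
Lemma toC_inj : injective toC. Proof. by move=> x y []. Qed.
Lemma toC_le x y : (toC x <= toC y) = (x <= y). Proof. exact: (@lecR R). Qed.
Lemma toC_lt x y : (toC x < toC y) = (x < y). Proof. exact: (@ltcR R). Qed.

Lemma normE' z : `|z| = toC (nrm z). Proof. exact: normE. Qed.

Lemma nrm_ge0 z : 0 <= nrm z. Proof. exact: sqrtr_ge0. Qed.
Lemma nrmM z w : nrm (z * w) = nrm z * nrm w.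
Proof. by apply: toC_inj; rewrite toCM -!normE' normrM. Qed.
Lemma nrmD z w : nrm (z + w) <= nrm z + nrm w.
Proof. by rewrite -toC_le toCD -!normE' ler_normD. Qed.
Lemma nrmN z : nrm (- z) = nrm z.
Proof. by apply: toC_inj; rewrite -!normE' normrN. Qed.
Lemma nrmB z w : nrm (z - w) <= nrm z + nrm w.
Proof. by rewrite -(nrmN w); exact: nrmD. Qed.
Lemma nrm_subC z w : nrm (z - w) = nrm (w - z).
Proof. by rewrite -nrmN opprB. Qed.
Lemma nrm0 : nrm 0 = 0.
Proof. by apply: toC_inj; rewrite -normE' normr0. Qed.
Lemma nrm1 : nrm 1 = 1.
Proof. by apply: toC_inj; rewrite -normE' normr1. Qed.
Lemma nrmV z : nrm z^-1 = (nrm z)^-1.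
Proof. by apply: toC_inj; rewrite toCV -!normE' normfV. Qed.
Lemma nrmX z n : nrm (z ^+ n) = nrm z ^+ n.
Proof. by apply: toC_inj; rewrite toCX -!normE' normrX. Qed.
Lemma nrm_eq0 z : (nrm z == 0) = (z == 0).
Proof. by rewrite -(inj_eq toC_inj) -normE' normr_eq0. Qed.
Lemma nrm_gt0 z : (0 < nrm z) = (z != 0).
Proof. by rewrite lt_def nrm_ge0 andbT nrm_eq0. Qed.
Lemma nrm_toC x : nrm (toC x) = `|x|.
Proof. by rewrite /nrm /= expr0n addr0 sqrtr_sqr. Qed.
Lemma nrmn n : nrm n%:R = n%:R.
Proof. by rewrite -toCn nrm_toC ger0_norm. Qed.

Lemma nrm_sum (I : Type) (r : seq I) (Q : pred I) (f : I -> C) :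
  nrm (\sum_(i <- r | Q i) f i) <= \sum_(i <- r | Q i) nrm (f i).
Proof.
elim/big_rec2: _ => [|i x y _ le]; first by rewrite nrm0.
by apply: le_trans (nrmD _ _) _; rewrite lerD2l.
Qed.

Lemma Re_le_nrm z : `|complex.Re z| <= nrm z.
Proof. by rewrite /nrm -sqrtr_sqr ler_wsqrtr // lerDl sqr_ge0. Qed.

Lemma Im_le_nrm z : `|complex.Im z| <= nrm z.
Proof. by rewrite /nrm -sqrtr_sqr ler_wsqrtr // lerDr sqr_ge0. Qed.

Lemma nrm_le z : nrm z <= `|complex.Re z| + `|complex.Im z|.
Proof.
have h : 0 <= `|complex.Re z| + `|complex.Im z| by rewrite addr_ge0.
rewrite /nrm -[leRHS](ger0_norm h) -[leRHS]sqrtr_sqr ler_wsqrtr //.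
by rewrite sqrrD !real_normK ?num_real // lerD2r lerDl mulrn_wge0 // mulr_ge0.
Qed.

Lemma nrm_dist z w : nrm z - nrm w <= nrm (z - w).
Proof. by rewrite lerBlDr; apply: le_trans (nrmD _ _); rewrite subrK. Qed.

Lemma cReD z w : complex.Re (z + w) = complex.Re z + complex.Re w.
Proof. by case: z => a b; case: w. Qed.
Lemma cImD z w : complex.Im (z + w) = complex.Im z + complex.Im w.
Proof. by case: z => a b; case: w. Qed.
Lemma cReN z : complex.Re (- z) = - complex.Re z. Proof. by case: z. Qed.
Lemma cImN z : complex.Im (- z) = - complex.Im z. Proof. by case: z. Qed.
Lemma cReB z w : complex.Re (z - w) = complex.Re z - complex.Re w.
Proof. by rewrite cReD cReN. Qed.
Lemma cImB z w : complex.Im (z - w) = complex.Im z - complex.Im w.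
Proof. by rewrite cImD cImN. Qed.
Lemma cReM z w : complex.Re (z * w) = complex.Re z * complex.Re w - complex.Im z * complex.Im w.
Proof. by case: z => a b; case: w. Qed.
Lemma cImM z w : complex.Im (z * w) = complex.Re z * complex.Im w + complex.Im z * complex.Re w.
Proof. by case: z => a b; case: w. Qed.
Lemma eq_ReIm z w : complex.Re z = complex.Re w -> complex.Im z = complex.Im w -> z = w.
Proof. by case: z => a b; case: w => c d /= -> ->. Qed.

Lemma posC (e : C) : 0 < e -> exists2 d : R, 0 < d & e = toC d.
Proof.
move=> e0; exists (nrm e); first by rewrite nrm_gt0 gt_eqF.
by rewrite -normE' gtr0_norm.
Qed.

Definition tends u (l : C) := forall e : R, 0 < e ->
  exists N : nat, forall n, (N <= n)%N -> nrm (u n - l) < e.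

Lemma tends_cvg u l : tends u l -> u @ \oo --> l.
Proof.
move=> H; apply/cvgrPdist_lt => e /posC[d d0 ->].
have [N HN] := H d d0; exists N => // n /= Nn.
by rewrite normE' toC_lt nrm_subC; exact: HN.
Qed.

Lemma nbhs_nrm (z : C) (P : C -> Prop) : (exists2 d : R, 0 < d & forall w, nrm (w - z) < d -> P w) ->
  \forall w \near z, P w.
Proof.
move=> [d d0 H]; apply/nbhs_ballP; exists (toC d); first by rewrite /= toC_lt.
move=> w; rewrite /ball /= normE' toC_lt nrm_subC; exact: H.
Qed.

Lemma nbhs_nrmP (z : C) (P : C -> Prop) : (\forall w \near z, P w) ->
  exists2 d : R, 0 < d & forall w, nrm (w - z) < d -> P w.
Proof.
move=> /nbhs_ballP[e /posC[d d0 ->] H]; exists d => // w wz; apply: H.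
by rewrite /ball /= normE' toC_lt nrm_subC.
Qed.

Lemma dnbhs_nrm (z : C) (P : C -> Prop) :
  (exists2 d : R, 0 < d & forall w, w != z -> nrm (w - z) < d -> P w) ->
  \forall w \near z^', P w.
Proof. by move=> [d d0 H]; apply: nbhs_nrm; exists d => // w wz /= nwz; exact: H. Qed.

Definition has_der (f : C -> C) (z g : C) := forall e : R, 0 < e ->
  exists2 d : R, 0 < d & forall h, nrm h < d -> nrm (f (z + h) - f z - g * h) <= e * nrm h.

Lemma has_der_derivable f z g : has_der f z g -> derivable (f : C^o -> C^o) z 1.
Proof.
move=> H; apply/cvg_ex; exists (g : C^o); apply/cvgrPdist_le => e /posC[r r0 ->].
have [d d0 hd] := H r r0; apply: dnbhs_nrm; exists d => // h h0; rewrite subr0 => hd'.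
rewrite /= normE' toC_le nrm_subC.
have -> : h^-1 *: (f (h *: 1 + z) - f z) - g = h^-1 * (f (z + h) - f z - g * h) :> C.
  rewrite /GRing.scale /= mulr1 (addrC h) [in RHS]mulrBr; congr (_ - _).
  by rewrite mulrCA mulVf // mulr1.
have := hd h hd'; rewrite nrmM nrmV => le.
by rewrite mulrC ler_pdivrMr // nrm_gt0.
Qed.

End ComplexNorm.

(** * Second-order bounds for sine, cosine and the exponential *)

Section RealBounds.
Variable R : realType.

Lemma mvt0 (f df : R -> R) (b : R) : (forall x : R, is_derive x (1 : R) f (df x)) ->
  exists2 c : R, `|c| <= `|b| & f b - f 0 = df c * b.
Proof.
move=> fd.
have cf (x y : R) : {within `[x, y], continuous f}.
  by apply: derivable_within_continuous => z _; exact: ex_derive.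
case: (ltgtP b 0) => [b0|b0|->]; last by exists 0; rewrite ?subrr ?mulr0.
- have [c + e] := MVT b0 (fun x _ => fd x) (cf _ _).
  rewrite in_itv /= => /andP[bc c0]; exists c; first by rewrite !ltr0_norm // lerN2 ltW.
  by apply/eqP; rewrite -eqr_opp opprB e sub0r mulrN.
- have [c + e] := MVT b0 (fun x _ => fd x) (cf _ _).
  rewrite in_itv /= => /andP[c0 bc]; exists c; first by rewrite !gtr0_norm // ltW.
  by rewrite e subr0.
Qed.

Lemma sin_le_norm (b : R) : `|sin b| <= `|b|.
Proof.
have [c _ e] := @mvt0 sin cos b (@is_derive_sin R).
move: e; rewrite sin0 subr0 => ->; rewrite normrM ler_piMl // cos_max //.
Qed.

Lemma cos_quad (b : R) : `|cos b - 1| <= b ^+ 2.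
Proof.
have [c cb e] := @mvt0 cos (fun x => - sin x) b (@is_derive_cos R).
move: e; rewrite cos0 => ->; rewrite normrM normrN -(@real_normK _ b) ?num_real //.
rewrite expr2 ler_wpM2r //; apply: le_trans (sin_le_norm _) cb.
Qed.

Lemma sin_quad (b : R) : `|b| <= 1 -> `|sin b - b| <= b ^+ 2.
Proof.
move=> b1.
have D x : is_derive x (1 : R) (fun x : R => sin x - x) (cos x - 1).
  by apply: is_deriveB.
have [c cb e] := @mvt0 (fun x : R => sin x - x) (fun x => cos x - 1) b D.
move: e; rewrite sin0 subrr subr0 => ->; rewrite normrM -(@real_normK _ b) ?num_real //.
rewrite expr2 ler_wpM2r //; apply: le_trans (cos_quad _) _.
rewrite -(@real_normK _ c) ?num_real // expr2.
by rewrite (le_trans _ cb) // ler_piMr // (le_trans cb).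
Qed.

(** Only 1 + a <= e^a is used, for a and for -a; the second gives e^a (1 - a) <= 1, hence the upper
    bound. *)
Lemma expR_quad (a : R) : `|a| <= 1/2 -> `|expR a - 1 - a| <= 2 * a ^+ 2.
Proof.
rewrite ler_norml => /andP[a1 a2].
have h1 := expR_ge1Dx a; have h2 := expR_ge1Dx (- a).
have h3 : expR a * expR (- a) = 1 by rewrite -expRD subrr expR0.
have h4 := expR_gt0 a.
rewrite ger0_norm; last by lra.
move: (expR a) (expR (- a)) h1 h2 h3 h4 => x y h1 h2 h3 h4.
have h5 : x * (1 - a) <= 1 by rewrite -h3 ler_pM2l //; lra.
nra.
Qed.

End RealBounds.

(** * Complex exponential, differentiability and meromorphic functions *)

Section ComplexExp.
Variable R : realType.
Local Notation C := (Cplx R).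
Implicit Types (z w s : C).

Lemma cexpD z w : cexp (z + w) = cexp z * cexp w.
Proof.
apply: eq_ReIm; rewrite /cexp ?cReM ?cImM /= cReD cImD expRD cosD sinD; ring.
Qed.

Lemma cexp0 : cexp (0 : C) = 1.
Proof. by apply: eq_ReIm; rewrite /cexp ?cReM ?cImM /= expR0 cos0 sin0; ring. Qed.

Lemma nrm_cexp z : nrm (cexp z) = expR (complex.Re z).
Proof.
rewrite /cexp nrmM nrm_toC gtr0_norm ?expR_gt0 // /nrm /= cos2Dsin2 sqrtr1 mulr1 //.
Qed.

Lemma cexp_neq0 z : cexp z != 0.
Proof. by rewrite -nrm_gt0 nrm_cexp expR_gt0. Qed.

Lemma cexpN z : cexp (- z) = (cexp z)^-1.
Proof.
by apply: (mulfI (cexp_neq0 z)); rewrite -cexpD subrr cexp0 divff // cexp_neq0.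
Qed.

Lemma cexpMn z n : cexp (z *+ n) = cexp z ^+ n.
Proof. by elim: n => [|n IH]; rewrite ?mulr0n ?cexp0 // mulrS cexpD IH exprS. Qed.

Lemma cexp_quad z : nrm z <= 1/2 -> nrm (cexp z - 1 - z) <= 10 * nrm z ^+ 2.
Proof.
move=> z1; have hR := Re_le_nrm z; have hI := Im_le_nrm z.
have n2 : nrm z ^+ 2 = complex.Re z ^+ 2 + complex.Im z ^+ 2.
  by rewrite /nrm sqr_sqrtr // addr_ge0 ?sqr_ge0.
rewrite n2; move: hR hI; set a := complex.Re z; set b := complex.Im z => hR hI.
have ha : `|a| <= 1/2 by exact: le_trans z1.
have hb : `|b| <= 1/2 by exact: le_trans z1.
have := expR_quad ha; rewrite ler_norml => /andP[e1 e2].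
have := cos_quad b; rewrite ler_norml => /andP[c1 c2].
have hb1 : `|b| <= 1 by lra.
have := sin_quad hb1; rewrite ler_norml => /andP[s1 s2].
move: ha; rewrite ler_norml => /andP[a1 a2]; move: (hb); rewrite ler_norml => /andP[b1 b2].
apply: le_trans (nrm_le _) _.
rewrite !cReB !cImB /cexp cReM cImM /= !mul0r subr0 addr0 -/a -/b.
have c3 : cos b <= 1 by exact: cos_le1.
have c4 : -1 <= cos b by exact: cos_geN1.
have s3 : sin b <= 1 by exact: sin_le1.
have s4 : -1 <= sin b by exact: sin_geN1.
have -> : expR a * cos b - 1 - a = (expR a - 1 - a) * cos b + (1 + a) * (cos b - 1) by ring.
have -> : expR a * sin b - 0 - b = (expR a - 1 - a) * sin b + (1 + a) * (sin b - b) + a * b by ring.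
move: (expR a - 1 - a) (cos b - 1) (sin b - b) e1 e2 c1 c2 s1 s2 => x y t e1 e2 c1 c2 s1 s2.
have a0 : 0 <= a ^+ 2 by exact: sqr_ge0.
have b0 : 0 <= b ^+ 2 by exact: sqr_ge0.
have H (p k m : R) : - m <= p <= m -> -1 <= k <= 1 -> 0 <= m -> `|p * k| <= m.
  move=> /andP[p1 p2] /andP[k1 k2] m0; rewrite normrM -[leRHS]mulr1.
  by apply: ler_pM => //; rewrite ler_norml ?p1 ?k1.
have h1 : `|x * cos b| <= 2 * a ^+ 2 by apply: H; [lra|lra|nra].
have h2 : `|x * sin b| <= 2 * a ^+ 2 by apply: H; [lra|lra|nra].
have h3 : `|(1 + a) * y| <= 2 * b ^+ 2.
  rewrite (_ : _ * y = (2 * y) * ((1 + a) / 2)); last by field.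
  by apply: H; [lra|lra|nra].
have h4 : `|(1 + a) * t| <= 2 * b ^+ 2.
  rewrite (_ : _ * t = (2 * t) * ((1 + a) / 2)); last by field.
  by apply: H; [lra|lra|nra].
have h5 : `|a * b| <= a ^+ 2 + b ^+ 2 by rewrite ler_norml; apply/andP; split; nra.
have := ler_normD (x * cos b) ((1 + a) * y).
have := ler_normD (x * sin b + (1 + a) * t) (a * b).
have := ler_normD (x * sin b) ((1 + a) * t).
lra.
Qed.

Lemma quad_has_der (f : C -> C) z g (K r : R) : 0 < r ->
  (forall h, nrm h < r -> nrm (f (z + h) - f z - g * h) <= K * nrm h ^+ 2) -> has_der f z g.
Proof.
move=> r0 H e e0; exists (Num.min r (e / (`|K| + 1))).
  by rewrite lt_min r0 divr_gt0 // ltr_wpDl.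
move=> h; rewrite lt_min => /andP[h1 h2]; apply: le_trans (H h h1) _.
rewrite expr2 mulrA ler_wpM2r ?nrm_ge0 //.
move: h2; rewrite ltr_pdivlMr ?ltr_wpDl // => h2.
have := ler_norm K; have := nrm_ge0 h; nra.
Qed.

Lemma has_der_cexp (a b s : C) : has_der (fun s => cexp (a * s + b)) s (a * cexp (a * s + b)).
Proof.
pose r : R := 1 / (2 * (nrm a + 1)).
have na := nrm_ge0 a.
have r0 : 0 < r by rewrite divr_gt0 // mulr_gt0 // ltr_wpDl.
apply: (@quad_has_der _ _ _ (nrm (cexp (a * s + b)) * 10 * nrm a ^+ 2) r r0) => h hr.
have nh := nrm_ge0 h.
have hah : nrm (a * h) <= 1 / 2.
  rewrite nrmM; move: hr; rewrite /r ltr_pdivlMr ?mulr_gt0 ?ltr_wpDl // => hr; nra.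
have -> : cexp (a * (s + h) + b) - cexp (a * s + b) - a * cexp (a * s + b) * h =
    cexp (a * s + b) * (cexp (a * h) - 1 - a * h).
  rewrite (_ : a * (s + h) + b = (a * s + b) + a * h); last by ring.
  rewrite cexpD; ring.
rewrite nrmM -!mulrA ler_wpM2l ?nrm_ge0 //.
apply: le_trans (cexp_quad hah) _; rewrite nrmM le_eqVlt; apply/orP; left; apply/eqP; ring.
Qed.

Record dv (f : C -> C) w : Prop := Dv { dv_derivable : derivable (f : C^o -> C^o) w 1 }.

Lemma dv_cexp a b s : dv (fun s => cexp (a * s + b)) s.
Proof. exact/Dv/has_der_derivable/has_der_cexp. Qed.

Lemma dv_cst (c s : C) : dv (fun=> c) s.
Proof. exact/Dv/derivable_cst. Qed.

Lemma dv_id (s : C) : dv id s.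
Proof. exact/Dv/derivable_id. Qed.

Lemma dvD f g s : dv f s -> dv g s -> dv (fun s => f s + g s) s.
Proof. by move=> [df] [dg]; split; exact: (@derivableD _ _ _ (f : C^o -> C^o) (g : C^o -> C^o) _ _ df dg). Qed.

Lemma dvB f g s : dv f s -> dv g s -> dv (fun s => f s - g s) s.
Proof. by move=> [df] [dg]; split; exact: (@derivableB _ _ _ (f : C^o -> C^o) (g : C^o -> C^o) _ _ df dg). Qed.

Lemma dvM f g s : dv f s -> dv g s -> dv (fun s => f s * g s) s.
Proof. by move=> [df] [dg]; split; exact: (@derivableM _ _ (f : C^o -> C^o) (g : C^o -> C^o) _ _ df dg). Qed.

Lemma dvV f s : f s != 0 -> dv f s -> dv (fun s => (f s)^-1) s.
Proof. by move=> f0 [df]; split; exact: (@derivableV _ _ (f : C^o -> C^o) _ _ f0 df). Qed.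

Lemma dvX f s n : dv f s -> dv (fun s => f s ^+ n) s.
Proof.
move=> df; elim: n => [|n IH].
  by rewrite (_ : (fun s => _) = fun=> 1); [exact: dv_cst | apply/funext => w; rewrite expr0].
have -> : (fun s => f s ^+ n.+1) = fun w => f w * (fun w => f w ^+ n) w.
  by apply/funext => w; rewrite exprS.
exact: (dvM df IH).
Qed.

Lemma dv_prod (I : Type) (r : seq I) (f : I -> C -> C) s :
  (forall i, dv (f i) s) -> dv (fun s => \prod_(i <- r) f i s) s.
Proof.
move=> df; elim: r => [|i r IH].
  by rewrite (_ : (fun s => _) = fun=> 1); [exact: dv_cst | apply/funext => w; rewrite big_nil].
have -> : (fun s => \prod_(i <- i :: r) f i s) = fun w => f i w * (fun w => \prod_(i <- r) f i w) w.
  by apply/funext => w; rewrite big_cons.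
exact: (dvM (df i) IH).
Qed.

Lemma holo_ball (f : C -> C) z (r : R) : 0 < r -> (forall w, nrm (w - z) < r -> dv f w) ->
  holomorphic_at f z.
Proof. by move=> r0 H; apply: nbhs_nrm; exists r => // w /H[]. Qed.

Lemma holo_ballP (f : C -> C) z : holomorphic_at f z ->
  exists2 r : R, 0 < r & forall w, nrm (w - z) < r -> dv f w.
Proof. by move=> /nbhs_nrmP[r r0 H]; exists r => // w /H. Qed.

Lemma holo_mero f z : holomorphic_at f z -> meromorphic_at f z.
Proof.
move=> hf; exists 0%N, f; split=> //; apply: dnbhs_nrm; exists 1 => // w _ _.
by rewrite expr0 divr1.
Qed.

Lemma dv_mero f : (forall w, dv f w) -> meromorphic f.
Proof. by move=> df z; apply/holo_mero/(@holo_ball _ _ 1). Qed.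

Lemma dv_pow z n s : dv (fun w => (w - z) ^+ n) s.
Proof. exact: (dvX n (dvB (dv_id s) (dv_cst z s))). Qed.

Lemma dnbhs_nrmP (z : C) (P : C -> Prop) : (\forall w \near z^', P w) ->
  exists2 d : R, 0 < d & forall w, w != z -> nrm (w - z) < d -> P w.
Proof.
move=> /nbhs_nrmP[d d0 H]; exists d => // w wz /H; exact.
Qed.

Lemma mero_ball f z : meromorphic_at f z -> exists m g (r : R), [/\ 0 < r,
  forall w, nrm (w - z) < r -> dv g w &
  forall w, w != z -> nrm (w - z) < r -> f w = g w / (w - z) ^+ m].
Proof.
move=> [m [g [/holo_ballP[r1 r10 hg] /dnbhs_nrmP[r2 r20 e]]]].
exists m, g, (Num.min r1 r2); split; first by rewrite lt_min r10.
  by move=> w; rewrite lt_min => /andP[/hg].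
by move=> w wz; rewrite lt_min => /andP[_ /(e _ wz)].
Qed.

Lemma ball_mero f z m g (r : R) : 0 < r -> (forall w, nrm (w - z) < r -> dv g w) ->
  (forall w, w != z -> nrm (w - z) < r -> f w = g w / (w - z) ^+ m) -> meromorphic_at f z.
Proof.
move=> r0 hg e; exists m, g; split; first exact: holo_ball r0 hg.
by apply: dnbhs_nrm; exists r.
Qed.

Lemma mero_ext f g z (r : R) : 0 < r -> (forall w, w != z -> nrm (w - z) < r -> f w = g w) ->
  meromorphic_at f z -> meromorphic_at g z.
Proof.
move=> r0 e /mero_ball[m [h [r' [r'0 dh eh]]]].
apply: (@ball_mero _ _ m h (Num.min r r')); first by rewrite lt_min r0.
  by move=> w; rewrite lt_min => /andP[_ /dh].
by move=> w wz; rewrite lt_min => /andP[w1 w2]; rewrite -e // eh.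
Qed.

Lemma meroD f g z : meromorphic_at f z -> meromorphic_at g z ->
  meromorphic_at (fun w => f w + g w) z.
Proof.
move=> /mero_ball[m1 [h1 [r1 [r10 dh1 e1]]]] /mero_ball[m2 [h2 [r2 [r20 dh2 e2]]]].
apply: (@ball_mero _ _ (m1 + m2) (fun w => h1 w * (w - z) ^+ m2 + h2 w * (w - z) ^+ m1) (Num.min r1 r2)).
- by rewrite lt_min r10.
- move=> w; rewrite lt_min => /andP[w1 w2].
  exact: (dvD (dvM (dh1 _ w1) (dv_pow z m2 w)) (dvM (dh2 _ w2) (dv_pow z m1 w))).
- move=> w wz; rewrite lt_min => /andP[w1 w2]; rewrite e1 // e2 // exprD.
  have wz0 : w - z != 0 by rewrite subr_eq0.
  have p1 : (w - z) ^+ m1 != 0 by rewrite expf_neq0.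
  have p2 : (w - z) ^+ m2 != 0 by rewrite expf_neq0.
  by field; rewrite p1 p2.
Qed.

Lemma meroM f g z : meromorphic_at f z -> meromorphic_at g z ->
  meromorphic_at (fun w => f w * g w) z.
Proof.
move=> /mero_ball[m1 [h1 [r1 [r10 dh1 e1]]]] /mero_ball[m2 [h2 [r2 [r20 dh2 e2]]]].
apply: (@ball_mero _ _ (m1 + m2) (fun w => h1 w * h2 w) (Num.min r1 r2)).
- by rewrite lt_min r10.
- by move=> w; rewrite lt_min => /andP[w1 w2]; exact: (dvM (dh1 _ w1) (dh2 _ w2)).
- move=> w wz; rewrite lt_min => /andP[w1 w2]; rewrite e1 // e2 // exprD.
  by rewrite invfM mulrACA.
Qed.

Lemma mero_cst (c z : C) : meromorphic_at (fun=> c) z.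
Proof. by apply: dv_mero => w; exact: dv_cst. Qed.

Lemma mero_sum (I : Type) (r : seq I) (f : I -> C -> C) z :
  (forall i, meromorphic_at (f i) z) -> meromorphic_at (fun w => \sum_(i <- r) f i w) z.
Proof.
move=> df; elim: r => [|i r IH].
  by rewrite (_ : (fun s => _) = fun=> 0); [exact: mero_cst | apply/funext => w; rewrite big_nil].
have -> : (fun s => \sum_(i <- i :: r) f i s) = fun w => f i w + (fun w => \sum_(i <- r) f i w) w.
  by apply/funext => w; rewrite big_cons.
exact: (meroD (df i) IH).
Qed.

Lemma has_der_cont (u : C -> C) z g : has_der u z g -> exists2 d : R, 0 < d &
  forall h, nrm h < d -> nrm (u (z + h) - u z) <= (nrm g + 1) * nrm h.
Proof.
move=> /(_ 1 ltr01)[d d0 H]; exists d => // h /H; rewrite mul1r => le.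
rewrite -[u (z + h) - u z](subrK (g * h)); apply: le_trans (nrmD _ _) _.
by rewrite nrmM; lra.
Qed.

Lemma has_der_1Bexp (a c s : C) :
  has_der (fun s => 1 - c * cexp (a * s)) s (- (c * (a * cexp (a * s)))).
Proof.
move=> e e0; have ne : 0 < e / (nrm c + 1) by rewrite divr_gt0 // ltr_wpDl // nrm_ge0.
have [d d0 H] := has_der_cexp a 0 s ne; exists d => // h /H; rewrite !addr0 => le.
rewrite (_ : _ - _ = - c * (cexp (a * (s + h)) - cexp (a * s) - a * cexp (a * s) * h)); last by ring.
rewrite nrmM nrmN; apply: le_trans (ler_wpM2l (nrm_ge0 c) le) _.
rewrite mulrA ler_wpM2r ?nrm_ge0 // mulrA ler_pdivrMr ?ltr_wpDl ?nrm_ge0 //.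
by have := nrm_ge0 c; nra.
Qed.

Lemma dv_1Bexp (a c s : C) : dv (fun s => 1 - c * cexp (a * s)) s.
Proof. exact/Dv/has_der_derivable/has_der_1Bexp. Qed.

(* At a zero [z] of [u] the witness is [(w - z)^2 / u w] rather than
   [(w - z) / u w]: it takes the right value at [z] because [0^-1 = 0], and its
   derivative there only requires the first-order expansion of [u]. *)
Lemma mero_inv_1Bexp (a c z : C) : a != 0 -> meromorphic_at (fun s => (1 - c * cexp (a * s))^-1) z.
Proof.
move=> a0; set u := fun s => 1 - c * cexp (a * s).
have hu s : has_der u s (- (c * (a * cexp (a * s)))) := has_der_1Bexp a c s.
have [uz|uz] := eqVneq (u z) 0; last first.
  have [d d0 hd] := has_der_cont (hu z); set g := - (c * _) in hd.
  apply: holo_mero; apply: (@holo_ball _ _ (Num.min d (nrm (u z) / (2 * (nrm g + 1))))).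
    by rewrite lt_min d0 divr_gt0 ?nrm_gt0 // mulr_gt0 // ltr_wpDl // nrm_ge0.
  move=> w; rewrite lt_min => /andP[/hd]; rewrite (addrC z) subrK => le1.
  rewrite ltr_pdivlMr ?mulr_gt0 ?ltr_wpDl ?nrm_ge0 // => le2.
  apply: (@dvV u); last exact: dv_1Bexp.
  rewrite -nrm_gt0; have := nrm_dist (u z) (u z - u w); rewrite subKr.
  rewrite (nrm_subC (u z)); have : 0 < nrm (u z) by rewrite nrm_gt0.
  nra.
have cE : c * cexp (a * z) = 1 by apply/eqP; rewrite eq_sym -subr_eq0; exact/eqP.
have gE : - (c * (a * cexp (a * z))) = - a by rewrite mulrCA cE mulr1.
have := hu z; rewrite gE => huz.
have na0 : 0 < nrm a by rewrite nrm_gt0.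
have low (e : R) : 0 < e -> e <= nrm a / 2 -> exists2 d : R, 0 < d & forall h, nrm h < d ->
    nrm (u (z + h) + a * h) <= e * nrm h /\ nrm a / 2 * nrm h <= nrm (u (z + h)).
  move=> e0 ea; have [d d0 H] := huz e e0; exists d => // h /H.
  rewrite uz subr0 mulNr opprK => le; split=> //.
  have := nrm_dist (a * h) (a * h + u (z + h)).
  rewrite (_ : a * h - (a * h + u (z + h)) = - u (z + h)); last by ring.
  rewrite nrmN.
  rewrite (addrC (a * h)) nrmM; have := nrm_ge0 h; nra.
have a20 : 0 < nrm a / 2 by rewrite divr_gt0.
have [d d0 hd] := low _ a20 (lexx _).
have u0 w : w != z -> nrm (w - z) < d -> u w != 0.
  move=> wz /hd[_]; rewrite (addrC z) subrK => le; rewrite -nrm_gt0; apply: lt_le_trans le.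
  by rewrite mulr_gt0 // nrm_gt0 subr_eq0.
apply: (@ball_mero _ _ 2 (fun w => (w - z) ^+ 2 / u w) d) => // [w wd|w wz wd]; last first.
  by rewrite mulrAC divff ?mul1r // expf_neq0 // subr_eq0.
have [->|wz] := eqVneq w z; last first.
  exact: (dvM (dv_pow z 2 w) (dvV (u0 _ wz wd) (dv_1Bexp a c w))).
apply/Dv/(@has_der_derivable _ _ _ (- a^-1)) => e e0.
(* [nrm a / 2] yields the lower bound for u; the second bound is such that division by |a| |u| >=
   |a|^2 |h| / 2 leaves e |h|. *)
pose e' := Num.min (nrm a / 2) (e * (nrm a ^+ 2) / 2).
have e'0 : 0 < e' by rewrite lt_min a20 !(divr_gt0, mulr_gt0, exprn_gt0).
have e'a : e' <= nrm a / 2 by rewrite ge_min lexx.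
have [d' d'0 hd'] := low e' e'0 e'a; exists (Num.min d d'); first by rewrite lt_min d0.
move=> h; rewrite lt_min => /andP[h1 h2].
have [->|h0] := eqVneq h 0; first by rewrite addr0 !subrr mulr0 subr0 nrm0 mulr0.
have [le1 le2] := hd' h h2.
have uh : u (z + h) != 0.
  by apply: u0; [rewrite -subr_eq0 addrC addKr | rewrite addrC addKr].
rewrite (_ : z + h - z = h); last by ring.
rewrite subrr expr0n mul0r subr0 mulNr opprK.
have -> : h ^+ 2 / u (z + h) + a^-1 * h = h * (u (z + h) + a * h) / (a * u (z + h)).
  by field; rewrite uh a0.
have hh : 0 < nrm h by rewrite nrm_gt0.
rewrite nrmM nrmV !nrmM ler_pdivrMr ?mulr_gt0 ?nrm_gt0 //.
have e'e : e' <= e * (nrm a ^+ 2) / 2 by rewrite ge_min lexx orbT.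
apply: le_trans (_ : nrm h * (e * (nrm a ^+ 2) / 2 * nrm h) <= _).
  rewrite ler_wpM2l ?nrm_ge0 //; apply: le_trans le1 _.
  by rewrite ler_wpM2r ?nrm_ge0.
have -> : nrm h * (e * nrm a ^+ 2 / 2 * nrm h) = e * nrm h * (nrm a * (nrm a / 2 * nrm h)) by field.
by rewrite !ler_wpM2l ?mulr_ge0 ?nrm_ge0 // ltW.
Qed.

End ComplexExp.

(** * Complex series with geometric bounds *)

Section Series.
Variable R : realType.
Local Notation C := (Cplx R).
Implicit Types (u v : nat -> C) (z w s l : C).

Definition psums u : nat -> C := fun n => \sum_(i < n) u i.

(** A total operation; it is the sum whenever the partial sums converge, by [csum_eq]. *)
Definition csum u : C :=
  (limn (series (fun n => complex.Re (u n))) +i* limn (series (fun n => complex.Im (u n))))%C.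

Lemma tends_uniq u l l' : tends u l -> tends u l' -> l = l'.
Proof.
move=> H H'; apply/eqP; rewrite -subr_eq0 -nrm_eq0 eq_le nrm_ge0 andbT leNgt; apply/negP => e0.
have e2 : 0 < nrm (l - l') / 2 by rewrite divr_gt0.
have [N hN] := H _ e2; have [N' hN'] := H' _ e2.
have := hN (maxn N N') (leq_maxl _ _); have := hN' (maxn N N') (leq_maxr _ _).
set x := u _ => h1 h2; have := nrmB (x - l') (x - l).
by rewrite (_ : _ - _ - _ = l - l'); [lra | ring].
Qed.

Lemma tendsD u v l l' : tends u l -> tends v l' -> tends (fun n => u n + v n) (l + l').
Proof.
move=> H H' e e0; have e2 : 0 < e / 2 by rewrite divr_gt0.
have [N hN] := H _ e2; have [N' hN'] := H' _ e2; exists (maxn N N') => n.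
rewrite geq_max => /andP[/hN h1 /hN' h2].
by rewrite opprD addrACA; apply: le_lt_trans (nrmD _ _) _; lra.
Qed.

Lemma tendsMl u l (c : C) : tends u l -> tends (fun n => c * u n) (c * l).
Proof.
move=> H e e0; have e2 : 0 < e / (nrm c + 1) by rewrite divr_gt0 // ltr_wpDl // nrm_ge0.
have [N hN] := H _ e2; exists N => n /hN; rewrite -mulrBr nrmM ltr_pdivlMr ?ltr_wpDl ?nrm_ge0 //.
have := nrm_ge0 (u n - l); have := nrm_ge0 c; nra.
Qed.

Lemma tendsB u v l l' : tends u l -> tends v l' -> tends (fun n => u n - v n) (l - l').
Proof.
move=> H H'; have := tendsD H (tendsMl (-1) H').
rewrite mulN1r; under eq_fun do rewrite mulN1r; exact.
Qed.

Lemma tends_cst l : tends (fun=> l) l.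
Proof. by move=> e e0; exists 0%N => n _; rewrite subrr nrm0. Qed.

Lemma tends_ext u v l : (exists N : nat, forall n, (N <= n)%N -> u n = v n) -> tends u l -> tends v l.
Proof.
move=> [N0 uv] H e e0; have [N hN] := H e e0; exists (maxn N0 N) => n.
by rewrite geq_max => /andP[/uv <- /hN].
Qed.

Lemma tends_sum (I : Type) (r : seq I) (f : I -> nat -> C) (l : I -> C) :
  (forall i, tends (f i) (l i)) -> tends (fun n => \sum_(i <- r) f i n) (\sum_(i <- r) l i).
Proof.
move=> H; elim: r => [|i r IH].
  rewrite big_nil; under eq_fun do rewrite big_nil; exact: tends_cst.
rewrite big_cons; under eq_fun do rewrite big_cons.
exact: tendsD.
Qed.

Lemma tends_bound u l (c : C) (B : R) : tends u l ->
  (exists N : nat, forall n, (N <= n)%N -> nrm (u n - c) <= B) -> nrm (l - c) <= B.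
Proof.
move=> H [N0 hB]; rewrite leNgt; apply/negP => lt.
have e0 : 0 < nrm (l - c) - B by rewrite subr_gt0.
have [N hN] := H _ e0; have := hN (maxn N0 N) (leq_maxr _ _); have := hB (maxn N0 N) (leq_maxl _ _).
set x := u _ => h1 h2; have := nrmB (x - c) (x - l).
by rewrite (_ : _ - _ - _ = l - c); [lra | ring].
Qed.

Lemma psumsRe u n : complex.Re (psums u n) = series (fun n => complex.Re (u n)) n.
Proof.
rewrite /psums /series /= big_mkord; elim/big_ind2: _ => // x y x' y' <- <-.
exact: cReD.
Qed.

Lemma psumsIm u n : complex.Im (psums u n) = series (fun n => complex.Im (u n)) n.
Proof.
rewrite /psums /series /= big_mkord; elim/big_ind2: _ => // x y x' y' <- <-.
exact: cImD.
Qed.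

Lemma csum_eq u l : tends (psums u) l -> csum u = l.
Proof.
move=> H; apply: eq_ReIm => /=.
  apply/cvg_lim => //; apply/cvgrPdist_lt => e e0; have [N hN] := H e e0.
  exists N => // n /= /hN; apply: le_lt_trans; rewrite -psumsRe distrC -cReB; exact: Re_le_nrm.
apply/cvg_lim => //; apply/cvgrPdist_lt => e e0; have [N hN] := H e e0.
exists N => // n /= /hN; apply: le_lt_trans; rewrite -psumsIm distrC -cImB; exact: Im_le_nrm.
Qed.

Definition geo u (K y : R) := forall n, nrm (u n) <= K * y ^+ n.

Lemma cvg_geo (a : nat -> R) (K y : R) : 0 <= y < 1 -> (forall n, `|a n| <= K * y ^+ n) ->
  cvgn (series a).
Proof.
move=> /andP[y0 y1] ha; apply: normed_cvg.
apply: (@series_le_cvg _ _ (geometric K y)) => [n|n|n|]; rewrite /geometric /=.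
- by [].
- exact: le_trans (ha n).
- exact: ha.
- by apply: is_cvg_geometric_series; rewrite ger0_norm.
Qed.

Lemma tends_csum u K y : 0 <= y < 1 -> geo u K y -> tends (psums u) (csum u).
Proof.
move=> y01 hu e e0; have e2 : 0 < e / 2 by rewrite divr_gt0.
have h1 : cvgn (series (fun n => complex.Re (u n))).
  by apply: (cvg_geo y01) => n; apply: le_trans (hu n); exact: Re_le_nrm.
have h2 : cvgn (series (fun n => complex.Im (u n))).
  by apply: (cvg_geo y01) => n; apply: le_trans (hu n); exact: Im_le_nrm.
have /cvgrPdist_lt/(_ _ e2)[N1 _ H1] := h1.
have /cvgrPdist_lt/(_ _ e2)[N2 _ H2] := h2.
exists (maxn N1 N2) => n; rewrite geq_max => /andP[n1 n2].
apply: le_lt_trans (nrm_le _) _; rewrite cReB cImB psumsRe psumsIm /csum /=.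
have := H1 n n1; have := H2 n n2; rewrite /= (distrC (limn _)) (distrC (limn _)).
lra.
Qed.

Lemma geo_psums u K y n : 0 <= y < 1 -> geo u K y -> nrm (psums u n) <= K / (1 - y).
Proof.
move=> /andP[y0 y1] hu; apply: le_trans (nrm_sum _ _ _) _.
have K0 : 0 <= K by have := hu 0%N; rewrite expr0 mulr1; apply: le_trans; exact: nrm_ge0.
apply: (@le_trans _ _ (\sum_(i < n) K * y ^+ i)); first by apply: ler_sum => i _; exact: hu.
rewrite -mulr_sumr ler_wpM2l // -[leRHS]mul1r ler_pdivlMr ?subr_gt0 //.
rewrite (_ : _ * _ = 1 - y ^+ n); first by rewrite gerBl exprn_ge0.
elim: n => [|n IH]; first by rewrite big_ord0 mul0r expr0 subrr.
by rewrite big_ord_recr /= mulrDl IH exprS; ring.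
Qed.

Lemma nrm_csum u K y : 0 <= y < 1 -> geo u K y -> nrm (csum u) <= K / (1 - y).
Proof.
move=> y01 hu; rewrite -[csum u]subr0; apply: (tends_bound (tends_csum y01 hu)).
by exists 0%N => n _; rewrite subr0; exact: geo_psums.
Qed.

Lemma csumB u v K y K' : 0 <= y < 1 -> geo u K y -> geo v K' y ->
  csum (fun n => u n - v n) = csum u - csum v.
Proof.
move=> y01 hu hv; apply: csum_eq.
apply: tends_ext (tendsB (tends_csum y01 hu) (tends_csum y01 hv)).
by exists 0%N => n _; rewrite /psums sumrB.
Qed.

Lemma csumMr u K y c : 0 <= y < 1 -> geo u K y -> csum (fun n => u n * c) = csum u * c.
Proof.
move=> y01 hu; apply: csum_eq; rewrite mulrC.
apply: tends_ext (tendsMl c (tends_csum y01 hu)).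
by exists 0%N => n _; rewrite /psums mulrC mulr_suml.
Qed.

Lemma csum_split u n0 K y : 0 <= y < 1 -> geo (fun n => u (n0 + n)%N) K y ->
  csum u = psums u n0 + csum (fun n => u (n0 + n)%N).
Proof.
move=> y01 hu; apply: csum_eq => e e0.
have [N hN] := tends_csum y01 hu e0; exists (n0 + N)%N => n nn.
have [m nE] : exists m, n = (n0 + m)%N.
  by exists (n - n0)%N; rewrite subnKC // (leq_trans _ nn) // leq_addr.
have := hN m; rewrite nE leq_add2l in nn * => /(_ nn).
congr (nrm _ < _); rewrite /psums opprD addrA; congr (_ - _).
rewrite big_split_ord /= [RHS]addrAC subrr add0r; exact: eq_bigr.
Qed.

(* Bounds on [f], on its derivative [g] and on the second-order remainder: they
   are summable, so that a geometrically convergent series can be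
   differentiated termwise without Cauchy's formula. *)
Definition S2 z (r K : R) (f g : C -> C) := forall w, nrm (w - z) < r ->
  [/\ nrm (f w) <= K, nrm (g w) <= K & forall w', nrm (w' - z) < r ->
    nrm (f w' - f w - g w * (w' - w)) <= K * nrm (w' - w) ^+ 2].

Lemma S2_csum z (r K y : R) (f g : nat -> C -> C) : 0 < r -> 0 <= y < 1 ->
  (forall n, S2 z r (K * y ^+ n) (f n) (g n)) ->
  forall w, nrm (w - z) < r -> dv (fun w => csum (fun n => f n w)) w.
Proof.
move=> r0 y01 H w wz.
have gf w' : nrm (w' - z) < r -> geo (fun n => f n w') K y by move=> h n; case: (H n w' h).
have gg : geo (fun n => g n w) K y by move=> n; case: (H n w wz).
apply/Dv/(@has_der_derivable _ _ _ (csum (fun n => g n w))).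
have d0 : 0 < r - nrm (w - z) by rewrite subr_gt0.
apply: (@quad_has_der _ _ _ _ (K / (1 - y)) _ d0) => h hr.
have wh : nrm (w + h - z) < r.
  by rewrite addrAC; apply: le_lt_trans (nrmD _ _) _; rewrite -ltrBrDl.
have g1 : geo (fun n => f n (w + h) - f n w) (K + K) y.
  by move=> n; apply: le_trans (nrmB _ _) _; rewrite mulrDl lerD ?gf.
have g2 : geo (fun n => g n w * h) (K * nrm h) y.
  by move=> n; rewrite nrmM mulrAC ler_wpM2r ?nrm_ge0.
rewrite -(csumB y01 (gf _ wh) (gf _ wz)) -(csumMr _ y01 gg) -(csumB y01 g1 g2) mulrAC.
apply: (nrm_csum y01) => n.
have [_ _ /(_ _ wh)] := H n w wz; rewrite (_ : w + h - w = h); last by ring.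
by rewrite mulrAC.
Qed.

(** Points of the ball are at distance h <= 2, so K h + K h^2 <= 3 K h. *)
Lemma S2_diff z r K f g w w' : r <= 1 -> S2 z r K f g -> nrm (w - z) < r -> nrm (w' - z) < r ->
  nrm (f w' - f w) <= 3 * K * nrm (w' - w) /\ nrm (w' - w) <= 2.
Proof.
move=> r1 H wz wz'; have [_ h1 /(_ _ wz') h2] := H w wz.
have h3 : nrm (w' - w) <= 2.
  rewrite (_ : w' - w = (w' - z) - (w - z)); last by ring.
  by apply: le_trans (nrmB _ _) _; lra.
split=> //; rewrite -[f w' - f w](subrK (g w * (w' - w))).
apply: le_trans (nrmD _ _) _; rewrite nrmM.
have d0 := nrm_ge0 (w' - w); have g0 := nrm_ge0 (g w).
have Kd : 0 <= K * nrm (w' - w) by rewrite mulr_ge0 // (le_trans g0).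
have := ler_wpM2l Kd h3; have := ler_wpM2r d0 h1; move: h2; rewrite expr2 mulrA; lra.
Qed.

Lemma S2_lin z r K f g (a b : C) (A d : R) : r <= 1 -> S2 z r K f g ->
  (forall w, nrm (w - z) < r -> nrm (a * w + b) <= A) -> nrm a <= d ->
  S2 z r (K * (A + 3 * d)) (fun w => f w * (a * w + b)) (fun w => g w * (a * w + b) + f w * a).
Proof.
move=> r1 H hA ad w wz; have [h1 h2 h3] := H w wz; have := hA w wz => hAw.
have a0 := nrm_ge0 a; have A0 := nrm_ge0 (a * w + b); have f0 := nrm_ge0 (f w); have g0 := nrm_ge0 (g w).
split.
- rewrite nrmM; nra.
- apply: le_trans (nrmD _ _) _; rewrite !nrmM; nra.
move=> w' wz'; have [d1 d2] := S2_diff r1 H wz wz'.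
rewrite (_ : _ - _ - _ = (f w' - f w - g w * (w' - w)) * (a * w + b) + (f w' - f w) * (a * (w' - w))); last by ring.
apply: le_trans (nrmD _ _) _; rewrite !nrmM.
have := h3 _ wz'; have := nrm_ge0 (w' - w); have := nrm_ge0 (f w' - f w - g w * (w' - w)).
have := nrm_ge0 (f w' - f w); move: (nrm (f w' - f w)) (nrm (f w' - f w - _)) (nrm (w' - w)) d1 d2.
move=> x1 x2 h d1 d2 x10 x20 h0 le.
have e1 : x2 * nrm (a * w + b) <= K * h ^+ 2 * A by apply: ler_pM.
have e2 : x1 * (nrm a * h) <= 3 * K * h * (d * h).
  by apply: ler_pM => //; [exact: mulr_ge0 | exact: ler_wpM2r].
apply: le_trans (lerD e1 e2) _; rewrite le_eqVlt; apply/orP; left; apply/eqP; ring.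
Qed.

Lemma S2_mul z r K1 f1 g1 K2 f2 g2 : r <= 1 -> S2 z r K1 f1 g1 -> S2 z r K2 f2 g2 ->
  S2 z r (5 * (K1 * K2)) (fun w => f1 w * f2 w) (fun w => g1 w * f2 w + f1 w * g2 w).
Proof.
move=> r1 H1 H2 w wz; have [a1 a2 a3] := H1 w wz; have [b1 b2 b3] := H2 w wz.
have f10 := nrm_ge0 (f1 w); have f20 := nrm_ge0 (f2 w).
have g10 := nrm_ge0 (g1 w); have g20 := nrm_ge0 (g2 w).
have K10 : 0 <= K1 by exact: le_trans a1.
have K20 : 0 <= K2 by exact: le_trans b1.
have KK : 0 <= K1 * K2 by exact: mulr_ge0.
split.
- rewrite nrmM; apply: le_trans (ler_pM f10 f20 a1 b1) _; lra.
- apply: le_trans (nrmD _ _) _; rewrite !nrmM.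
  have := ler_pM g10 f20 a2 b1; have := ler_pM f10 g20 a1 b2; lra.
move=> w' wz'; have [d1 d2] := S2_diff r1 H2 wz wz'.
(* The three terms contribute 1, 3 and 1 times K1 K2 |w' - w|^2, the 3 coming from [S2_diff]; hence
   the constant 5. *)
rewrite (_ : _ - _ - _ = (f1 w' - f1 w - g1 w * (w' - w)) * f2 w' + (g1 w * (w' - w)) * (f2 w' - f2 w)
   + f1 w * (f2 w' - f2 w - g2 w * (w' - w))); last by ring.
apply: le_trans (nrmD _ _) _; apply: le_trans (lerD (nrmD _ _) (lexx _)) _; rewrite !nrmM.
have [b1' _ _] := H2 w' wz'.
have e1 := ler_pM (nrm_ge0 (f1 w' - f1 w - g1 w * (w' - w))) (nrm_ge0 (f2 w')) (a3 _ wz') b1'.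
have e2 := ler_pM (mulr_ge0 g10 (nrm_ge0 (w' - w))) (nrm_ge0 (f2 w' - f2 w)) (ler_wpM2r (nrm_ge0 (w' - w)) a2) d1.
have e3 := ler_pM f10 (nrm_ge0 (f2 w' - f2 w - g2 w * (w' - w))) a1 (b3 _ wz').
apply: le_trans (lerD (lerD e1 e2) e3) _; rewrite le_eqVlt; apply/orP; left; apply/eqP; ring.
Qed.

Lemma S2_inv z r K f g : r <= 1 -> 1 <= K -> S2 z r K f g ->
  (forall w, nrm (w - z) < r -> 1/2 <= nrm (f w)) ->
  S2 z r (32 * K ^+ 2) (fun w => (f w)^-1) (fun w => - (g w / f w ^+ 2)).
Proof.
move=> r1 K1 H hf w wz; have [a1 a2 a3] := H w wz; have fw := hf w wz.
have inv2 w' : nrm (w' - z) < r -> nrm (f w')^-1 <= 2 /\ f w' != 0.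
  move=> wz'; have h := hf w' wz'; have h0 : 0 < nrm (f w') by apply: lt_le_trans h.
  by rewrite nrmV -nrm_gt0 h0 invf_ple ?posrE //; split=> //; lra.
have [i1 f0] := inv2 w wz; have g0 := nrm_ge0 (g w).
have KK : 1 <= K ^+ 2 by rewrite expr_ge1 // ltW // (lt_le_trans ltr01).
have K0 : 0 <= K by lra.
have i4 : nrm (f w)^-1 ^+ 2 <= 4 by rewrite (_ : 4 = 2 ^+ 2) ?ler_pXn2r ?nnegrE ?nrm_ge0 //; ring.
split.
- lra.
- rewrite nrmN nrmM -exprVn nrmX; have := ler_pM g0 (exprn_ge0 2 (nrm_ge0 (f w)^-1)) a2 i4; nra.
move=> w' wz'; have [i1' f0'] := inv2 w' wz'; have [d1 d2] := S2_diff r1 H wz wz'.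
(* The first factor is at most (1 + 3) K^2 |w' - w|^2 and the inverses contribute at most 2^3; hence
   the constant 32. *)
rewrite (_ : _ - _ - _ = (- f w * (f w' - f w - g w * (w' - w)) + (g w * (w' - w)) * (f w' - f w))
   * ((f w')^-1 * (f w)^-1 ^+ 2)); last by field; rewrite f0 f0'.
rewrite nrmM; have n1 : nrm ((f w')^-1 * (f w)^-1 ^+ 2) <= 8.
  rewrite nrmM nrmX; have := ler_pM (nrm_ge0 _) (exprn_ge0 2 (nrm_ge0 (f w)^-1)) i1' i4; lra.
have e1 := ler_pM (nrm_ge0 (f w)) (nrm_ge0 (f w' - f w - g w * (w' - w))) a1 (a3 _ wz').
have e2 := ler_pM (mulr_ge0 g0 (nrm_ge0 (w' - w))) (nrm_ge0 (f w' - f w)) (ler_wpM2r (nrm_ge0 (w' - w)) a2) d1.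
have n2 : nrm (- f w * (f w' - f w - g w * (w' - w)) + (g w * (w' - w)) * (f w' - f w)) <= 4 * K ^+ 2 * nrm (w' - w) ^+ 2.
  apply: le_trans (nrmD _ _) _; rewrite !nrmM nrmN.
  apply: le_trans (lerD e1 e2) _; rewrite le_eqVlt; apply/orP; left; apply/eqP; ring.
apply: le_trans (ler_pM (nrm_ge0 _) (nrm_ge0 _) n2 n1) _.
rewrite le_eqVlt; apply/orP; left; apply/eqP; ring.
Qed.

Lemma S2_1Bexp z (r V : R) (a c : C) : 2 * r * nrm a <= 1/2 ->
  (forall w, nrm (w - z) < r -> nrm (c * cexp (a * w)) <= V) ->
  S2 z r (1 + V * (1 + nrm a + 10 * nrm a ^+ 2)) (fun w => 1 - c * cexp (a * w))
     (fun w => - (a * (c * cexp (a * w)))).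
Proof.
move=> ra hV w wz; have := hV w wz => hw; have a0 := nrm_ge0 a; have v0 := nrm_ge0 (c * cexp (a * w)).
have V0 : 0 <= V by exact: le_trans hw.
have Va : 0 <= V * nrm a by exact: mulr_ge0.
have Va2 : 0 <= V * nrm a ^+ 2 by rewrite mulr_ge0 ?exprn_ge0.
split.
- apply: le_trans (nrmB _ _) _; rewrite nrm1; nra.
- rewrite nrmN nrmM; have := ler_wpM2l a0 hw; nra.
move=> w' wz'; have dw : nrm (w' - w) <= 2 * r.
  rewrite (_ : w' - w = (w' - z) - (w - z)); last by ring.
  by apply: le_trans (nrmB _ _) _; lra.
have h1 : nrm (a * (w' - w)) <= 1 / 2.
  by rewrite nrmM; apply: le_trans ra; rewrite mulrC ler_wpM2r.
rewrite (_ : _ - _ - _ = - (c * cexp (a * w)) * (cexp (a * (w' - w)) - 1 - a * (w' - w))); last first.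
  rewrite (_ : a * w' = a * w + a * (w' - w)); last by ring.
  rewrite cexpD; ring.
rewrite nrmM nrmN.
apply: le_trans (ler_pM v0 (nrm_ge0 _) hw (cexp_quad h1)) _.
rewrite nrmM exprMn mulrA [in leRHS]mulrDl; have := sqr_ge0 (nrm (w' - w)); move: (nrm (w' - w) ^+ 2) => x x0.
have h2 : 0 <= V * x by exact: mulr_ge0.
have h3 : 0 <= V * nrm a * x by exact: mulr_ge0.
lra.
Qed.

End Series.

(** * The binomial series *)

Section Binomial.
Variable R : realType.
Local Notation C := (Cplx R).
Implicit Types (z w s : C).

(* The coefficient of [t ^ l] in [(1 + t) ^ (- s)], with the bound [binB]. *)
Definition bin (l : nat) s : C := \prod_(j < l) - ((s + j%:R) / j.+1%:R).

Definition binB (l : nat) (r : R) : R := \prod_(j < l) (1 + r / j.+1%:R).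

Lemma binS l s : bin l.+1 s = bin l s * (- (l.+1%:R)^-1 * s + - (l%:R / l.+1%:R)).
Proof. by rewrite /bin big_ord_recr /=; congr (_ * _); ring. Qed.

(** Comparison of coefficients in d/dt (1 + t)^(-s) = -s (1 + t)^(-s-1). *)
Lemma bin_shift l s : bin l.+1 s * l.+1%:R = - s * bin l (s + 1).
Proof.
elim: l => [|l IH].
  by rewrite /bin big_ord1 big_ord0 addr0 divr1 !mulr1.
have n1 : (l.+1%:R : C) != 0 by rewrite pnatr_eq0.
have n2 : (l.+2%:R : C) != 0 by rewrite pnatr_eq0.
rewrite binS [bin l.+1 (s + 1)]/bin big_ord_recr /= -/(bin l (s + 1)).
rewrite [RHS]mulrA -IH.
have -> : (l.+2%:R : C) = l.+1%:R + 1 by rewrite -natr1.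
have e1 : (l%:R : C) = l.+1%:R - 1 by rewrite -natr1 addrK.
rewrite e1; have n3 : (l.+1%:R + 1 : C) != 0 by rewrite natr1.
move: (bin l.+1 s) n1 n3; move: (l.+1%:R : C) => x b n1 n3.
by field; rewrite n1 n3.
Qed.

Lemma binB_ge0 l r : 0 <= r -> 0 <= binB l r.
Proof. by move=> r0; apply: prodr_ge0 => j _; rewrite addr_ge0 // divr_ge0. Qed.

(** The factors with j + 1 >= r are at most 2; the finitely many others go into B. *)
Lemma binB_le r : 0 <= r -> exists2 B : R, 0 <= B & forall l, binB l r <= B * 2 ^+ l.
Proof.
move=> r0; pose J := (Num.trunc r).+1.
have rJ : r <= J%:R by apply: ltW; rewrite /J; exact: truncnS_gt.
have step l : 1 <= 1 + r / l.+1%:R by rewrite lerDl divr_ge0.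
have mono l : binB l r <= binB l.+1 r.
  by rewrite /binB big_ord_recr /= ler_peMr //; exact: binB_ge0.
exists (binB J r); first exact: binB_ge0.
elim=> [|l IH].
  rewrite expr0 mulr1; elim: J {rJ} => // J IH; exact: le_trans (mono J).
have [lJ|Jl] := ltnP l J.
  apply: (@le_trans _ _ (binB J r)).
    rewrite -(subnKC lJ); elim: (J - l.+1)%N => [|k IHk]; first by rewrite addn0.
    by rewrite addnS; exact: le_trans (mono _).
  by rewrite ler_peMr ?binB_ge0 // exprn_ege1 // ler1n.
rewrite /binB big_ord_recr /= -/(binB l r) exprS mulrCA mulrC.
apply: ler_pM => //; [by rewrite addr_ge0 // divr_ge0 | exact: binB_ge0 |].
have : r / l.+1%:R <= 1.
  by rewrite ler_pdivrMr // mul1r (le_trans rJ) // ler_nat (leq_trans Jl).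
by move: (r / _) => x; lra.
Qed.

Lemma nrm_bin l s : nrm (bin l s) <= binB l (nrm s).
Proof.
elim: l => [|l IH]; first by rewrite /bin /binB !big_ord0 nrm1.
rewrite /bin /binB !big_ord_recr /= -/(bin l s) -/(binB l (nrm s)) nrmM.
apply: ler_pM => //; try exact: nrm_ge0.
rewrite nrmN nrmM nrmV nrmn ler_pdivrMr // mulrDl mul1r divfK ?pnatr_eq0 //.
apply: le_trans (nrmD _ _) _; rewrite nrmn addrC lerD2r ler_nat //.
Qed.

(** Induction with [S2_lin]: on the ball the new linear factor is at most 1 + (|z| + 1) / (l + 1),
    and its slope adds 3 / (l + 1). Replacing |z| by |z| + 4 absorbs both. The derivative is written
    by the product rule. *)
Lemma S2_bin z r l : 0 < r <= 1 -> S2 z r (binB l (nrm z + 4)) (bin l)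
  (fun w => (fix g l := if l is l'.+1 then
      g l' * (- (l'.+1%:R)^-1 * w + - (l'%:R / l'.+1%:R)) + bin l' w * (- (l'.+1%:R)^-1)
    else 0) l).
Proof.
move=> /andP[r0 r1]; elim: l => [|l IH].
  move=> w _; rewrite /binB big_ord0 /bin !big_ord0 nrm1 nrm0; split => // w' _.
  by rewrite !big_ord0 subrr mul0r subrr nrm0 mul1r exprn_ge0 // nrm_ge0.
have -> : bin l.+1 = (fun w => bin l w * (- (l.+1%:R)^-1 * w + - (l%:R / l.+1%:R))).
  by apply/funext => w; exact: binS.
have -> : binB l.+1 (nrm z + 4) = binB l (nrm z + 4) * ((1 + (nrm z + 1) / l.+1%:R) + 3 * (l.+1%:R)^-1).
  by rewrite /binB big_ord_recr /=; congr (_ * _); rewrite -addrA; congr (_ + _); rewrite -mulrDl; congr (_ / _); ring.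
apply: (S2_lin r1 IH); last by rewrite nrmN nrmV nrmn.
move=> w wz; rewrite (_ : _ + _ = - ((w + l%:R) / l.+1%:R)); last by ring.
rewrite nrmN nrmM nrmV nrmn ler_pdivrMr // mulrDl mul1r divfK ?pnatr_eq0 //.
have : nrm w <= nrm z + 1.
  by rewrite -[w](subrK z); apply: le_trans (nrmD _ _) _; lra.
have : nrm (w + l%:R) <= nrm w + l%:R by apply: le_trans (nrmD _ _) _; rewrite nrmn.
have : (l%:R : R) <= l.+1%:R by rewrite ler_nat.
lra.
Qed.

(* [(1 + t) ^ (- s)] *)
Definition powD1 (t : R) s : C := cexp (- s * toC (ln (1 + t))).

Definition taylor (L : nat) s (t : R) : C := powD1 t s - \sum_(l < L) bin l s * toC (t ^+ l).

Record rder (f : R -> R) (t d : R) : Prop := Rder { rder_derive : is_derive t (1 : R) f d }.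

Lemma rder_eq f t d d' : rder f t d -> d = d' -> rder f t d'.
Proof. by move=> h <-. Qed.

Lemma rder_cst c t : rder (fun=> c) t 0.
Proof. by split; exact: is_derive_cst. Qed.

Lemma rder_id t : rder id t 1.
Proof. by split; exact: is_derive_id. Qed.

Lemma rderD f g t df dg : rder f t df -> rder g t dg -> rder (fun t => f t + g t) t (df + dg).
Proof. by move=> [hf] [hg]; split; exact: is_deriveD. Qed.

Lemma rderM f g t df dg : rder f t df -> rder g t dg ->
  rder (fun t => f t * g t) t (f t * dg + g t * df).
Proof. by move=> [hf] [hg]; split; exact: is_deriveM. Qed.

Lemma rderZ c f t df : rder f t df -> rder (fun t => c * f t) t (c * df).
Proof.
by move=> hf; apply: rder_eq (rderM (rder_cst c t) hf) _; rewrite mulr0 addr0.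
Qed.

Lemma rder_comp f g t df dg : rder f (g t) df -> rder g t dg -> rder (fun t => f (g t)) t (df * dg).
Proof. by move=> [hf] [hg]; split; exact: is_derive1_comp. Qed.

Lemma rderX n t : rder (fun t => t ^+ n.+1) t (n.+1%:R * t ^+ n).
Proof.
elim: n => [|n IH].
  by apply: rder_eq (rder_id t) _; rewrite expr0 mulr1.
have -> : (fun t : R => t ^+ n.+2) = (fun t => id t * (fun t => t ^+ n.+1) t).
  by apply/funext => x; rewrite exprS.
apply: rder_eq (rderM (rder_id t) IH) _.
by rewrite -[n.+2%:R]natr1 /= exprS; ring.
Qed.

Lemma rder_ln1 t : 0 <= t -> rder (fun t => ln (1 + t)) t (1 + t)^-1.
Proof.
move=> t0; have t1 : 0 < 1 + t by rewrite ltr_wpDr.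
have h1 : rder (@ln R) (1 + t) (1 + t)^-1 by split; exact: is_derive1_ln.
have h2 : rder (fun t => 1 + t) t 1.
  by apply: rder_eq (rderD (rder_cst 1 t) (rder_id t)) _; rewrite add0r.
by apply: rder_eq (@rder_comp _ (fun t => 1 + t) _ _ _ h1 h2) _; rewrite mulr1.
Qed.

(** K t^(n+1) + f(t) and K t^(n+1) - f(t) vanish at 0 and have nonnegative derivatives on [0, T]. *)
Lemma growth_bound (f df : R -> R) (T K : R) n : 0 <= T -> 0 <= K -> f 0 = 0 ->
  (forall t : R, 0 <= t -> rder f t (df t)) ->
  (forall t : R, 0 <= t <= T -> `|df t| <= K * n.+1%:R * t ^+ n) ->
  `|f T| <= K * T ^+ n.+1.
Proof.
move=> T0 K0 f0 fd hd; move: T0; rewrite le_eqVlt => /predU1P[<-|T0].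
  by rewrite f0 normr0 mulr_ge0 // exprn_ge0.
have key (e : R) : `|e| = 1 -> 0 <= K * T ^+ n.+1 + e * f T.
  move=> e1; pose g := fun t : R => K * t ^+ n.+1 + e * f t.
  have gd (t : R) : 0 <= t -> rder g t (K * (n.+1%:R * t ^+ n) + e * df t).
    by move=> t0; exact: (rderD (rderZ K (rderX n t)) (rderZ e (fd t t0))).
  have cg : {within `[0, T], continuous g}.
    apply: derivable_within_continuous => x; rewrite in_itv /= => /andP[x0 _].
    by have [h] := gd x x0; exact: ex_derive.
  have [|c + e2] := @MVT R g (fun t => K * (n.+1%:R * t ^+ n) + e * df t) 0 T T0 _ cg.
    by move=> x; rewrite in_itv /= => /andP[/ltW x0 _]; case: (gd x x0).
  rewrite in_itv /= => /andP[c0 cT].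
  have := hd c; rewrite (ltW c0) (ltW cT) => /(_ isT) le.
  move: e2; rewrite /g f0 expr0n /= !mulr0 add0r !subr0 => ->.
  rewrite mulr_ge0 ?(ltW T0) // mulrA -[e * df c]opprK subr_ge0.
  by apply: le_trans (ler_norm _) _; rewrite normrN normrM e1 mul1r.
have h1 := key 1 (normr1 _); have h2 := key (-1) (normrN1 _).
by rewrite ler_norml; apply/andP; split; lra.
Qed.

Record cder (f : R -> C) (t : R) (d : C) : Prop := Cder {
  cder_Re : rder (fun t => complex.Re (f t)) t (complex.Re d);
  cder_Im : rder (fun t => complex.Im (f t)) t (complex.Im d) }.

Lemma cderD f g t df dg : cder f t df -> cder g t dg -> cder (fun t => f t + g t) t (df + dg).
Proof.
move=> [f1 f2] [g1 g2]; split.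
  by rewrite cReD; under eq_fun do rewrite cReD; exact: (rderD f1 g1).
by rewrite cImD; under eq_fun do rewrite cImD; exact: (rderD f2 g2).
Qed.

Lemma cder_cst c t : cder (fun=> c) t 0.
Proof. by split; exact: rder_cst. Qed.

Lemma cReM_toC z (k : R) : complex.Re (z * toC k) = complex.Re z * k.
Proof. by rewrite cReM /= mulr0 subr0. Qed.

Lemma cImM_toC z (k : R) : complex.Im (z * toC k) = complex.Im z * k.
Proof. by rewrite cImM /= mulr0 add0r. Qed.

Lemma cder_real c f t d : rder f t d -> cder (fun t => c * toC (f t)) t (c * toC d).
Proof.
move=> h; split.
  rewrite cReM /= mulr0 subr0; under eq_fun do rewrite cReM /= mulr0 subr0; exact: rderZ.
rewrite cImM /= mulr0 add0r; under eq_fun do rewrite cImM /= mulr0 add0r; exact: rderZ.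
Qed.

Lemma cder_sum n (f : 'I_n -> R -> C) t (d : 'I_n -> C) : (forall i, cder (f i) t (d i)) ->
  cder (fun t => \sum_i f i t) t (\sum_i d i).
Proof.
move=> H; elim: (index_enum _) => [|i r IH].
  by rewrite big_nil; under eq_fun do rewrite big_nil; exact: cder_cst.
by rewrite big_cons; under eq_fun do rewrite big_cons; exact: cderD.
Qed.

Lemma powD1S t s : 0 <= t -> powD1 t (s + 1) = powD1 t s * toC (1 + t)^-1.
Proof.
move=> t0; have t1 : 0 < 1 + t by rewrite ltr_wpDr.
rewrite /powD1 (_ : - (s + 1) * _ = - s * toC (ln (1 + t)) + toC (- ln (1 + t))); last first.
  by rewrite -[- ln _]sub0r toCB toC0; ring.
rewrite cexpD; congr (_ * _); apply: eq_ReIm; rewrite /cexp ?cReM ?cImM /= cos0 sin0.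
  by rewrite expRN lnK ?posrE //; ring.
by ring.
Qed.

Lemma powD1_Re t s : complex.Re (powD1 t s) =
  expR (- complex.Re s * ln (1 + t)) * cos (- complex.Im s * ln (1 + t)).
Proof.
by rewrite /powD1 /cexp cReM /= !cReM !cImM /= !cReN !cImN !mulr0 subr0 add0r mul0r subr0.
Qed.

Lemma powD1_Im t s : complex.Im (powD1 t s) =
  expR (- complex.Re s * ln (1 + t)) * sin (- complex.Im s * ln (1 + t)).
Proof.
by rewrite /powD1 /cexp cImM /= !cReM !cImM /= !cReN !cImN !mulr0 subr0 add0r mul0r addr0.
Qed.

Lemma cder_powD1 t s : 0 <= t -> cder (fun t => powD1 t s) t (- s * powD1 t (s + 1)).
Proof.
move=> t0; rewrite powD1S // mulrA.
have hl := rder_ln1 t0.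
have he : rder (fun t => expR (- complex.Re s * ln (1 + t))) t
    (expR (- complex.Re s * ln (1 + t)) * (- complex.Re s * (1 + t)^-1)).
  apply: (@rder_comp _ (fun t => - complex.Re s * ln (1 + t))); last exact: rderZ.
  by split; exact: is_derive_expR.
split.
  under eq_fun do rewrite powD1_Re.
  have hc : rder (fun t => cos (- complex.Im s * ln (1 + t))) t
      (- sin (- complex.Im s * ln (1 + t)) * (- complex.Im s * (1 + t)^-1)).
    apply: (@rder_comp _ (fun t => - complex.Im s * ln (1 + t))); last exact: rderZ.
    by split; exact: is_derive_cos.
  apply: rder_eq (rderM he hc) _.
  rewrite cReM_toC cReM cReN cImN powD1_Re powD1_Im.
  by move: (1 + t)^-1 (expR _) (cos _) (sin _) => k x y w; ring.
under eq_fun do rewrite powD1_Im.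
have hs : rder (fun t => sin (- complex.Im s * ln (1 + t))) t
    (cos (- complex.Im s * ln (1 + t)) * (- complex.Im s * (1 + t)^-1)).
  apply: (@rder_comp _ (fun t => - complex.Im s * ln (1 + t))); last exact: rderZ.
  by split; exact: is_derive_sin.
apply: rder_eq (rderM he hs) _.
rewrite cImM_toC cImM cReN cImN powD1_Re powD1_Im.
by move: (1 + t)^-1 (expR _) (cos _) (sin _) => k x y w; ring.
Qed.

Lemma cder_taylor L s t : 0 <= t -> cder (taylor L.+1 s) t (- s * taylor L (s + 1) t).
Proof.
move=> t0; rewrite [taylor L _ _]/taylor mulrBr.
have -> : - (- s * \sum_(l < L) bin l (s + 1) * toC (t ^+ l)) =
    - bin 0 s * toC 0 + \sum_(l < L) - bin l.+1 s * toC (l.+1%:R * t ^+ l).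
  rewrite toC0 mulr0 add0r mulr_sumr -sumrN; apply: eq_bigr => l _.
  by rewrite mulrA -bin_shift toCM toCn; ring.
have -> : taylor L.+1 s = fun t => powD1 t s + (- bin 0 s * toC ((fun=> 1) t) +
    \sum_(l < L) - bin l.+1 s * toC (t ^+ l.+1)).
  apply/funext => x; rewrite /taylor big_ord_recl expr0 opprD -sumrN mulNr.
  by congr (_ + (_ + _)); apply: eq_bigr => l _; rewrite mulNr.
apply: cderD; first exact: cder_powD1.
apply: cderD; first by apply: cder_real; exact: rder_cst.
by apply: cder_sum => l; apply: cder_real; exact: rderX.
Qed.

Lemma taylor0 L s : taylor L.+1 s 0 = 0.
Proof.
rewrite /taylor /powD1 addr0 ln1 toC0 mulr0 cexp0 big_ord_recl expr0 /bin big_ord0 mul1r.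
by rewrite big1 ?addr0 ?subrr // => l _; rewrite expr0n /= toC0 mulr0.
Qed.

(** Induction on L: the derivative in t of the remainder for (L + 1, s) is -s times the remainder
    for (L, s + 1). Real and imaginary parts are estimated separately, which costs a factor 2 at
    each step. *)
Lemma taylor_bound L s (T M : R) : 0 <= T ->
  (forall t, 0 <= t <= T -> nrm (powD1 t (s + L%:R)) <= M) ->
  forall t, 0 <= t <= T -> nrm (taylor L s t) <= 2 ^+ L * nrm (bin L s) * M * t ^+ L.
Proof.
elim: L s => [|L IH] s T0 hM t tT.
  rewrite /taylor big_ord0 subr0 /bin big_ord0 nrm1 !expr0 !mulr1 mul1r.
  by have := hM t tT; rewrite addr0.
move: (tT) => /andP[t0 tT'].
have M0 : 0 <= M by exact: le_trans (nrm_ge0 _) (hM t tT).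
have IH' : forall t, 0 <= t <= T -> nrm (taylor L (s + 1) t) <= 2 ^+ L * nrm (bin L (s + 1)) * M * t ^+ L.
  apply: IH => // x xT; have := hM x xT; congr (nrm (powD1 _ _) <= _).
  by rewrite -natr1; ring.
pose K := 2 ^+ L * nrm (bin L.+1 s) * M.
have K0 : 0 <= K by rewrite !mulr_ge0 ?exprn_ge0 ?nrm_ge0.
have dK x : 0 <= x <= t -> nrm (- s * taylor L (s + 1) x) <= K * L.+1%:R * x ^+ L.
  move=> /andP[x0 xt]; have xT : 0 <= x <= T by rewrite x0 (le_trans xt).
  rewrite nrmM nrmN; apply: le_trans (ler_wpM2l (nrm_ge0 s) (IH' x xT)) _.
  have e : nrm (bin L.+1 s) * L.+1%:R = nrm s * nrm (bin L (s + 1)).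
    by rewrite -[L.+1%:R]nrmn -nrmM bin_shift nrmM nrmN.
  rewrite /K (_ : _ * L.+1%:R = 2 ^+ L * M * (nrm (bin L.+1 s) * L.+1%:R)); last by ring.
  by rewrite e le_eqVlt; apply/orP; left; apply/eqP; ring.
have hRe : `|complex.Re (taylor L.+1 s t)| <= K * t ^+ L.+1.
  apply: (@growth_bound (fun t => complex.Re (taylor L.+1 s t)) (fun t => complex.Re (- s * taylor L (s + 1) t))) => //.
  - by rewrite taylor0.
  - by move=> x x0; case: (cder_taylor L s x0).
  - by move=> x xt; apply: le_trans (Re_le_nrm _) _; exact: dK.
have hIm : `|complex.Im (taylor L.+1 s t)| <= K * t ^+ L.+1.
  apply: (@growth_bound (fun t => complex.Im (taylor L.+1 s t)) (fun t => complex.Im (- s * taylor L (s + 1) t))) => //.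
  - by rewrite taylor0.
  - by move=> x x0; case: (cder_taylor L s x0).
  - by move=> x xt; apply: le_trans (Im_le_nrm _) _; exact: dK.
apply: le_trans (nrm_le _) _; apply: le_trans (lerD hRe hIm) _.
by rewrite /K le_eqVlt; apply/orP; left; apply/eqP; rewrite [2 ^+ L.+1]exprS; ring.
Qed.

Lemma small_pow (K y e : R) : 0 <= y < 1 -> 0 < e -> exists N : nat, forall n, (N <= n)%N -> K * y ^+ n < e.
Proof.
move=> /andP[y0 y1] e0; have e1 : 0 < e / (`|K| + 1) by rewrite divr_gt0 // ltr_wpDl.
have /cvgrPdist_lt/(_ _ e1)[N _ hN] : (fun n => y ^+ n) @ \oo --> (0 : R).
  by apply: cvg_expr; rewrite ger0_norm.
exists N => n /hN; rewrite /= sub0r normrN ger0_norm ?exprn_ge0 // ltr_pdivlMr ?ltr_wpDl //.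
have := ler_norm K; have := exprn_ge0 n y0; move: (y ^+ n) => x x0; nra.
Qed.

Lemma nrm_powD1 t s : 0 <= t <= 1 -> nrm (powD1 t s) = expR (- complex.Re s * ln (1 + t)).
Proof. by move=> _; rewrite /powD1 nrm_cexp cReM /= cReN mulr0 subr0. Qed.

(** The coefficients are O(2^n) and [taylor_bound] adds another 2^n, so the remainder is O((4 t)^n);
    t <= 1/16 leaves the ratio 1/4. *)
Lemma binomial_tends t s : 0 <= t <= 16^-1 ->
  tends (fun L => \sum_(l < L) bin l s * toC (t ^+ l)) (powD1 t s).
Proof.
move=> /andP[t0 t16] e e0.
have t1 : 0 <= t <= 1 by rewrite t0 (le_trans t16) // invf_le1 // ler1n.
(* A bound for (1 + x)^(-s-L) that is uniform in L: ln (1 + x) lies in [0, 1], and adding L to s can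
   only decrease the modulus. *)
pose M := expR `|complex.Re s|.
have hM L x : 0 <= x <= t -> nrm (powD1 x (s + L%:R)) <= M.
  move=> /andP[x0 xt]; have x1 : 0 <= x <= 1 by rewrite x0 (le_trans xt) //; case/andP: t1.
  rewrite nrm_powD1 // ler_expR cReD.
  have -> : complex.Re (L%:R : C) = L%:R by rewrite -toCn.
  have l0 : 0 <= ln (1 + x) by rewrite ln_ge0 // lerDl.
  have l1 : ln (1 + x) <= 1.
    by have := @le_ln1Dx R x; rewrite (lt_le_trans _ x0) ?ltrN10 // => /(_ isT); move/andP: x1; lra.
  have := ler_normr (complex.Re s) (- complex.Re s); have L0 : 0 <= (L%:R : R) by [].
  have := ler_norm (- complex.Re s); rewrite normrN.
  have := mulr_ge0 L0 l0; have := normr_ge0 (complex.Re s); nra.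
have [B B0 hB] := binB_le (nrm_ge0 s).
have y01 : 0 <= (4^-1 : R) < 1 by rewrite invr_ge0 invf_lt1 ?ltr1n // ler0n.
have [N hN] := small_pow (B * M) y01 e0; exists N => n nn.
rewrite nrm_subC; apply: le_lt_trans (hN n nn).
have := @taylor_bound n s t M t0 (hM n) t; rewrite t0 lexx => /(_ isT); rewrite /taylor => le.
apply: le_trans le _.
have M0 : 0 <= M by exact: expR_ge0.
have h1 : nrm (bin n s) <= B * 2 ^+ n by exact: le_trans (nrm_bin _ _) (hB n).
have h2 : t ^+ n <= 16^-1 ^+ n by rewrite lerXn2r ?nnegrE // invr_ge0.
have h3 : nrm (bin n s) * t ^+ n <= B * 2 ^+ n * 16^-1 ^+ n.
  by apply: ler_pM => //; [exact: nrm_ge0 | exact: exprn_ge0].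
have -> : 2 ^+ n * nrm (bin n s) * M * t ^+ n = 2 ^+ n * M * (nrm (bin n s) * t ^+ n) by ring.
apply: le_trans (ler_wpM2l _ h3) _; first by rewrite mulr_ge0 // exprn_ge0.
have -> : (4^-1 : R) = 2 * (2 * 16^-1) by field.
by rewrite !exprMn le_eqVlt; apply/orP; left; apply/eqP; ring.
Qed.

End Binomial.

(** * Lacunary Dirichlet series *)

Section Lacunary.
Variable R : realType.
Local Notation C := (Cplx R).
Implicit Types (z w s : C).

Lemma S2_le z (r K K' : R) (f g : C -> C) : K <= K' -> S2 z r K f g -> S2 z r K' f g.
Proof.
move=> KK' H w wz; have [h1 h2 h3] := H w wz; split; [exact: le_trans KK' | exact: le_trans KK' |].
move=> w' wz'; apply: le_trans (h3 w' wz') _.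
by rewrite ler_wpM2r // exprn_ge0 // nrm_ge0.
Qed.

Lemma S2_scale z (r K : R) (c : C) (f g : C -> C) : S2 z r K f g ->
  S2 z r (K * nrm c) (fun w => f w * c) (fun w => g w * c).
Proof.
move=> H w wz; have [h1 h2 h3] := H w wz; rewrite !nrmM.
split; [by rewrite ler_wpM2r ?nrm_ge0 | by rewrite ler_wpM2r ?nrm_ge0 | move=> w' wz'].
rewrite (_ : _ - _ - _ = (f w' - f w - g w * (w' - w)) * c); last by ring.
by rewrite nrmM mulrAC ler_wpM2r ?nrm_ge0 //; exact: h3.
Qed.

Lemma tends_sum_nat (m M : nat) (f : nat -> nat -> C) (l : nat -> C) :
  (forall k, (m <= k)%N -> tends (f k) (l k)) ->
  tends (fun n => \sum_(m <= k < M) f k n) (\sum_(m <= k < M) l k).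
Proof.
move=> H; elim: M => [|M IH].
  by rewrite big_geq //; under eq_fun do rewrite big_geq //; exact: tends_cst.
have [mM|mM] := leqP m M; last first.
  by rewrite big_geq //; under eq_fun do rewrite big_geq //; exact: tends_cst.
rewrite big_nat_recr //=; under eq_fun do rewrite big_nat_recr //=.
exact: (tendsD IH (H M mM)).
Qed.

Lemma dv_bin l s : dv (bin l) s.
Proof.
have h j : dv (fun w : C => - ((w + j%:R) / j.+1%:R)) s.
  have -> : (fun w : C => - ((w + j%:R) / j.+1%:R)) =
      (fun w => (fun=> - (j.+1%:R)^-1) w * (fun w => id w + (fun=> j%:R) w) w).
    by apply/funext => w /=; ring.
  exact: (dvM (dv_cst _ _) (dvD (dv_id _) (dv_cst _ _))).
exact: (@dv_prod _ _ (index_enum _) (fun (j : 'I_l) w => - ((w + j%:R) / j.+1%:R)) s (fun j => h j)).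
Qed.

Variables (Q c : nat) (b : C) (k1 : nat).
Hypothesis Q1 : (1 < Q)%N.

Let lnQ : R := ln Q%:R.
Let a : C := - toC lnQ.

Definition lac_term (k : nat) s : C := b ^+ k / natpow (c + Q ^ k) s.

(** [cexp (a * s)] is Q^-s. A term of the series is x^k (1 + tau_k)^-s, and the l-th term of its
    binomial expansion is geometric in k with ratio y_l = b Q^(-l-s). *)
Let x s : C := b * cexp (a * s).
Let tau (k : nat) : R := c%:R / Q%:R ^+ k.
Let y (l : nat) s : C := (b * toC (Q%:R ^- l)) * cexp (a * s).
(* [x s ^+ M * inner M l s] is the tail from [M] on of the geometric series in
   [k] formed by the [l]-th binomial terms of [lac_term k s]. *)
Let inner M l s : C := bin l s * toC (tau M ^+ l) * (1 - y l s)^-1.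
(** From this index on c / Q^k <= 1/16, the range of [binomial_tends]. *)
Let k0 := maxn k1 (16 * c).

Let Q0 : 0 < (Q%:R : R). Proof. by rewrite ltr0n ltnW. Qed.
Let lnQ0 : 0 < lnQ. Proof. by rewrite ln_gt0 // ltr1n. Qed.
Let a0 : a != 0.
Proof. by rewrite oppr_eq0 -toC0 (inj_eq (@toC_inj R)) gt_eqF. Qed.

Lemma tau_le M : (k0 <= M)%N -> 0 <= tau M <= 16^-1.
Proof.
rewrite geq_max => /andP[_ cM]; rewrite divr_ge0 ?exprn_ge0 ?ler0n //=.
rewrite ler_pdivrMr ?exprn_gt0 // ler_pdivlMl ?ltr0n //.
rewrite -natrX -natrM ler_nat (leq_trans cM) // ltnW //; exact: ltn_expl.
Qed.

Lemma yE l s : y l s = x s * toC (Q%:R ^- l).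
Proof. by rewrite /y /x mulrAC. Qed.

Lemma lac_term_pw k s : lac_term k s = x s ^+ k * powD1 (tau k) s.
Proof.
have Qk : 0 < (Q%:R ^+ k : R) by rewrite exprn_gt0.
rewrite /lac_term /natpow -cexpN /x exprMn -mulrA; congr (_ * _).
rewrite -cexpMn /powD1 -cexpD; congr cexp.
have -> : ln (c + Q ^ k)%N%:R = lnQ *+ k + ln (1 + tau k).
  rewrite /lnQ -lnXn // -lnM ?posrE //; last by rewrite ltr_wpDr // divr_ge0 ?exprn_ge0 ?ler0n.
  congr ln; rewrite natrD natrX /tau; field; by rewrite gt_eqF.
rewrite -[((_ + _)%:C)%C]/(toC _) toCD -[lnQ *+ k]mulr_natr toCM toCn /a -mulr_natr; ring.
Qed.

Lemma nrm_x s : nrm (x s) = nrm b * expR (- lnQ * complex.Re s).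
Proof.
have aR : complex.Re a = - lnQ by rewrite /a cReN.
have aI : complex.Im a = 0 by rewrite /a cImN /= oppr0.
by rewrite /x nrmM nrm_cexp cReM aR aI mul0r subr0.
Qed.

Lemma nrm_y l s : nrm (y l s) <= nrm (x s).
Proof.
rewrite yE nrmM nrm_toC ler_piMr ?nrm_ge0 // ger0_norm ?invr_ge0 ?exprn_ge0 ?ler0n //.
by rewrite invf_le1 ?exprn_gt0 // exprn_ege1 // ler1n ltnW.
Qed.

Section Convergence.
Variable s : C.
Hypothesis xs : nrm (x s) < 1.

Let y1 l : 1 - y l s != 0.
Proof.
rewrite subr_eq0; apply/eqP => e; have := nrm_y l s; rewrite -e nrm1.
by rewrite leNgt xs.
Qed.

Let y1_inv l : nrm (1 - y l s)^-1 <= (1 - nrm (x s))^-1.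
Proof.
have := nrm_dist 1 (y l s); have := nrm_y l s; rewrite nrm1 => h1 h2.
have h0 : 0 < 1 - nrm (x s) by rewrite subr_gt0.
rewrite nrmV lef_pV2 ?posrE ?nrm_gt0 //; lra.
Qed.

Lemma geom_block l M : (k0 <= M)%N ->
  \sum_(k0 <= k < M) x s ^+ k * toC (tau k ^+ l) =
  (x s ^+ k0 * toC (tau k0 ^+ l) - x s ^+ M * toC (tau M ^+ l)) * (1 - y l s)^-1.
Proof.
move=> kM; rewrite -(subnKC kM); elim: (M - k0)%N => [|m IH].
  by rewrite addn0 big_geq // subrr mul0r.
rewrite addnS big_nat_recr ?leq_addr //= IH.
have -> : toC (tau (k0 + m).+1 ^+ l) = toC (tau (k0 + m) ^+ l) * toC (Q%:R ^- l).
  rewrite -toCM; congr toC; rewrite /tau exprSr invfM mulrA exprMn exprVn //.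
rewrite exprSr; have := y1 l; rewrite yE => h.
move: h (x s ^+ k0 * _) (x s ^+ (k0 + m)) => h A X; move: h.
by move: (x s) (toC (Q%:R ^- l)) (toC (tau (k0 + m) ^+ l)) => v p t h; field.
Qed.

(** The bound is uniform in M: 2^l from the binomial coefficient and 16^-l from [tau] give 8^-l. *)
Lemma inner_geo : exists2 B : R, 0 <= B & forall M, (k0 <= M)%N ->
  geo (fun l => inner M l s) B 8^-1.
Proof.
have [B B0 hB] := binB_le (nrm_ge0 s).
have h0 : 0 < 1 - nrm (x s) by rewrite subr_gt0.
exists (B / (1 - nrm (x s))); first by rewrite divr_ge0 // ltW.
move=> M kM l; have hI := y1_inv l; move: hI; set I := (1 - nrm (x s))^-1 => hI.
rewrite /inner !nrmM nrm_toC.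
have /andP[t0 t16] := tau_le kM.
have h1 : nrm (bin l s) <= B * 2 ^+ l by exact: le_trans (nrm_bin _ _) (hB l).
have h2 : `|tau M ^+ l| <= 16^-1 ^+ l.
  by rewrite ger0_norm ?exprn_ge0 // lerXn2r ?nnegrE // invr_ge0.
have h3 := ler_pM (nrm_ge0 _) (normr_ge0 _) h1 h2.
apply: le_trans (ler_pM (mulr_ge0 (nrm_ge0 _) (normr_ge0 _)) (nrm_ge0 _) h3 hI) _.
have <- : (2 : R) ^+ l * 16^-1 ^+ l = 8^-1 ^+ l by rewrite -exprMn; congr (_ ^+ _); field.
by rewrite le_eqVlt; apply/orP; left; apply/eqP; ring.
Qed.

Let y8 : 0 <= (8^-1 : R) < 1.
Proof. by rewrite invr_ge0 invf_lt1 ?ltr1n // ler0n. Qed.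

(** The block is finite in k, so the limit of the binomial expansions may be exchanged with the sum
    over k. By [inner_geo] the last term is O(|x s|^M), which gives convergence as M grows. *)
Lemma lac_block M : (k0 <= M)%N -> \sum_(k0 <= k < M) lac_term k s =
  x s ^+ k0 * csum (fun l => inner k0 l s) - x s ^+ M * csum (fun l => inner M l s).
Proof.
move=> kM; have [B B0 hB] := inner_geo.
have T1 : tends (fun L => \sum_(k0 <= k < M) x s ^+ k * \sum_(l < L) bin l s * toC (tau k ^+ l))
    (\sum_(k0 <= k < M) lac_term k s).
  apply: tends_sum_nat => k kk; rewrite lac_term_pw; apply: tendsMl.
  by apply: binomial_tends; exact: tau_le.
have T2 : tends (fun L => x s ^+ k0 * psums (fun l => inner k0 l s) L - x s ^+ M * psums (fun l => inner M l s) L)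
    (x s ^+ k0 * csum (fun l => inner k0 l s) - x s ^+ M * csum (fun l => inner M l s)).
  by apply: tendsB; apply: tendsMl; apply: tends_csum (hB _ _).
apply: tends_uniq T1 _; apply: tends_ext T2; exists 0%N => L _.
under [RHS]eq_bigr do rewrite mulr_sumr.
rewrite exchange_big /= /psums !mulr_sumr -sumrB; apply: eq_bigr => l _.
under [RHS]eq_bigr do rewrite mulrCA.
rewrite -mulr_sumr geom_block // /inner; ring.
Qed.

Lemma lac_tends : tends (fun M => \sum_(k1 <= k < M) lac_term k s)
  (\sum_(k1 <= k < k0) lac_term k s + x s ^+ k0 * csum (fun l => inner k0 l s)).
Proof.
have [B B0 hB] := inner_geo.
have k10 : (k1 <= k0)%N by exact: leq_maxl.
move=> e e0; have xs01 : 0 <= nrm (x s) < 1 by rewrite nrm_ge0.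
have [N hN] := small_pow (B / (1 - 8^-1)) xs01 e0; exists (maxn k0 N) => M.
rewrite geq_max => /andP[kM NM]; rewrite (big_cat_nat k10 kM) //= lac_block //.
rewrite (_ : _ - _ = - (x s ^+ M * csum (fun l => inner M l s))); last by ring.
rewrite nrmN nrmM nrmX mulrC; apply: le_lt_trans (hN M NM).
by rewrite ler_wpM2r ?exprn_ge0 ?nrm_ge0 //; exact: nrm_csum (hB _ _).
Qed.

End Convergence.

Lemma mero_inner M l z : meromorphic_at (inner M l) z.
Proof.
have h1 : meromorphic_at (fun s => bin l s * (fun=> toC (tau M ^+ l)) s) z.
  by apply: dv_mero => w; exact: (dvM (dv_bin l w) (dv_cst _ w)).
exact: (meroM h1 (mero_inv_1Bexp (b * toC (Q%:R ^- l)) z a0)).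
Qed.

(** Near z all but finitely many |y_l| are at most 1/2. The corresponding 1 / (1 - y_l) are
    uniformly bounded, so that part of the sum is holomorphic by [S2_csum]; only the finitely many
    first terms can have poles. *)
Lemma mero_tail z : meromorphic_at (fun s => csum (fun l => inner k0 l s)) z.
Proof.
have na := nrm_ge0 a.
(* Small enough for the hypothesis [2 * r * nrm a <= 1/2] of [S2_1Bexp]. *)
pose r : R := 1 / (4 * (nrm a + 1)).
have r0 : 0 < r by rewrite divr_gt0 // mulr_gt0 // ltr_wpDl.
have r1 : r <= 1 by rewrite /r ler_pdivrMr ?mulr_gt0 ?ltr_wpDl //; lra.
have ra : 2 * r * nrm a <= 1 / 2.
  have e : r * (4 * (nrm a + 1)) = 1 by rewrite /r divfK // gt_eqF // mulr_gt0 // ltr_wpDl.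
  nra.
pose X := nrm b * expR (lnQ * (nrm z + 1)).
have hX w : nrm (w - z) < r -> nrm (x w) <= X.
  move=> wz; rewrite nrm_x ler_wpM2l ?nrm_ge0 // ler_expR mulNr -mulrN ler_wpM2l ?(ltW lnQ0) //.
  have := ler_norm (- complex.Re w); have := Re_le_nrm w; rewrite normrN.
  have : nrm w <= nrm z + 1.
    by rewrite -[w](subrK z); apply: le_trans (nrmD _ _) _; lra.
  lra.
have Qi : 0 <= (Q%:R^-1 : R) < 1 by rewrite invr_ge0 ler0n invf_lt1 // ltr1n.
have h2 : 0 < 1/2 :> R by rewrite divr_gt0.
have [l0 hl0] := small_pow X Qi h2.
have hy l w : (l0 <= l)%N -> nrm (w - z) < r -> nrm (y l w) <= 1/2.
  move=> ll wz; rewrite yE nrmM nrm_toC -exprVn ger0_norm ?exprn_ge0 ?invr_ge0 ?ler0n //.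
  apply: le_trans (ltW (hl0 l ll)); rewrite ler_wpM2r ?hX // exprn_ge0 //; by case/andP: Qi.
pose K1 := 1 + 1/2 * (1 + nrm a + 10 * nrm a ^+ 2).
have K11 : 1 <= K1 by rewrite /K1 lerDl; have := sqr_ge0 (nrm a); nra.
have Sinv l : (l0 <= l)%N -> S2 z r (32 * K1 ^+ 2) (fun w => (1 - y l w)^-1)
    (fun w => - ((- (a * (b * toC (Q%:R ^- l) * cexp (a * w)))) / (1 - y l w) ^+ 2)).
  move=> ll; apply: (@S2_inv _ z r K1 (fun w => 1 - y l w)) => //.
    by apply: S2_1Bexp => // w wz; exact: hy.
  move=> w wz; have := nrm_dist 1 (y l w); rewrite nrm1; have := hy l w ll wz; lra.
have [B B0 hB] := binB_le (addr_ge0 (nrm_ge0 z) (ler0n _ 4)).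
have /andP[t0 t16] := tau_le (leqnn k0).
pose K := 5 * (B * (32 * K1 ^+ 2)).
have K10 : 0 <= K1 by lra.
have K0 : 0 <= K by rewrite !mulr_ge0.
have Sall n : exists g, S2 z r (K * 8^-1 ^+ n) (inner k0 (l0 + n)) g.
  have h1 := @S2_bin R z r (l0 + n); rewrite r0 r1 in h1.
  have h2' := S2_mul r1 (h1 isT) (Sinv (l0 + n)%N (leq_addr _ _)).
  have hg := S2_scale (toC (tau k0 ^+ (l0 + n))) h2'; eexists.
  have -> : inner k0 (l0 + n) = (fun w => bin (l0 + n) w * (1 - y (l0 + n) w)^-1 * toC (tau k0 ^+ (l0 + n))).
    by apply/funext => w; rewrite /inner mulrAC.
  apply: S2_le hg; rewrite nrm_toC ger0_norm ?exprn_ge0 //.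
  have h3 : tau k0 ^+ (l0 + n) <= 16^-1 ^+ (l0 + n) by rewrite lerXn2r ?nnegrE // invr_ge0.
  have h4 := ler_pM (binB_ge0 (l0 + n) (addr_ge0 (nrm_ge0 z) (ler0n _ 4))) (exprn_ge0 (l0 + n) t0) (hB (l0 + n)%N) h3.
  have h5 : (8^-1 : R) ^+ (l0 + n) <= 8^-1 ^+ n.
    by rewrite ler_wiXn2l ?leq_addl // ?invr_ge0 ?invf_le1 ?ler0n ?ler1n ?ltr0n.
  have e : B * 2 ^+ (l0 + n) * 16^-1 ^+ (l0 + n) = B * 8^-1 ^+ (l0 + n).
    by rewrite -mulrA -exprMn; congr (_ * _ ^+ _); field.
  rewrite e in h4.
  have KK : 0 <= 5 * (32 * K1 ^+ 2) by rewrite !mulr_ge0.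
  have h6 := ler_wpM2l KK (le_trans h4 (ler_wpM2l B0 h5)).
  rewrite /K; move: h6; move: (binB _ _) (tau k0 ^+ _) (8^-1 ^+ n) => p q t; lra.
have [g hg] := choice Sall.
have y8 : 0 <= (8^-1 : R) < 1 by rewrite invr_ge0 invf_lt1 ?ltr1n // ler0n.
have dG := S2_csum r0 y8 hg.
have mG : meromorphic_at (fun w => csum (fun n => inner k0 (l0 + n) w)) z.
  by apply: holo_mero; exact: holo_ball r0 dG.
apply: (mero_ext r0 _ (meroD (mero_sum (index_enum _) (fun l : 'I_l0 => mero_inner k0 l z)) mG)).
move=> w _ wz /=; rewrite [RHS](@csum_split _ _ l0 K 8^-1) // => n.
by have [] := hg n w wz.
Qed.

Lemma lacunary_continuation : exists F : C -> C, meromorphic F /\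
  forall s, nrm b * expR (- lnQ * complex.Re s) < 1 ->
  tends (fun M => \sum_(k1 <= k < M) lac_term k s) (F s).
Proof.
exists (fun s => \sum_(k1 <= k < k0) lac_term k s + x s ^+ k0 * csum (fun l => inner k0 l s)).
split; last by move=> s; rewrite -nrm_x; exact: lac_tends.
move=> z; apply: meroD.
  apply: mero_sum => k; apply: dv_mero => w.
  have -> : lac_term k = (fun w => (fun=> b ^+ k) w * (fun w => cexp (- toC (ln (c + Q ^ k)%N%:R) * w + 0)) w).
    by apply/funext => v; rewrite /lac_term /natpow -cexpN; congr (_ * cexp _); rewrite addr0 mulNr; congr (- _); exact: mulrC.
  exact: (dvM (dv_cst _ _) (dv_cexp _ _ _)).
apply: meroM (mero_tail z); apply: dv_mero => w.
have -> : x = (fun w => (fun=> b) w * (fun w => cexp (a * w + 0)) w).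
  by apply/funext => v; rewrite /x addr0.
exact: (dvX _ (dvM (dv_cst _ _) (dv_cexp _ _ _))).
Qed.

End Lacunary.

(** * The von Mangoldt function *)

Section PrimePowers.
Variables (F : finFieldType) (K : fieldExtType {fraction {poly F}}).
Notation q := #|F|.

(** By [effN_growth] the quotient of [effN K n] by q^n G2 - G1 has period e from n0 on, so it is
    bounded by its sum over one period. *)
Lemma effN_bound : exists B : nat, forall n, (effN K n <= B * q ^ n)%N.
Proof.
have [e [n0 [G1 [G2 [e0 G20 hG hr]]]]] := effN_growth K.
pose x n := (q ^ n * G2 - G1)%N.
have x0 n : (n0 <= n)%N -> (0 < x n)%N by move=> nn; rewrite subn_gt0 hG.
pose A := (\sum_(i < e) effN K (n0 + i))%N.
have hA n : (effN K (n0 + n) <= A * x (n0 + n))%N.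
  elim: n {-2}n (leqnn n) => [|m IH] n nm; have [ne|en] := ltnP n e.
  - apply: (@leq_trans A); last by rewrite leq_pmulr // x0 // leq_addr.
    by rewrite /A (bigD1 (Ordinal ne)) //= leq_addr.
  - lia.
  - apply: (@leq_trans A); last by rewrite leq_pmulr // x0 // leq_addr.
    by rewrite /A (bigD1 (Ordinal ne)) //= leq_addr.
  - have n'm : (n - e <= m)%N by lia.
    have := hr (n0 + (n - e))%N (leq_addr _ _); rewrite -addnA subnK // -!/(x _) => e1.
    have xp := x0 (n0 + (n - e))%N (leq_addr _ _).
    rewrite -(leq_pmul2r xp) -e1 mulnAC leq_mul2r; apply/orP; right.
    exact: IH.
exists (A * G2 + \sum_(i < n0) effN K i)%N => n.
have qn : (0 < q ^ n)%N by rewrite expn_gt0 (ltnW (q_gt1 F)).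
have [nn|nn] := ltnP n n0.
  apply: leq_trans (_ : (\sum_(i < n0) effN K i) * q ^ n <= _)%N; last first.
    by rewrite leq_mul2r leq_addl orbT.
  apply: leq_trans (_ : effN K n * q ^ n <= _)%N; first exact: leq_pmulr.
  by rewrite leq_mul2r (bigD1 (Ordinal nn)) //= leq_addr orbT.
have := hA (n - n0)%N; rewrite subnKC // => h; apply: leq_trans h _.
apply: (@leq_trans (A * (q ^ n * G2))); first by rewrite leq_mul2l leq_subr orbT.
by rewrite [(q ^ n * G2)%N]mulnC mulnA leq_mul2r leq_addr orbT.
Qed.

Lemma primeN_le k : (primeN K k <= k * effN K k)%N.
Proof.
rewrite effN_primeN; case: k => [|k].
  rewrite big_geq // leqn0; apply/eqP; rewrite /primeN big1_seq // => P.
  by rewrite in_places_le leqn0 => /andP[_ /eqP ->].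
by rewrite big_nat_recr //= subnn effN0 muln1 leq_addl.
Qed.

Lemma primeN_exponential (E : numClosedFieldType) : exists t : seq E, exists c : E -> E,
  [/\ uniq t, forall z, z \in t -> c z != 0 &
   forall k, (0 < k)%N -> (primeN K k)%:R = \sum_(z <- t) c z * z ^+ k].
Proof.
have [e [n0 [G1 [G2 [e0 G20 hG hr]]]]] := effN_growth K.
pose a n : E := (effN K n)%:R; pose Qe : E := (q ^ e)%:R.
pose Q : {poly E} := 1 - (1 + Qe) *: 'X^e + Qe *: 'X^(e + e).
have Q0 : Q`_0 = 1.
  rewrite /Q !coefD coefN !coefZ !coefXn coef1.
  have -> : (0 == e)%N = false by lia.
  have -> : (0 == e + e)%N = false by lia.
  by rewrite !mulr0 subr0 addr0.
(* The numbers u_n = q^n G2 - G1 satisfy this recurrence, and along steps of e the a_n are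
   proportional to them. *)
have rec n : (n0 <= n)%N -> a (n + e + e)%N = (1 + Qe) * a (n + e)%N - Qe * a n.
  move=> nn; pose u n : E := (q ^ n * G2)%:R - G1%:R.
  have uE m : (n0 <= m)%N -> (q ^ m * G2 - G1)%:R = u m by move=> nm; rewrite natrB // ltnW // hG.
  have ne : (n0 <= n + e)%N by rewrite (leq_trans nn) // leq_addr.
  have nee : (n0 <= n + e + e)%N by rewrite (leq_trans ne) // leq_addr.
  have u0 : u (n + e)%N != 0.
    by rewrite -uE // pnatr_eq0 -lt0n subn_gt0 hG.
  have e1 := congr1 (fun m : nat => m%:R : E) (hr n nn).
  have e2 := congr1 (fun m : nat => m%:R : E) (hr _ ne).
  rewrite /= !natrM !uE // -!/(a _) in e1 e2.
  have e3 : u (n + e + e)%N = (1 + Qe) * u (n + e)%N - Qe * u n.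
    rewrite /u /Qe !expnD !natrM; ring.
  apply: (mulIf u0); rewrite -e2 e3.
  have -> : ((1 + Qe) * a (n + e)%N - Qe * a n) * u (n + e)%N =
     (1 + Qe) * a (n + e)%N * u (n + e)%N - Qe * (a n * u (n + e)%N) by ring.
  rewrite e1; ring.
have aQ n : (n0 + e + e <= n)%N -> \sum_(i < n.+1) a i * Q`_(n - i) = 0.
  move=> nn; pose A := \poly_(i < n.+1) a i.
  have Ai i : (i <= n)%N -> A`_i = a i by move=> ni; rewrite coef_poly ltnS ni.
  transitivity ((A * Q)`_n).
    by rewrite coefM; apply: eq_bigr => i _; rewrite Ai // -ltnS.
  have -> : A * Q = A - (1 + Qe) *: (A * 'X^e) + Qe *: (A * 'X^(e + e)).
    by rewrite /Q mulrDr mulrBr mulr1 -!scalerAr.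
  rewrite !coefD coefN !coefZ !coefMXn !ltnNge.
  have -> : (e <= n)%N by lia.
  have -> : (e + e <= n)%N by lia.
  rewrite /= !Ai ?leq_subr //.
  have := rec (n - (e + e))%N; rewrite -addnA subnK; last by lia.
  have -> : (n - (e + e) + e = n - e)%N by lia.
  move=> ->; [ring | lia].
have aN n : a n *+ n = \sum_(1 <= k < n.+1) (primeN K k)%:R * a (n - k)%N.
  rewrite -[a n *+ n]mulr_natl /a -natrM effN_primeN natr_sum.
  by apply: eq_bigr => k _; rewrite natrM.
have a0 : a 0%N = 1 by rewrite /a effN0.
have [s1 [s2 hs]] := exponential_sum a0 Q0 aQ aN.
have [t [c [ut c0 tc]]] := merge_sums s1 s2.
by exists t, c; split=> // k k0; rewrite hs.
Qed.

Variable R : realType.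
Local Notation C := (Cplx R).

(** The linear factor is absorbed by the larger ratio w = y (1 + d), still below 1, as (1 + d)^k >=
    1 + d k. *)
Lemma linear_geo (y : R) : 0 < y < 1 -> exists2 B : R, 0 <= B &
  exists2 w : R, 0 <= w < 1 & forall k, k.+1%:R * y ^+ k <= B * w ^+ k.
Proof.
move=> /andP[y0 y1]; pose d := (y^-1 - 1) / 2.
have yi : 1 < y^-1 by rewrite invf_gt1.
have d0 : 0 < d by rewrite divr_gt0 // subr_gt0.
pose w := y * (1 + d).
have w0 : 0 < w by rewrite mulr_gt0 // ltr_wpDr // ltW.
have w1 : w < 1.
  have : y * y^-1 = 1 by rewrite mulfV // gt_eqF.
  by rewrite /w /d; move: (y^-1) yi => v v1 e; nra.
have bern k : 1 + d * k%:R <= (1 + d) ^+ k.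
  elim: k => [|k IH]; first by rewrite mulr0 addr0.
  rewrite exprS; have h : 0 <= 1 + d by lra.
  apply: le_trans (ler_wpM2l h IH); rewrite -addn1 natrD.
  have : 0 <= (k%:R : R) by []. move: (k%:R : R) => x x0; nra.
exists (1 + d^-1); first by rewrite addr_ge0 // invr_ge0 ltW.
exists w; first by rewrite ltW.
move=> k; rewrite /w exprMn mulrCA [leLHS]mulrC; apply: ler_wpM2l; first by rewrite exprn_ge0 // ltW.
have h : 0 <= 1 + d^-1 by rewrite addr_ge0 // invr_ge0 ltW.
apply: le_trans (ler_wpM2l h (bern k)); rewrite -addn1 natrD.
have e : d^-1 * d = 1 by rewrite mulVf // gt_eqF.
have : 0 <= (k%:R : R) by [].
have : 0 < d^-1 by rewrite invr_gt0.
move: (d^-1) e (k%:R : R) => v e x v0 x0; nra.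
Qed.

Lemma primeN_sum_bounded : exists t : seq C, exists c : C -> C,
  (forall k, (0 < k)%N -> (primeN K k)%:R = \sum_(z <- t) c z * z ^+ k) /\
  forall z, z \in t -> nrm z <= q%:R.
Proof.
have [t [c [ut c0 tc]]] := primeN_exponential C; exists t, c; split=> // z zt.
(* c_z z^k is a fixed linear combination of N_k, N_(k+1), ..., hence O(k q^k), which is impossible
   for |z| > q as c_z is nonzero. *)
have [B hB] := effN_bound; have [p hp] := isolate_term c ut zt.
have q0 : 0 < (q%:R : R) by rewrite ltr0n (ltnW (q_gt1 F)).
rewrite leNgt; apply/negP => qz.
have z0 : 0 < nrm z by exact: lt_trans qz.
pose y := q%:R / nrm z.
have y01 : 0 < y < 1 by rewrite divr_gt0 //= ltr_pdivrMr // mul1r.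
pose D : R := \sum_(i < size p) nrm p`_i * (B%:R * q%:R ^+ i * i.+1%:R).
have le k : (0 < k)%N -> nrm (c z) * nrm z ^+ k <= D * (k.+1%:R * q%:R ^+ k).
  move=> k0; rewrite -nrmX -nrmM hp mulr_suml; apply: le_trans (nrm_sum _ _ _) _.
  apply: ler_sum => i _; rewrite nrmM -mulrA ler_wpM2l ?nrm_ge0 //.
  rewrite -tc ?addn_gt0 ?k0 // nrmn.
  have h : (primeN K (k + i) <= B * q ^ i * i.+1 * (k.+1 * q ^ k))%N.
    apply: leq_trans (primeN_le _) _; apply: leq_trans (leq_mul (leqnn _) (hB _)) _.
    rewrite expnD; move: (q ^ i)%N (q ^ k)%N => u v.
    have -> : (B * u * i.+1 * (k.+1 * v) = (i.+1 * k.+1) * (B * (v * u)))%N by lia.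
    by rewrite leq_mul2r; apply/orP; right; nia.
  by move: h; rewrite -(ler_nat R) !natrM !natrX.
have le' k : (0 < k)%N -> nrm (c z) <= D * (k.+1%:R * y ^+ k).
  move=> /le; rewrite -ler_pdivlMr ?exprn_gt0 // => h; apply: le_trans h _.
  by rewrite /y exprMn exprVn !mulrA.
have [M M0 [w w01 hw]] := linear_geo y01.
have cz : 0 < nrm (c z) by rewrite nrm_gt0 c0.
have [N hN] := small_pow (`|D| * M) w01 cz.
have := le' _ (ltn0Sn N); apply/negP; rewrite -ltNge.
apply: le_lt_trans (hN _ (leqnSn N)); apply: le_trans (_ : `|D| * (N.+2%:R * y ^+ N.+1) <= _).
  rewrite ler_wpM2r ?ler_norm // mulr_ge0 // exprn_ge0 //; by case/andP: y01 => /ltW.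
by rewrite -mulrA ler_wpM2l.
Qed.

Lemma multipleE h (P Q : place K) : multiple h P Q = if Q == P then h else 0%N.
Proof. by rewrite /multiple fsfunE inE. Qed.

Lemma degree_multiple h (P : place K) : div_degree (multiple h P) = (h * place_degree P)%N.
Proof.
have -> : multiple h P = add_mult [fsfun with 0%N] h P.
  apply/fsfunP => Q; rewrite multipleE add_multE fsfun0E add0n.
  by case: eqP; rewrite ?muln1 ?muln0.
by rewrite degree_add_mult /div_degree finsupp0 big_seq_fset0.
Qed.

Lemma multiple_inj h h' (P P' : place K) : (0 < h)%N -> multiple h P = multiple h' P' -> P = P'.
Proof.
move=> h0 e; have := congr1 (fun D : effdiv K => D P) e; rewrite /= !multipleE eqxx.
by case: eqP => // _ h00; rewrite h00 in h0.
Qed.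

Lemma von_mangoldt_multiple h (P : place K) : (0 < h)%N ->
  von_mangoldt R (multiple h P) = (place_degree P)%:R * ln q%:R.
Proof.
move=> h0; have E (Q : place K) : ln (div_norm (multiple 1 Q))%:R = (place_degree Q)%:R * ln q%:R :> R.
  rewrite /div_norm degree_multiple mul1n natrX lnXn ?mulr_natl //.
  by rewrite ltr0n (ltnW (q_gt1 F)).
rewrite /von_mangoldt; apply: xget_unique; first by exists P, h; split.
by move=> y [P' [h' [h'0 e ->]]]; rewrite E (multiple_inj h0 e).
Qed.

Lemma von_mangoldt_eq0 (A : effdiv K) :
  (forall (P : place K) h, (0 < h)%N -> A <> multiple h P) -> von_mangoldt R A = 0.
Proof. by move=> H; apply: xgetPN => y [P [h [h0 e _]]]; exact: H h0 e. Qed.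

Definition mangoldt_sum k : R := \sum_(A <- eff K k) von_mangoldt R A.

Lemma mangoldt_sum0 : mangoldt_sum 0 = 0.
Proof.
rewrite /mangoldt_sum big1_seq // => A /andP[_]; rewrite in_eff => /eqP A0.
apply: von_mangoldt_eq0 => P h h0 e; move: A0; rewrite e degree_multiple => /eqP.
by rewrite muln_eq0 (gtn_eqF h0) (gtn_eqF (place_degree_gt0 P)).
Qed.

(** A place whose degree divides k has exactly one multiple of degree k; all other divisors of
    degree k contribute 0. *)
Lemma mangoldt_sumE k : (0 < k)%N -> mangoldt_sum k = ln q%:R * (primeN K k)%:R.
Proof.
move=> k0; pose T := [fset P in places_le K k | (place_degree P %| k)%N]%fset.
pose m (P : place K) := multiple (k %/ place_degree P) P.
have mT P : P \in T -> (0 < k %/ place_degree P)%N /\ (k %/ place_degree P * place_degree P = k)%N.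
  rewrite !inE in_places_le => /andP[Pk dk]; split; last exact: divnK.
  by rewrite divn_gt0 // place_degree_gt0.
have Tk : (m @` T `<=` eff K k)%fset.
  apply/fsubsetP => A /imfsetP[P /= PT ->]; rewrite in_eff degree_multiple.
  by have [_ ->] := mT P PT.
rewrite /mangoldt_sum -(big_fset_incl _ Tk); last first.
  move=> A; rewrite in_eff => /eqP Ak AT; apply: von_mangoldt_eq0 => P h h0 e.
  move/negP: AT; apply; apply/imfsetP; exists P => /=; last first.
    by rewrite /m -Ak e degree_multiple mulnK // place_degree_gt0.
  rewrite !inE in_places_le -Ak e degree_multiple dvdn_mull // andbT.
  by rewrite leq_pmull.
rewrite big_imfset /=; last by move=> P P' /mT[h0 _] _ /(multiple_inj h0).
rewrite /primeN natr_sum mulr_sumr [RHS]big_fset_condE /=.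
apply: eq_big_seq => P PT; have [h0 _] := mT P PT.
by rewrite von_mangoldt_multiple // mulrC.
Qed.

Lemma finite_degree_lt n : finite_set [set A : effdiv K | (div_degree A < n)%N].
Proof.
have fU : finite_set (\bigcup_(i in setT) @Eff F K (nat_of_ord (i : 'I_n))).
  by apply: bigcup_finite => // i _; exact: finite_Eff.
by apply: sub_finite_set fU => A /= An; exists (Ordinal An).
Qed.

Lemma sum_degree_lt (n : nat) (f : effdiv K -> R) (g : nat -> R) :
  \sum_(A \in [set A : effdiv K | (div_degree A < n)%N]) f A * g (div_degree A) =
  \sum_(k < n) (\sum_(A <- eff K k) f A) * g k.
Proof.
pose D := [set A : effdiv K | (div_degree A < n)%N].
have fD : finite_set D := finite_degree_lt n.
rewrite (fsbig_finite _ _ fD) /=.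
transitivity (\sum_(A <- fset_set D) \sum_(k < n) (div_degree A == k)%:R * (f A * g k)).
  apply: eq_big_seq => A; rewrite in_fset_set // inE => An.
  rewrite (bigD1 (Ordinal An)) //= eqxx mul1r big1 ?addr0 // => i iA.
  by case: eqP => [e|]; rewrite ?mul0r //; move: iA; rewrite -val_eqE /= e eqxx.
rewrite exchange_big /=; apply: eq_bigr => k _; rewrite mulr_suml.
have kD : (eff K k `<=` fset_set D)%fset.
  apply/fsubsetP => A; rewrite in_eff in_fset_set // inE /= => /eqP Ak.
  by rewrite /D /= Ak ltn_ord.
rewrite -(big_fset_incl _ kD); last first.
  by move=> A _; rewrite in_eff => /negPf ->; rewrite mul0r.
by apply: eq_big_seq => A; rewrite in_eff => ->; rewrite mul1r.
Qed.

End PrimePowers.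

(** * The coefficients of the Dirichlet series as a convolution *)

Section Convolution.
Variables (R : realType) (F1 : finFieldType) (K1 : fieldExtType {fraction {poly F1}}).
Variables (F2 : finFieldType) (K2 : fieldExtType {fraction {poly F2}}).

(** As d < q^d, a pair whose norms add up to n has degrees below N. The index set is thus cut out of
    a finite product, over which the sum splits by degrees. *)
Lemma G2FF_sum (n N : nat) : (n <= N)%N -> G2FF R K1 K2 n =
  \sum_(k1 < N) \sum_(k2 < N) (#|F1| ^ k1 + #|F2| ^ k2 == n)%N%:R *
    (mangoldt_sum K1 R k1 * mangoldt_sum K2 R k2).
Proof.
move=> nN; pose D1 := [set A : effdiv K1 | (div_degree A < N)%N].
pose D2 := [set A : effdiv K2 | (div_degree A < N)%N].
pose V (A : effdiv K1 * effdiv K2) := (div_norm A.1 + div_norm A.2 == n)%N.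
rewrite /G2FF (_ : [set A | _] = (D1 `*` D2) `&` [set A | V A]); last first.
  apply/seteqP; split=> [[A1 A2] /= e|[A1 A2] [_ /eqP]//].
  split; last by apply/eqP.
  have h1 := ltn_expl (div_degree A1) (q_gt1 F1); have h2 := ltn_expl (div_degree A2) (q_gt1 F2).
  move: e; rewrite /div_norm /= => e; split; rewrite /D1 /D2 /=.
    by move: h1 e; move: (_ ^ _)%N (_ ^ _)%N => u v; lia.
  by move: h2 e; move: (_ ^ _)%N (_ ^ _)%N => u v; lia.
rewrite fsbig_mkcondr.
pose g A1 A2 : R := von_mangoldt R A1 * ((V (A1, A2))%:R * von_mangoldt R A2).
transitivity (\sum_(p \in D1 `*` D2) g p.1 p.2).
  apply: eq_fsbigr => -[A1 A2] _ /=; rewrite /g /V /=.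
  case: ifP => [|/negbT]; rewrite ?inE /=; first by move=> ->; rewrite mul1r.
  by rewrite notin_setE /= => /negP/negPf ->; rewrite mul0r mulr0.
rewrite -(pair_fsbig _ g (finite_degree_lt K1 N) (finite_degree_lt K2 N)).
transitivity (\sum_(A1 \in D1) von_mangoldt R A1 * (fun k1 => \sum_(k2 < N)
   mangoldt_sum K2 R k2 * (#|F1| ^ k1 + #|F2| ^ k2 == n)%N%:R) (div_degree A1)).
  apply: eq_fsbigr => A1 _; rewrite -mulr_fsumr; congr (_ * _).
  rewrite -(sum_degree_lt _ (von_mangoldt R) (fun k2 => (#|F1| ^ div_degree A1 + #|F2| ^ k2 == n)%N%:R)).
  by apply: eq_fsbigr => A2 _; rewrite mulrC.
rewrite (sum_degree_lt _ (von_mangoldt R) (fun k1 => \sum_(k2 < N)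
   mangoldt_sum K2 R k2 * (#|F1| ^ k1 + #|F2| ^ k2 == n)%N%:R)).
apply: eq_bigr => k1 _; rewrite mulr_sumr; apply: eq_bigr => k2 _.
by rewrite -/(mangoldt_sum K1 R k1) mulrA mulrC.
Qed.

(** A partial sum over n becomes a double sum over the region q_1^k1 + q_2^k2 < N, the shape of
    [dsum]; degree 0 drops out because the von Mangoldt function vanishes at the zero divisor. *)
Lemma G2FF_partial_sum (N : nat) (f : nat -> Cplx R) :
  \sum_(1 <= n < N) toC (G2FF R K1 K2 n) * f n =
  \sum_(1 <= k1 < N) \sum_(1 <= k2 < N | (#|F1| ^ k1 + #|F2| ^ k2 < N)%N)
    toC (mangoldt_sum K1 R k1) * toC (mangoldt_sum K2 R k2) * f (#|F1| ^ k1 + #|F2| ^ k2)%N.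
Proof.
pose g k1 k2 : Cplx R := toC (mangoldt_sum K1 R k1) * toC (mangoldt_sum K2 R k2).
transitivity (\sum_(1 <= n < N) \sum_(0 <= k1 < N) \sum_(0 <= k2 < N)
   (#|F1| ^ k1 + #|F2| ^ k2 == n)%N%:R * (g k1 k2 * f n)).
  apply: eq_big_nat => n /andP[_ nN]; rewrite (G2FF_sum (ltnW nN)) /toC.
  rewrite (rmorph_sum (real_complex R)) mulr_suml big_mkord; apply: eq_bigr => k1 _.
  rewrite (rmorph_sum (real_complex R)) mulr_suml big_mkord; apply: eq_bigr => k2 _.
  by rewrite [RHS]mulrA /g -toCM -toCn -toCM.
rewrite exchange_big /=.
have g0 k1 k2 : (k1 == 0%N) || (k2 == 0%N) -> g k1 k2 = 0.
  by case/orP => /eqP ->; rewrite /g mangoldt_sum0 toC0 ?mul0r ?mulr0.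
have drop0 (h : nat -> Cplx R) : h 0%N = 0 -> \sum_(0 <= k < N) h k = \sum_(1 <= k < N) h k.
  move=> h0; case: N => [|N']; first by rewrite !big_geq.
  by rewrite big_ltn // h0 add0r.
rewrite drop0; last first.
  by rewrite big1 // => n _; rewrite big1 // => k2 _; rewrite g0 // mul0r mulr0.
apply: eq_big_nat => k1 /andP[k10 k1N]; rewrite exchange_big /= drop0; last first.
  by rewrite big1 // => n _; rewrite g0 ?orbT // mul0r mulr0.
rewrite [RHS]big_mkcond; apply: eq_big_nat => k2 /andP[k20 k2N] /=.
set m := (_ + _)%N; have m0 : (0 < m)%N by rewrite addn_gt0 expn_gt0 (ltnW (q_gt1 F1)).
transitivity (\sum_(1 <= n < N | n == m) g k1 k2 * f n).
  rewrite [RHS]big_mkcond; apply: eq_bigr => n _; rewrite eq_sym.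
  by case: eqP; rewrite ?mul1r ?mul0r.
by rewrite big_nat1_eq m0.
Qed.

End Convolution.

(** * Double series *)

Section DoubleSums.
Variable R : realType.
Local Notation C := (Cplx R).
Implicit Types (z w s l : C).

Lemma sum_downward_closed (f : nat -> C) (P : pred nat) (a N : nat) :
  (forall k, P k.+1 -> P k) -> exists2 M : nat,
  \sum_(a <= k < N | P k) f k = \sum_(a <= k < M) f k & forall K, (K < N)%N -> P K -> (K < M)%N.
Proof.
move=> PS; have Pm k d : P (k + d)%N -> P k by elim: d => [|d IH]; rewrite ?addn0 // addnS => /PS/IH.
elim: N => [|N [M eM hM]].
  by exists 0%N => //; rewrite !big_geq.
have [PN|PN] := boolP (P N); last first.
  exists M => [|k].
    have [aN|aN] := leqP a N; last by rewrite -eM !big_geq // ltnW.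
    by rewrite big_mkcond big_nat_recr //= -big_mkcond (negPf PN) addr0.
  rewrite ltnS leq_eqVlt => /orP[/eqP ->|]; [by rewrite (negPf PN) | exact: hM].
exists N.+1 => //; rewrite big_mkcond /=; apply: eq_big_nat => k /andP[_ kN].
by rewrite (Pm k (N - k)%N) // subnKC.
Qed.

(** The cutoff keeps an initial segment of the indices, whose length grows beyond all bounds with
    N. *)
Lemma tends_cutoff (f : nat -> C) l (c Q a : nat) : (1 < Q)%N ->
  tends (fun M => \sum_(a <= k < M) f k) l ->
  tends (fun N => \sum_(a <= k < N | (c + Q ^ k < N)%N) f k) l.
Proof.
move=> Q1 H e e0; have [M0 hM0] := H e e0; exists (c + Q ^ M0).+1 => N hN.
have [|M -> hM] := @sum_downward_closed f (fun k => c + Q ^ k < N)%N a N.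
  move=> k; apply: leq_ltn_trans; rewrite leq_add2l leq_exp2l //.
apply/hM0/ltnW/hM => //; apply: leq_ltn_trans hN.
by apply: leq_trans (leq_addl _ _); apply/ltnW/ltn_expl.
Qed.

Lemma tends_bounded u l : tends u l -> exists2 D : R, 0 <= D & forall n, nrm (u n - l) <= D.
Proof.
move=> /(_ 1 ltr01)[N hN].
have S0 : 0 <= \sum_(i < N) nrm (u i - l) by apply: sumr_ge0 => i _; exact: nrm_ge0.
exists (1 + \sum_(i < N) nrm (u i - l)); first by rewrite addr_ge0.
move=> n; have [nN|/hN/ltW h] := ltnP n N; last by apply: le_trans h _; rewrite lerDl.
rewrite (bigD1 (Ordinal nN)) //= addrCA lerDl addr_ge0 //.
by apply: sumr_ge0 => i _; exact: nrm_ge0.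
Qed.

(** L = l / (1 - k) satisfies L = l + k L, so the error of P at N is at most the error of E plus |k|
    times the error of P at about N / m. This first bounds the errors, and then each iteration gains
    a factor |k|. *)
Lemma tends_contraction (E P : nat -> C) (k l : C) (m : nat) : (1 < m)%N -> nrm k < 1 ->
  tends E l -> (forall N, P N = E N + k * P (N.-1 %/ m).+1) -> tends P (l / (1 - k)).
Proof.
move=> m1 k1 El PE; have [D D0 hD] := tends_bounded El.
have k1' : 1 - k != 0.
  by rewrite subr_eq0; apply/eqP => e; move: k1; rewrite -e nrm1 ltxx.
set L := l / (1 - k); have LE : L = l + k * L by rewrite /L; field.
have dE N : nrm (P N - L) <= nrm (E N - l) + nrm k * nrm (P (N.-1 %/ m).+1 - L).
  rewrite -nrmM; apply: le_trans (nrmD _ _); rewrite le_eqVlt; apply/orP; left; apply/eqP.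
  by congr nrm; rewrite {1}PE {1}LE; ring.
have nk := nrm_ge0 k.
have h1 : 0 < 1 - nrm k by rewrite subr_gt0.
(* At N = 0 and N = 1 the recursion does not lead to a smaller index, so these two errors are put
   into the bound. *)
pose B := D / (1 - nrm k) + nrm (P 0%N - L) + nrm (P 1%N - L).
have B0 : 0 <= D / (1 - nrm k) by rewrite divr_ge0 // ltW.
have BP N : nrm (P N - L) <= B.
  elim: N {-2}N (leqnn N) => [|N0 IH] N; rewrite /B.
    rewrite leqn0 => /eqP ->; have := nrm_ge0 (P 1%N - L); lra.
  move=> NN; have [N2|N2] := ltnP 1 N; last first.
    case: N NN N2 => [|[|//]] _ _; have := nrm_ge0 (P 1%N - L); have := nrm_ge0 (P 0%N - L); lra.
  have lt : ((N.-1 %/ m).+1 <= N0)%N.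
    have : (N.-1 %/ m < N.-1)%N by apply: ltn_Pdiv => //; lia.
    lia.
  apply: le_trans (dE N) _.
  have := ler_wpM2l nk (IH _ lt); have := hD N; rewrite -/B.
  have e : D / (1 - nrm k) * (1 - nrm k) = D by rewrite divfK // gt_eqF.
  have := nrm_ge0 (P 1%N - L); have := nrm_ge0 (P 0%N - L).
  rewrite /B; move: e; move: (D / _) => d; move: h1 nk.
  by move: (nrm (P 0%N - L)) (nrm (P 1%N - L)) (nrm k) => x y z; nra.
have B00 : 0 <= B by exact: le_trans (nrm_ge0 _) (BP 0%N).
move=> e e0; have e2 : 0 < e / 2 * (1 - nrm k) by rewrite mulr_gt0 // divr_gt0.
have [N1 hN1] := El _ e2.
have step j : exists Nj : nat, forall N, (Nj <= N)%N -> nrm (P N - L) <= e / 2 + B * nrm k ^+ j.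
  elim: j => [|j [Nj hj]].
    by exists 0%N => N _; apply: le_trans (BP N) _; rewrite mulr1 lerDr ltW // divr_gt0.
  exists (maxn N1 (m * Nj).+1) => N; rewrite geq_max => /andP[NN1 NNj].
  have /hj h : (Nj <= (N.-1 %/ m).+1)%N.
    by rewrite ltnW // ltnS leq_divRL ?(ltnW m1) // mulnC -ltnS prednK // (leq_trans _ NNj).
  apply: le_trans (dE N) _; have := ltW (hN1 _ NN1); have := ler_wpM2l nk h.
  rewrite exprS; move: (nrm k ^+ j) (nrm (P _ - L)) (nrm (E N - l)) => x y z; lra.
have k01 : 0 <= nrm k < 1 by rewrite nk.
have e20 : 0 < e / 2 by rewrite divr_gt0.
have [j hj] := small_pow B k01 e20; have [Nj hNj] := step j.
by exists Nj => N /hNj h; apply: le_lt_trans h _; have := hj j (leqnn j); lra.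
Qed.

Lemma natpowM (m n : nat) s : (0 < m)%N -> (0 < n)%N -> natpow (m * n) s = natpow m s * natpow n s.
Proof.
move=> m0 n0; rewrite /natpow -cexpD -mulrDr natrM lnM ?posrE ?ltr0n //.
by rewrite -!/(toC _) toCD.
Qed.

(** The square serves the ratio of the two-scale shift, whose numerator is bounded by q_1^r2 q_2^r1
    = m^2; this is how the half-plane Re s > 2 comes in. *)
Lemma nrm_power_small (z s : C) (Q : nat) : (1 < Q)%N -> nrm z <= Q%:R ^+ 2 ->
  2 < complex.Re s -> nrm z * expR (- ln Q%:R * complex.Re s) < 1.
Proof.
move=> Q1 zQ s2; have Q0 : 0 < (Q%:R : R) by rewrite ltr0n ltnW.
have lnQ : 0 < ln (Q%:R : R) by rewrite ln_gt0 // ltr1n.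
have e1 : (Q%:R : R) ^+ 2 = expR (ln Q%:R * 2) by rewrite [ln _ * 2]mulrC expRM_natl lnK // posrE.
apply: (@le_lt_trans _ _ (expR (ln Q%:R * 2) * expR (- ln Q%:R * complex.Re s))).
  by rewrite ler_wpM2r ?expR_ge0 // -e1.
rewrite -expRD -[ltRHS]expR0 ltr_expR mulNr -mulrBr pmulr_rlt0 //; lra.
Qed.

Section TwoScales.
Variables (p r1 r2 : nat) (A B : C).
Hypotheses (p1 : (1 < p)%N) (r10 : (0 < r1)%N) (r20 : (0 < r2)%N).
Notation q1 := (p ^ r1)%N.
Notation q2 := (p ^ r2)%N.
Notation m := (p ^ (r1 * r2))%N.
Hypotheses (Aq : nrm A <= q1%:R) (Bq : nrm B <= q2%:R).

Let q11 : (1 < q1)%N. Proof. by rewrite -(exp1n r1) ltn_exp2r. Qed.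
Let q21 : (1 < q2)%N. Proof. by rewrite -(exp1n r2) ltn_exp2r. Qed.
Let m1 : (1 < m)%N. Proof. by rewrite -(exp1n (r1 * r2)) ltn_exp2r // muln_gt0 r10. Qed.

Lemma sum_nat_widen (f : nat -> C) (a N T : nat) : (N <= T)%N ->
  (forall k, (N <= k)%N -> f k = 0) -> \sum_(a <= k < N) f k = \sum_(a <= k < T) f k.
Proof.
move=> NT f0; have z (b : nat) : (N <= b)%N -> \sum_(b <= k < T) f k = 0.
  by move=> Nb; rewrite big_nat big1 // => k /andP[bk _]; rewrite f0 // (leq_trans Nb).
have [aN|Na] := leqP a N; first by rewrite [RHS](big_cat_nat aN NT) /= z // addr0.
by rewrite big_geq ?z // ltnW.
Qed.

Definition dterm s k1 k2 : C := A ^+ k1 * B ^+ k2 / natpow (q1 ^ k1 + q2 ^ k2) s.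

Definition dsum s N : C :=
  \sum_(1 <= k1 < N) \sum_(1 <= k2 < N | (q1 ^ k1 + q2 ^ k2 < N)%N) dterm s k1 k2.

(** The pairs not reached by the shift: the whole strip k1 <= r2, then the strip k2 <= r1 without
    the overlap. *)
Definition edge s N : C :=
  \sum_(1 <= k1 < r2.+1) A ^+ k1 *
    \sum_(1 <= k2 < N | (q1 ^ k1 + q2 ^ k2 < N)%N) lac_term q2 (q1 ^ k1) B k2 s +
  \sum_(1 <= k2 < r1.+1) B ^+ k2 *
    \sum_(r2.+1 <= k1 < N | (q2 ^ k2 + q1 ^ k1 < N)%N) lac_term q1 (q2 ^ k2) A k1 s.

Definition ratio s : C := A ^+ r2 * B ^+ r1 / natpow m s.

Lemma dterm_shift s k1 k2 : dterm s (k1 + r2) (k2 + r1) = ratio s * dterm s k1 k2.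
Proof.
rewrite /dterm /ratio.
have -> : (q1 ^ (k1 + r2) + q2 ^ (k2 + r1) = m * (q1 ^ k1 + q2 ^ k2))%N.
  by rewrite !expnD -!expnM [(r2 * r1)%N]mulnC; lia.
rewrite natpowM ?addn_gt0 ?expn_gt0 ?(ltnW p1) //.
by rewrite !exprD invfM; ring.
Qed.

Lemma dsum_widen s N T : (N <= T)%N -> dsum s N =
  \sum_(1 <= k1 < T) \sum_(1 <= k2 < T) (q1 ^ k1 + q2 ^ k2 < N)%N%:R * dterm s k1 k2.
Proof.
move=> NT; have far k1 k2 : (N <= k1)%N || (N <= k2)%N -> (q1 ^ k1 + q2 ^ k2 < N)%N = false.
  have := ltn_expl k1 q11; have := ltn_expl k2 q21.
  by move: (q1 ^ k1)%N (q2 ^ k2)%N => u v; lia.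
have wid (a : nat) (f : nat -> C) := @sum_nat_widen f a N T NT.
rewrite /dsum wid; last first.
  move=> k1 Nk; rewrite big_mkcond big1 // => k2 _; by rewrite far ?Nk.
apply: eq_bigr => k1 _; rewrite big_mkcond wid; last first.
  by move=> k2 Nk; rewrite far ?Nk ?orbT.
by apply: eq_bigr => k2 _; case: ifP; rewrite ?mul1r ?mul0r.
Qed.

(** The shift multiplies u = q_1^k1 + q_2^k2 by m, and for u > 0 the condition m u < N means u < (N
    - 1) / m + 1 with integer division. *)
Lemma dsum_rec s N : dsum s N = edge s N + ratio s * dsum s (N.-1 %/ m).+1.
Proof.
(* A common size for all truncated sums; the rectangle of sides T + r2 and T + r1 loses its edges
   and becomes the square of side T under the shift. *)
pose T := (N + r1 + r2).+1.
pose g k1 k2 : C := (q1 ^ k1 + q2 ^ k2 < N)%N%:R * dterm s k1 k2.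
have far k1 k2 : (N <= k1)%N || (N <= k2)%N -> g k1 k2 = 0.
  rewrite /g; have := ltn_expl k1 q11; have := ltn_expl k2 q21.
  move: (dterm s k1 k2); move: (q1 ^ k1)%N (q2 ^ k2)%N => u v d h1 h2 h.
  by rewrite (_ : (u + v < N)%N = false) ?mul0r //; lia.
have wid (a T1 T2 : nat) (f : nat -> C) : (N <= T1)%N -> (N <= T2)%N ->
    (forall k, (N <= k)%N -> f k = 0) ->
    \sum_(a <= k < T1) f k = \sum_(a <= k < T2) f k.
  by move=> N1 N2 f0; rewrite -(sum_nat_widen _ N1 f0) (sum_nat_widen _ N2 f0).
have r2T : (r2.+1 <= T + r2)%N by rewrite /T; lia.
have r1T : (r1.+1 <= T + r1)%N by rewrite /T; lia.
have NT : (N <= T)%N by rewrite /T; lia.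
have NTr1 : (N <= T + r1)%N by rewrite /T; lia.
have NTr2 : (N <= T + r2)%N by rewrite /T; lia.
have -> : dsum s N = \sum_(1 <= k1 < T + r2) \sum_(1 <= k2 < T + r1) g k1 k2.
  rewrite (dsum_widen s NT) (@wid _ _ (T + r2)%N) //; last first.
    by move=> k1 Nk; rewrite big1 // => k2 _; apply: (far k1 k2); rewrite Nk.
  apply: eq_bigr => k1 _; apply: wid => // k2 Nk; apply: (far k1 k2); by rewrite Nk orbT.
rewrite (big_cat_nat (isT : (1 <= r2.+1)%N) r2T) /=.
rewrite [X in _ + X](eq_bigr (fun k1 => \sum_(1 <= k2 < r1.+1) g k1 k2 +
   \sum_(r1.+1 <= k2 < T + r1) g k1 k2)); last first.
  by move=> k1 _; rewrite (big_cat_nat (isT : (1 <= r1.+1)%N) r1T).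
rewrite big_split /= addrA; congr (_ + _).
  congr (_ + _).
    apply: eq_bigr => k1 _; rewrite mulr_sumr [RHS]big_mkcond (@wid _ _ N) //; last first.
      by move=> k2 Nk; rewrite far ?Nk ?orbT.
    apply: eq_bigr => k2 _; rewrite /g /lac_term /dterm.
    by case: ifP; rewrite ?mul1r ?mul0r // mulrA.
  rewrite exchange_big /=; apply: eq_bigr => k2 _; rewrite mulr_sumr [RHS]big_mkcond (@wid _ _ N) //; last first.
    by move=> k1 Nk; rewrite far ?Nk.
  apply: eq_bigr => k1 _; rewrite /g /lac_term /dterm addnC.
  by case: ifP; rewrite ?mul1r ?mul0r // mulrCA mulrA.
rewrite (@dsum_widen s _ T); last by rewrite /T; have := leq_div N.-1 m; lia.
rewrite -[r2.+1]add1n big_addn addnK mulr_sumr; apply: eq_bigr => k1 _.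
rewrite -[r1.+1]add1n big_addn addnK mulr_sumr; apply: eq_bigr => k2 _.
have e : (q1 ^ (k1 + r2) + q2 ^ (k2 + r1) = (q1 ^ k1 + q2 ^ k2) * m)%N.
  by rewrite !expnD -!expnM [(r2 * r1)%N]mulnC; lia.
rewrite /g dterm_shift mulrCA e ltnS leq_divRL ?(ltnW m1) //.
have : (0 < (q1 ^ k1 + q2 ^ k2) * m)%N by rewrite muln_gt0 addn_gt0 !expn_gt0 !(ltnW p1).
move: (_ * m)%N => u u0; congr (_ * (_ * _)); congr (nat_of_bool _)%:R; lia.
Qed.

Lemma two_scale_continuation : exists Psi : C -> C, meromorphic Psi /\
  forall s, 2 < complex.Re s -> tends (dsum s) (Psi s).
Proof.
have [F1 hF1] := choice (fun k => @lacunary_continuation R q2 (q1 ^ k) B 1 q21).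
have [F2 hF2] := choice (fun k => @lacunary_continuation R q1 (q2 ^ k) A r2.+1 q11).
pose a : C := - toC (ln m%:R).
pose E s := \sum_(1 <= k1 < r2.+1) A ^+ k1 * F1 k1 s + \sum_(1 <= k2 < r1.+1) B ^+ k2 * F2 k2 s.
have ratioE s : ratio s = A ^+ r2 * B ^+ r1 * cexp (a * s).
  by rewrite /ratio /natpow -cexpN; congr (_ * cexp _); rewrite /a mulNr; congr (- _); exact: mulrC.
(* The solution of [dsum_rec] in the limit, with [edge] replaced by its continuation. *)
exists (fun s => E s * (1 - ratio s)^-1); split.
  move=> z; apply: (@meroM _ E (fun s => (1 - ratio s)^-1)).
    apply: meroD; apply: mero_sum => k.
      exact: (meroM (mero_cst _ z) ((hF1 k).1 z)).
    exact: (meroM (mero_cst _ z) ((hF2 k).1 z)).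
  have -> : (fun s => (1 - ratio s)^-1) = (fun s => (1 - (A ^+ r2 * B ^+ r1) * cexp (a * s))^-1).
    by apply/funext => s; rewrite ratioE.
  apply: mero_inv_1Bexp; rewrite oppr_eq0 -toC0 (inj_eq (@toC_inj R)) gt_eqF //.
  by rewrite ln_gt0 // ltr1n.
move=> s s2; apply: (@tends_contraction (edge s) _ _ _ m m1); last exact: dsum_rec.
  rewrite ratioE nrmM nrm_cexp.
  have -> : complex.Re (a * s) = - ln m%:R * complex.Re s.
    by rewrite /a cReM cReN cImN /= oppr0 mul0r subr0.
  apply: nrm_power_small m1 _ s2.
  rewrite nrmM !nrmX expr2 -natrM.
  have -> : (m * m)%N%:R = (q1%:R ^+ r2 * q2%:R ^+ r1) :> R.
    by rewrite -!natrX -natrM -!expnM [(r2 * r1)%N]mulnC.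
  by apply: ler_pM; rewrite ?exprn_ge0 ?nrm_ge0 // lerXn2r ?nnegrE ?nrm_ge0 ?ler0n.
have sq (Q : nat) (x : R) : (0 < Q)%N -> x <= Q%:R -> x <= Q%:R ^+ 2.
  move=> Q0 xQ; apply: le_trans xQ _; rewrite expr2 ler_peMl //.
  by rewrite ler1n.
apply: tendsD; apply: tends_sum => k; apply: tendsMl; apply: tends_cutoff => //.
  by apply: (hF1 k).2; apply: nrm_power_small => //; apply: sq => //; exact: ltnW.
by apply: (hF2 k).2; apply: nrm_power_small => //; apply: sq => //; exact: ltnW.
Qed.

End TwoScales.
End DoubleSums.

Theorem theorem1 (R : realType)
    (F1 : finFieldType) (K1 : fieldExtType {fraction {poly F1}})
    (F2 : finFieldType) (K2 : fieldExtType {fraction {poly F2}})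
    (p1 r1 p2 r2 : nat)
    (p1_prime : prime p1) (cardF1 : #|F1| = (p1 ^ r1)%N)
    (p2_prime : prime p2) (cardF2 : #|F2| = (p2 ^ r2)%N)
    (p1_eq_p2 : p1 = p2) :
  exists Phi : Cplx R -> Cplx R,
    meromorphic Phi /\
    forall s : Cplx R, 2 < complex.Re s -> dirichlet_cvg (G2FF R K1 K2) s (Phi s).
Proof.
have p1_gt1 := prime_gt1 p1_prime.
have r1_gt0 : (0 < r1)%N.
  by have := q_gt1 F1; rewrite cardF1; case: (r1) => //; rewrite expn0.
have r2_gt0 : (0 < r2)%N.
  by have := q_gt1 F2; rewrite cardF2; case: (r2) => //; rewrite expn0.
have [t1 [c1 [N1 b1]]] := primeN_sum_bounded K1 R.
have [t2 [c2 [N2 b2]]] := primeN_sum_bounded K2 R.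
(* Continuations are chosen for all pairs of complex numbers at once; pairs outside these bounds get
   the zero function. *)
pose ok (A B : Cplx R) := nrm A <= (p1 ^ r1)%:R /\ nrm B <= (p1 ^ r2)%:R.
have [Psi hPsi] : {Psi : Cplx R * Cplx R -> Cplx R -> Cplx R & forall x, ok x.1 x.2 ->
    meromorphic (Psi x) /\ forall s, 2 < complex.Re s -> tends (dsum p1 r1 r2 x.1 x.2 s) (Psi x s)}.
  apply: (@choice _ _ (fun x (Psi : Cplx R -> Cplx R) => ok x.1 x.2 -> meromorphic Psi /\
    forall s, 2 < complex.Re s -> tends (dsum p1 r1 r2 x.1 x.2 s) (Psi s))) => -[A B] /=.
  have [[okA okB]|nok] := pselect (ok A B); last by exists (fun=> 0).
  by have [Psi ?] := two_scale_continuation p1_gt1 r1_gt0 r2_gt0 okA okB; exists Psi.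
pose g (A B : Cplx R) : Cplx R := toC (ln #|F1|%:R) * toC (ln #|F2|%:R) * c1 A * c2 B.
pose T := [seq (A, B) | A <- t1, B <- t2].
have Tok x : x \in T -> ok x.1 x.2.
  move=> /allpairsP[[A B] /= [At1 Bt2 ->]]; split=> /=.
    by have := b1 A At1; rewrite cardF1.
  by have := b2 B Bt2; rewrite cardF2 p1_eq_p2.
exists (fun s => \sum_(x <- T) g x.1 x.2 * Psi x s); split.
  move=> z; elim: T Tok => [|x T IH] Tok.
    rewrite (_ : (fun s => _) = fun=> 0); first exact: mero_cst.
    by apply/funext => s; rewrite big_nil.
  have [mx _] := hPsi x (Tok x (mem_head _ _)).
  rewrite (_ : (fun s => _) = fun s => g x.1 x.2 * Psi x s + \sum_(x <- T) g x.1 x.2 * Psi x s).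
    apply: meroD; first exact: (meroM (mero_cst _ z) (mx z)).
    by apply: IH => y yT; apply: Tok; rewrite inE yT orbT.
  by apply/funext => s; rewrite big_cons.
move=> s s2; apply: tends_cvg.
(* For each N the partial sum is exactly a finite combination of truncated double sums. *)
apply: (@tends_ext _ (fun N => \sum_(x <- T) g x.1 x.2 * dsum p1 r1 r2 x.1 x.2 s N)).
  exists 0%N => N _; rewrite (G2FF_partial_sum K1 K2 N (fun n => (natpow n s)^-1)).
  rewrite /T big_allpairs_dep /=.
  under eq_bigr do under eq_bigr do rewrite mulr_sumr.
  under eq_bigr do rewrite exchange_big /=.
  rewrite exchange_big /=; apply: eq_big_nat => k1 /andP[k10 _].
  under eq_bigr do under eq_bigr do rewrite mulr_sumr.
  under eq_bigr do rewrite exchange_big /=.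
  rewrite exchange_big /= cardF1 cardF2 -p1_eq_p2 big_nat_cond [RHS]big_nat_cond.
  apply: eq_bigr => k2 /andP[/andP[k20 _] _].
  rewrite !mangoldt_sumE // !toCM !toCn N1 // N2 //.
  transitivity (toC (ln #|F1|%:R) * toC (ln #|F2|%:R) / natpow ((p1 ^ r1) ^ k1 + (p1 ^ r2) ^ k2) s *
      ((\sum_(z <- t1) c1 z * z ^+ k1) * \sum_(z <- t2) c2 z * z ^+ k2)); last by ring.
  rewrite mulr_suml mulr_sumr; apply: eq_bigr => A _.
  rewrite mulr_sumr mulr_sumr; apply: eq_bigr => B _.
  by rewrite /g /dterm; ring.
elim: T Tok => [|x T IH] Tok.
  by rewrite big_nil; under eq_fun do rewrite big_nil; exact: tends_cst.
rewrite big_cons; under eq_fun do rewrite big_cons.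
apply: tendsD; last by apply: IH => y yT; apply: Tok; rewrite inE yT orbT.
by apply: tendsMl; apply: (hPsi x _).2 => //; apply: Tok; exact: mem_head.
Qed.
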